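(* Let $(M,\varphi_i,\xi_i,\eta_i,g)$ be a $3$-$(\alpha,\delta)$-Sasaki manifold with canonical submersion $\pi\colon M\to N$, let $\mathcal{R}$ be the curvature operator of its canonical connection, let $\mathcal{R}^{g_N}$ be the Riemannian curvature operator of $(N,g_N)$, and let $\beta=2(\delta-2\alpha)$. (a) If $\mathcal{R}^{g_N}\geq 0$ (non-negative), then $\mathcal{R}$ is non-negative if and only if $\alpha\beta\geq 0$. (b) If $\mathcal{R}^{g_N}\leq 0$ (non-positive), then $\mathcal{R}$ is non-positive.
   Context: An almost contact metric structure $(\varphi,\xi,\eta,g)$ consists of a $(1,1)$-tensor $\varphi$, a vector field $\xi$, a $1$-form $\eta$ and a Riemannian metric $g$ with $\varphi^2=-I+\eta\otimes\xi$, $\eta(\xi)=1$, $\varphi\xi=0$, $\eta\circ\varphi=0$, $g(\varphi X,\varphi Y)=g(X,Y)-\eta(X)\eta(Y)$; its fundamental $2$-form is $\Phi(X,Y)=g(X,\varphi Y)$. An almost $3$-contact metric manifold $(M,\varphi_i,\xi_i,\eta_i,g)$, $i=1,2,3$, is a manifold of dimension $4n+3$ ($n\ge1$) with three almost contact metric structures sharing $g$ such that $\varphi_k=\varphi_i\varphi_j-\eta_j\otimes\xi_i=-\varphi_j\varphi_i+\eta_i\otimes\xi_j$, $\xi_k=\varphi_i\xi_j=-\varphi_j\xi_i$, $\eta_k=\eta_i\circ\varphi_j=-\eta_j\circ\varphi_i$ for every even permutation $(ijk)$ of $(123)$. Then $TM=\mathcal{H}\oplus\mathcal{V}$ orthogonally,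 $\mathcal{V}=\langle\xi_1,\xi_2,\xi_3\rangle$, $\mathcal{H}=\bigcap_i\ker\eta_i$. It is $3$-$(\alpha,\delta)$-Sasaki, for real constants $\alpha\ne0$ and $\delta$, if $d\eta_i=2\alpha\Phi_i+2(\alpha-\delta)\eta_j\wedge\eta_k$ for every even permutation $(ijk)$, with $d\eta(X,Y)=X\eta(Y)-Y\eta(X)-\eta([X,Y])$ and $(\eta\wedge\zeta)(X,Y)=\eta(X)\zeta(Y)-\eta(Y)\zeta(X)$. Put $\beta=2(\delta-2\alpha)$. The canonical connection $\nabla$ is the unique metric connection with totally skew-symmetric torsion $T$ satisfying $\nabla_X\varphi_i=\beta(\eta_k(X)\varphi_j-\eta_j(X)\varphi_k)$ for all $X$ and all even permutations $(ijk)$; it satisfies $\nabla T=0$. Curvature: $R(X,Y,Z,V)=g([\nabla_X,\nabla_Y]Z-\nabla_{[X,Y]}Z,V)$, which is pair symmetric, and the curvature operator $\mathcal{R}\colon\Lambda^2TM\to\Lambda^2TM$ is the symmetric operator $\langle\mathcal{R}(X\wedge Y),Z\wedge V\rangle=-R(X,Y,Z,V)$, where $\langle u_1\wedge u_2,v_1\wedge v_2\rangle=\det[g(u_i,v_j)]$. The same conventions define $R^{g_N}$ and $\mathcal{R}^{g_N}$ from the Levi-Civita connection of $(N,g_N)$. Non-negative/non-positive means positive/negative semidefinite at every point. Canonical submersion (known): $M$ admits a locally defined Riemannian submersion $\pi\colon(M,g)\to(N,g_N)$ with fibers tangent to $\mathcal{V}$ and $\nabla^{g_N}_XY=\pi_*(\nabla_{\overline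 X}\overline Y)$, where $\overline X$ is the horizontal lift; $N$ carries a quaternionic Kähler structure locally given by $\check\varphi_i=\pi_*\circ\varphi_i\circ s_*$ for sections $s$ of $\pi$, with scalar curvature $16n(n+2)\alpha\delta$. *)

(* Defs.v *)
From HB Require Import structures.
From mathcomp Require Import all_boot all_order all_algebra all_fingroup.
From mathcomp Require Import all_classical all_reals all_analysis ring lra.

Set Implicit Arguments.
Unset Strict Implicit.
Unset Printing Implicit Defensive.

Import Order.TTheory GRing.Theory Num.Theory.
Import numFieldNormedType.Exports.
Local Open Scope classical_set_scope.
Local Open Scope ring_scope.

(** * Smooth manifolds

    A tangent vector at [p] is represented by its column of components in the
    chart [chart p] chosen at [p]; tensors at [p] are matrices in the same
    basis. The preferred chart may jump with [p], so smoothness of tensor fields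
    is never tested on these components, but on components in a fixed chart, or
    on smooth vector fields. *)

(** [Ck k O f]: [f] is of class C^k on the open set [O]. *)
Fixpoint Ck (R : realType) (V W : normedModType R) (k : nat) (O : set V)
    (f : V -> W) : Prop :=
  (forall x, O x -> {for x, continuous f}) /\
  if k is k'.+1 then
    forall v, (forall x, O x -> derivable f x v) /\ Ck k' O (fun x => 'D_v f x)
  else True.

Definition Cinf (R : realType) (V W : normedModType R) (O : set V)
  (f : V -> W) : Prop := forall k, Ck k O f.

Record manifold (R : realType) (m : nat) := Manifold {
  carrier :> topologicalType;
  mf_hausdorff : hausdorff_space carrier;
  mf_second_countable : @second_countable carrier;
  chart_dom : carrier -> set carrier;
  chart : carrier -> carrier -> 'cV[R]_m;
  chartV : carrier -> 'cV[R]_m -> carrier;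
  chart_dom_open : forall p, open (chart_dom p);
  chart_dom_mem : forall p, chart_dom p p;
  img_open : forall p, open (chart p @` chart_dom p);
  chartK : forall p q, chart_dom p q -> chartV p (chart p q) = q;
  chart_cont : forall p q, chart_dom p q -> {for q, continuous (chart p)};
  chartV_cont : forall p x, (chart p @` chart_dom p) x ->
    {for x, continuous (chartV p)};
  transition_smooth : forall p q,
    Cinf (chart p @` (chart_dom p `&` chart_dom q)) (chart q \o chartV p)
}.

Section Calculus.
Variables (R : realType) (m : nat) (M : manifold R m).

Definition vfield := M -> 'cV[R]_m.

Definition smooth_on (W : normedModType R) (U : set M) (F : M -> W) : Prop :=
  forall p, Cinf (chart p @` (chart_dom p `&` U)) (F \o chartV p).

Definition smooth_at (W : normedModType R) (p : M) (F : M -> W) : Prop :=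
  exists2 U, open_nbhs p U & smooth_on U F.

Definition dir (W : normedModType R) (p : M) (v : 'cV[R]_m) (F : M -> W) : W :=
  'D_v (F \o chartV p) (chart p p).

(** [dir q (X q) (chart p)] is the column of components of [X q] in the fixed
    chart [chart p]. *)
Definition smooth_vf_on (U : set M) (X : vfield) : Prop :=
  forall p, smooth_on (U `&` chart_dom p) (fun q => dir q (X q) (chart p)).

Definition smooth_vf_at (p : M) (X : vfield) : Prop :=
  exists2 U, open_nbhs p U & smooth_vf_on U X.

(** [chart p] being a chart at [p], this says
    [[X, Y] x = X (Y x) - Y (X x)] for its coordinate functions [x]. *)
Definition lie (X Y : vfield) : vfield := fun p =>
  dir p (X p) (fun q => dir q (Y q) (chart p))
  - dir p (Y p) (fun q => dir q (X q) (chart p)).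

Definition ev (a : 'rV[R]_m) (v : 'cV[R]_m) : R := (a *m v) 0 0.
Definition ip (G : 'M[R]_m) (u v : 'cV[R]_m) : R := (u^T *m G *m v) 0 0.

Definition dform (eta : M -> 'rV[R]_m) (X Y : vfield) (p : M) : R :=
  dir p (X p) (fun q => ev (eta q) (Y q))
  - dir p (Y p) (fun q => ev (eta q) (X q))
  - ev (eta p) (lie X Y p).

Definition wedge11 (a b : 'rV[R]_m) (u v : 'cV[R]_m) : R :=
  ev a u * ev b v - ev a v * ev b u.

Definition smooth_1form (eta : M -> 'rV[R]_m) : Prop :=
  forall (U : set M) (X : vfield), open U -> smooth_vf_on U X ->
    smooth_on U (fun q => ev (eta q) (X q)).

Definition smooth_endo (phi : M -> 'M[R]_m) : Prop :=
  forall (U : set M) (X : vfield), open U -> smooth_vf_on U X ->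
    smooth_vf_on U (fun q => phi q *m X q).

Record riemannian_metric (g : M -> 'M[R]_m) : Prop := {
  metric_sym : forall p, (g p)^T = g p;
  metric_pos : forall p v, v != 0 -> 0 < ip (g p) v v;
  metric_smooth : forall (U : set M) (X Y : vfield), open U ->
    smooth_vf_on U X -> smooth_vf_on U Y ->
    smooth_on U (fun q => ip (g q) (X q) (Y q))
}.

(** * Affine connections

    [nabla p v Y] is the covariant derivative at [p] of the (germ at [p] of the)
    vector field [Y] in the direction [v]; its values are only meaningful when
    [Y] is smooth near [p]. *)
Definition connection := forall p : M, 'cV[R]_m -> vfield -> 'cV[R]_m.

Record is_connection (nabla : connection) : Prop := {
  conn_linear : forall p a v w Y, smooth_vf_at p Y ->
    nabla p (a *: v + w) Y = a *: nabla p v Y + nabla p w Y;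
  conn_add : forall p v Y Z, smooth_vf_at p Y -> smooth_vf_at p Z ->
    nabla p v (fun q => Y q + Z q) = nabla p v Y + nabla p v Z;
  conn_leibniz : forall p v (f : M -> R) Y, smooth_at p f -> smooth_vf_at p Y ->
    nabla p v (fun q => f q *: Y q) = dir p v f *: Y p + f p *: nabla p v Y;
  conn_local : forall p v Y Z, smooth_vf_at p Y ->
    (\forall q \near p, Y q = Z q) -> nabla p v Y = nabla p v Z;
  conn_smooth : forall U X Y, open U -> smooth_vf_on U X -> smooth_vf_on U Y ->
    smooth_vf_on U (fun q => nabla q (X q) Y)
}.

Section Connection.
Variable nabla : connection.

Definition cov (X Y : vfield) : vfield := fun p => nabla p (X p) Y.

Definition torsion (X Y : vfield) : vfield := fun p =>
  cov X Y p - cov Y X p - lie X Y p.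

Definition curv (X Y Z : vfield) : vfield := fun p =>
  cov X (cov Y Z) p - cov Y (cov X Z) p - cov (lie X Y) Z p.

Definition cov_endo (X : vfield) (phi : M -> 'M[R]_m) (Y : vfield) : vfield :=
  fun p => cov X (fun q => phi q *m Y q) p - phi p *m cov X Y p.

Definition metric_connection (g : M -> 'M[R]_m) : Prop :=
  forall p X Y Z, smooth_vf_at p X -> smooth_vf_at p Y -> smooth_vf_at p Z ->
    dir p (X p) (fun q => ip (g q) (Y q) (Z q))
    = ip (g p) (cov X Y p) (Z p) + ip (g p) (Y p) (cov X Z p).

(** [torsion] is skew in its two arguments by construction, so this makes
    [g (torsion X Y) Z] a 3-form. *)
Definition skew_torsion (g : M -> 'M[R]_m) : Prop :=
  forall p X Y Z, smooth_vf_at p X -> smooth_vf_at p Y -> smooth_vf_at p Z ->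
    ip (g p) (torsion X Y p) (Z p) = - ip (g p) (torsion X Z p) (Y p).

Record levi_civita (g : M -> 'M[R]_m) : Prop := {
  lc_connection : is_connection nabla;
  lc_metric : metric_connection g;
  lc_torsion : forall p X Y, smooth_vf_at p X -> smooth_vf_at p Y ->
    torsion X Y p = 0
}.

End Connection.

(** * Curvature operator

    Bivectors at [p] are skew-symmetric matrices of contravariant components. *)

Definition skewmx (w : 'M[R]_m) : Prop := w^T = - w.

Definition wedge_vec (u v : 'cV[R]_m) : 'M[R]_m := u *m v^T - v *m u^T.

(** The inner product on bivectors induced by [G]; see [bip_wedge]. *)
Definition bip (G A B : 'M[R]_m) : R := 2^-1 * \tr (A^T *m G *m B *m G^T).

Lemma bip_wedge (G : 'M[R]_m) (u v : 'I_2 -> 'cV[R]_m) :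
  bip G (wedge_vec (u 0) (u 1)) (wedge_vec (v 0) (v 1))
  = \det (\matrix_(i, j) ip G (u i) (v j)).
Proof.
have tr4 (a b c d : 'cV[R]_m) :
    \tr ((a *m b^T)^T *m G *m (c *m d^T) *m G^T) = ip G a c * ip G b d.
  rewrite trmx_mul trmxK /ip.
  have -> : b *m a^T *m G *m (c *m d^T) *m G^T
    = b *m ((a^T *m G *m c) *m (d^T *m G^T)) by rewrite !mulmxA.
  rewrite mxtrace_mulC [in LHS](mx11_scalar (a^T *m G *m c)) mul_scalar_mx.
  rewrite -scalemxAl mxtraceZ trace_mx11; congr (_ * _).
  rewrite -[d^T *m G^T *m b]trmxK mxE; congr (_ 0 0).
  by rewrite !trmx_mul !trmxK mulmxA.
rewrite /bip /wedge_vec.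
have -> (A B C D : 'M[R]_m) : \tr ((A - B)^T *m G *m (C - D) *m G^T) =
    \tr (A^T *m G *m C *m G^T) - \tr (A^T *m G *m D *m G^T)
    - (\tr (B^T *m G *m C *m G^T) - \tr (B^T *m G *m D *m G^T)).
  have -> : (A - B)^T = A^T - B^T by rewrite linearB.
  by rewrite !mulmxBl !(mulmxBr _ C D) !mulmxBl !raddfB.
rewrite !tr4.
rewrite (expand_det_row _ 0) !big_ord_recl big_ord0 /cofactor !det_mx11 !mxE.
have -> : lift (0 : 'I_2) (0 : 'I_1) = 1 by exact: val_inj.
have -> : lift (1 : 'I_2) (0 : 'I_1) = 0 by exact: val_inj.
rewrite /= expr0 expr1 -[ord0]/(0 : 'I_2).
have two0 : 2 != 0 :> R by rewrite pnatr_eq0.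
by field.
Qed.

Section CurvatureOperator.
Variables (g : M -> 'M[R]_m) (nabla : connection) (p : M).

(** [A] is the curvature operator at [p]; only its values on skew-symmetric
    matrices matter. *)
Record is_curvature_operator (A : {linear 'M[R]_m -> 'M[R]_m}) : Prop := {
  co_bivector : forall w, skewmx w -> skewmx (A w);
  co_symmetric : forall w t, skewmx w -> skewmx t ->
    bip (g p) (A w) t = bip (g p) w (A t);
  co_curv : forall X Y Z V, smooth_vf_at p X -> smooth_vf_at p Y ->
    smooth_vf_at p Z -> smooth_vf_at p V ->
    bip (g p) (A (wedge_vec (X p) (Y p))) (wedge_vec (Z p) (V p))
    = - ip (g p) (curv nabla X Y Z p) (V p)
}.

End CurvatureOperator.

Definition curvature_nonneg (g : M -> 'M[R]_m) (nabla : connection) : Prop :=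
  forall p, exists2 A, is_curvature_operator g nabla p A &
    forall w, skewmx w -> 0 <= bip (g p) (A w) w.

Definition curvature_nonpos (g : M -> 'M[R]_m) (nabla : connection) : Prop :=
  forall p, exists2 A, is_curvature_operator g nabla p A &
    forall w, skewmx w -> bip (g p) (A w) w <= 0.

(** * Almost 3-contact metric and 3-(alpha,delta)-Sasaki structures *)

Record almost_contact_metric (phi : M -> 'M[R]_m) (xi : vfield)
    (eta : M -> 'rV[R]_m) (g : M -> 'M[R]_m) : Prop := {
  acm_phi_smooth : smooth_endo phi;
  acm_xi_smooth : smooth_vf_on setT xi;
  acm_eta_smooth : smooth_1form eta;
  acm_metric : riemannian_metric g;
  acm_phi2 : forall p, phi p *m phi p = - 1%:M + xi p *m eta p;
  acm_eta_xi : forall p, ev (eta p) (xi p) = 1;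
  acm_phi_xi : forall p, phi p *m xi p = 0;
  acm_eta_phi : forall p, eta p *m phi p = 0;
  acm_compat : forall p u v, ip (g p) (phi p *m u) (phi p *m v)
    = ip (g p) u v - ev (eta p) u * ev (eta p) v
}.

Definition even3 (i j k : 'I_3) : Prop :=
  exists s : 'S_3, [/\ ~~ odd_perm s, i = s 0, j = s 1 & k = s 2].

Section ThreeContact.
Variables (phi : 'I_3 -> M -> 'M[R]_m) (xi : 'I_3 -> vfield).
Variables (eta : 'I_3 -> M -> 'rV[R]_m) (g : M -> 'M[R]_m).

Record almost_3_contact_metric : Prop := {
  a3_acm : forall i, almost_contact_metric (phi i) (xi i) (eta i) g;
  a3_phi : forall i j k, even3 i j k -> forall p,
    phi k p = phi i p *m phi j p - xi i p *m eta j p /\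
    phi k p = - (phi j p *m phi i p) + xi j p *m eta i p;
  a3_xi : forall i j k, even3 i j k -> forall p,
    xi k p = phi i p *m xi j p /\ xi k p = - (phi j p *m xi i p);
  a3_eta : forall i j k, even3 i j k -> forall p,
    eta k p = eta i p *m phi j p /\ eta k p = - (eta j p *m phi i p)
}.

Definition Phi (i : 'I_3) (p : M) (u v : 'cV[R]_m) : R :=
  ip (g p) u (phi i p *m v).

Record sasaki3 (alpha delta : R) : Prop := {
  s3_a3 : almost_3_contact_metric;
  s3_alpha : alpha != 0;
  s3_deta : forall i j k, even3 i j k -> forall p X Y,
    smooth_vf_at p X -> smooth_vf_at p Y ->
    dform (eta i) X Y p = 2 * alpha * Phi i p (X p) (Y p)
      + 2 * (alpha - delta) * wedge11 (eta j p) (eta k p) (X p) (Y p)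
}.

Record canonical_connection (beta : R) (nabla : connection) : Prop := {
  cc_connection : is_connection nabla;
  cc_metric : metric_connection nabla g;
  cc_torsion : skew_torsion nabla g;
  cc_phi : forall i j k, even3 i j k -> forall p X Y,
    smooth_vf_at p X -> smooth_vf_at p Y ->
    cov_endo nabla X (phi i) Y p
    = beta *: (ev (eta k p) (X p) *: (phi j p *m Y p)
               - ev (eta j p) (X p) *: (phi k p *m Y p))
}.

End ThreeContact.
End Calculus.

(** * Local canonical submersions *)

Section Submersion.
Variables (R : realType) (m d : nat) (M : manifold R m) (N : manifold R d).

Definition tmap (f : M -> N) (p : M) (v : 'cV[R]_m) : 'cV[R]_d :=
  dir p v (fun q => chart (f p) (f q)).

Definition smooth_map_on (U : set M) (f : M -> N) : Prop :=
  (forall p, U p -> {for p, continuous f}) /\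
  forall q, smooth_on (U `&` f @^-1` chart_dom q) (fun p => chart q (f p)).

Definition horizontal (g : M -> 'M[R]_m) (f : M -> N) (p : M)
    (v : 'cV[R]_m) : Prop :=
  forall w, tmap f p w = 0 -> ip (g p) v w = 0.

Record riemannian_submersion_on (U : set M) (g : M -> 'M[R]_m)
    (gN : N -> 'M[R]_d) (f : M -> N) : Prop := {
  rs_smooth : smooth_map_on U f;
  rs_surj : f @` U = setT;
  rs_submersion : forall p w, U p -> exists v, tmap f p v = w;
  rs_isometry : forall p u v, U p -> horizontal g f p u -> horizontal g f p v ->
    ip (gN (f p)) (tmap f p u) (tmap f p v) = ip (g p) u v
}.

(** [Xbar] is the horizontal lift over [U `&` f @^-1` W] of the vector field [X]
    on [W]. *)
Definition horizontal_lift (U : set M) (g : M -> 'M[R]_m) (f : M -> N)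
    (W : set N) (X : vfield N) (Xbar : vfield M) : Prop :=
  forall p, U p -> W (f p) ->
    horizontal g f p (Xbar p) /\ tmap f p (Xbar p) = X (f p).

End Submersion.

(** A canonical submersion defined on an open subset [cs_dom] of [M], together
    with the Levi-Civita connection of its base. *)
Record local_canonical_submersion (R : realType) (m d : nat) (M : manifold R m)
    (xi : 'I_3 -> vfield M) (g : M -> 'M[R]_m) (nabla : connection M) := {
  cs_dom : set M;
  cs_dom_open : open cs_dom;
  cs_base : manifold R d;
  cs_metric : cs_base -> 'M[R]_d;
  cs_metricP : riemannian_metric cs_metric;
  cs_lc : connection cs_base;
  cs_lcP : levi_civita cs_lc cs_metric;
  cs_proj : M -> cs_base;
  cs_projP : riemannian_submersion_on cs_dom g cs_metric cs_proj;
  cs_fibers : forall p v, cs_dom p ->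
    tmap cs_proj p v = 0
    <-> exists a : 'I_3 -> R, v = \sum_i a i *: xi i p;
  cs_nabla : forall (W : set cs_base) (X Y : vfield cs_base)
      (Xbar Ybar : vfield M),
    open W -> smooth_vf_on W X -> smooth_vf_on W Y ->
    horizontal_lift cs_dom g cs_proj W X Xbar ->
    horizontal_lift cs_dom g cs_proj W Y Ybar ->
    forall p, cs_dom p -> W (cs_proj p) ->
      cov cs_lc X Y (cs_proj p) = tmap cs_proj p (cov nabla Xbar Ybar p)
}.

Arguments cs_base {R m d M xi g nabla} _.
Arguments cs_metric {R m d M xi g nabla} _ _.
Arguments cs_lc {R m d M xi g nabla} _ _ _ _.
Arguments cs_proj {R m d M xi g nabla} _ _.

(* Main.v *)
Require Import Defs.
From HB Require Import structures.
From mathcomp Require Import all_boot all_order all_algebra all_fingroup.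
From mathcomp Require Import all_classical all_reals all_analysis ring lra.

Set Implicit Arguments.
Unset Strict Implicit.
Unset Printing Implicit Defensive.

Import Order.TTheory GRing.Theory Num.Theory.
Import numFieldNormedType.Exports.
Local Open Scope classical_set_scope.
Local Open Scope ring_scope.

(** The curvature operator of the canonical connection splits along the canonical
    submersion. For [(i j k)] an even permutation put
    [omega_k = Phi_k - eta_i /\ eta_j], evaluated on bivectors by duality. Then

      [<R w, w> = alpha beta sum_k omega_k(w)^2 + <R^N B, B>],

    where [B] is the orthogonal projection of [pi_* w] off the span of the three
    bivectors dual to the quaternionic structure of the base: this is
    [curvature_operator_split]. If [R^N >= 0] and [alpha beta >= 0], both terms are
    non-negative; conversely [<R (xi_i /\ xi_j), xi_i /\ xi_j> = 4 alpha beta] by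
    [vertical_curvature]. If [R^N <= 0], its value [8 n^2 alpha delta] on one of
    those dual bivectors ([base_operator_value]) shows that [alpha delta <= 0],
    whence [alpha beta = 2 alpha delta - 4 alpha^2 <= 0], and both terms are
    non-positive.

    The curvature is computed on the [xi_i] and on horizontal lifts of vector
    fields of the base. The formula for the derivatives of the [phi_i] determines
    those of the [xi_i] ([cov_xi]), and differentiating these formulas once more
    gives the curvature on the [xi_i] ([Rm_xi]) and its commutators with the
    [phi_i] ([Rm_phi]); both are expressed by the [omega_k]. In particular the
    connection preserves horizontal and vertical vectors. The derivative of a lift
    along another lift is the lift of the derivative on the base ([cov_hl]). The
    derivative along [xi_i] is [- 2 alpha phi_i] ([cov_xi_hl]): since the torsion
    is a 3-form, it can be read off from the vertical part of the bracket of two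
    lifts, which the equation for [d eta_i] prescribes. With the brackets of the
    [xi_i] among themselves and with lifts, this yields the whole curvature
    ([Rm_lift]), namely

      [R = alpha beta sum_k omega_k (x) omega_k
           + pi^* (R^N - 2 alpha delta sum_k Phi_k (x) Phi_k)].

    It remains to understand the last bracket. Comparing [Rm_phi] with the
    curvature of the base gives the commutators of the values of [R^N] with the
    quaternionic structure. Multiplied by another structure endomorphism and
    traced, they show that the three dual bivectors are eigenvectors of [R^N] with
    eigenvalue [4 n alpha delta] ([bip_A_kform]). They have squared length [2 n], so
    the bracket is the operator [R^N] restricted to their orthogonal complement and
    extended by zero ([bip_kproj]).

    The calculus on manifolds behind this is developed from directional derivatives.
    Symmetry of second derivatives ([derive_comm]) makes the bracket the commutator
    of derivations ([lie_dir]), and the chain rule ([chain_rule]) shows that brackets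
    of related fields are related ([brk_related]). Horizontal lifts are smooth
    because their components in a smooth coframe are ([smooth_vf_coframe]), and
    since curvature is a tensor ([crv_tensor]) it may be computed on them. *)

(** * Directional derivatives *)

Lemma continuous_near_eq (R : realType) (V W : normedModType R)
    (f g : V -> W) (x : V) :
  (\forall y \near x, f y = g y) -> {for x, continuous f} ->
  {for x, continuous g}.
Proof.
move=> fg cf; rewrite /prop_for /continuous_at -(nbhs_singleton fg).
exact: cvg_trans (near_eq_cvg fg) cf.
Qed.

Section Directional.
Variables (R : realType) (V : normedModType R).
Implicit Types (f g : V -> R) (x v w : V) (O : set V).

(** Small parallelograms at [x] stay inside [S], so that the mean value theorem
    applies along their sides. *)
Lemma nbhs_box x v w (S : set V) : nbhs x S ->
  \forall t \near (0 : R), forall a b : R, 0 <= a <= 1 -> 0 <= b <= 1 ->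
    S (x + (a * t) *: v + (b * t) *: w).
Proof.
move=> /nbhs_ballP[e /= e0 eS].
have k0 : 0 < `|v| + `|w| + 1 :> R by rewrite ltr_wpDl ?addr_ge0.
exists (e / (`|v| + `|w| + 1)) => /=; first by rewrite divr_gt0.
move=> t; rewrite /= sub0r normrN ltr_pdivlMr // => te a b a01 b01.
apply: eS; rewrite -ball_normE /= -addrA opprD addrA subrr add0r normrN.
apply: le_lt_trans te; rewrite (le_trans (ler_normD _ _)) // !normrZ.
rewrite (@ger0_norm _ a); last lra.
rewrite (@ger0_norm _ b); last lra.
have := normr_ge0 t; have := normr_ge0 v; have := normr_ge0 w.
set p : R := `|w|; set q : R := `|v|; set r : R := `|t| => p0 q0 r0.
have ar : a * r <= r by rewrite ler_piMl//; lra.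
have br : b * r <= r by rewrite ler_piMl//; lra.
have h1 : a * r * q <= r * q by rewrite ler_wpM2r.
have h2 : b * r * p <= r * p by rewrite ler_wpM2r.
lra.
Qed.

Lemma nbhs_segment x (S : set V) : nbhs x S ->
  \forall y \near x, forall a : R, 0 <= a <= 1 -> S (x + a *: (y - x)).
Proof.
move=> /nbhs_ballP[e /= e0 eS]; apply/nbhs_ballP; exists e => //= y.
rewrite -ball_normE /= => xy a a01; case/andP: (a01) => a0 a1; apply: eS.
rewrite -ball_normE /= opprD addrA subrr add0r normrN normrZ ger0_norm //.
by apply: le_lt_trans xy; rewrite distrC ler_piMl.
Qed.

Lemma is_derive_line f x v (t : R) : derivable f (x + t *: v) v ->
  is_derive t (1 : R) (fun s => f (x + s *: v)) ('D_v f (x + t *: v)).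
Proof.
move=> df.
have e : (fun h : R => h^-1 *: ((((fun s : R => f (x + s *: v)) : R -> R)
      \o shift t) (h *: (1 : R)) - f (x + t *: v)))
  = (fun h => h^-1 *: ((f \o shift (x + t *: v)) (h *: v) - f (x + t *: v))).
  apply/funext => h /=; congr (_ *: (f _ - _)).
  by rewrite scalerDl [h%:A]mulr1 addrCA.
apply: DeriveDef; first by rewrite /derivable e.
by rewrite /derive e.
Qed.

Lemma MVT_line f x v :
  (forall t : R, 0 <= t <= 1 -> derivable f (x + t *: v) v) ->
  exists2 t : R, 0 <= t <= 1 & f (x + v) - f x = 'D_v f (x + t *: v).
Proof.
move=> df.
have [||t t01] := @MVT_segment R (fun s => f (x + s *: v))
    (fun s => 'D_v f (x + s *: v)) 0 1 ler01.
- move=> t /[!in_itv]/= t01; apply: is_derive_line; apply: df; lra.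
- apply: derivable_within_continuous => t /[!in_itv]/= t01.
  by have [] := is_derive_line (df _ t01).
rewrite scale1r scale0r addr0 subr0 mulr1 => ->.
by exists t => //; move: t01; rewrite in_itv.
Qed.

Lemma derivableZv f x v (a : R) : derivable f x v ->
  derivable f x (a *: v) /\ 'D_(a *: v) f x = a * 'D_v f x.
Proof.
move=> dv; have d0 : derivable f (x + 0 *: v) v by rewrite scale0r addr0.
have [d1 e1] := is_derive_line d0.
have lin : is_derive (0 : R) (1 : R) (fun s : R => s * a) a.
  by apply: is_derive_eq; rewrite scaler0 add0r [_%:A]mulr1.
have e : (fun h : R => h^-1 *: ((f \o shift x) (h *: (a *: v)) - f x))
  = (fun h => h^-1 *: ((((fun s : R => f (x + s *: v)) \o (fun s : R => s * a)
      : R -> R) \o shift 0) (h *: (1 : R)) - f (x + (0 * a) *: v))).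
  apply/funext => h /=.
  by rewrite mul0r scale0r !addr0 [h%:A]mulr1 scalerA [x + _]addrC.
have [l1 l2] := lin.
have dc : differentiable ((fun s : R => f (x + s *: v)) \o (fun s : R => s * a)) (0:R).
  apply: differentiable_comp; first exact/derivable1_diffP.
  by rewrite mul0r; exact/derivable1_diffP.
have dd : derivable ((fun s : R => f (x + s *: v)) \o (fun s : R => s * a)) (0:R) 1.
  exact/derivable1_diffP.
split; first by rewrite /derivable e.
have -> : 'D_(a *: v) f x
    = 'D_(1 : R) ((fun s : R => f (x + s *: v)) \o (fun s : R => s * a)) (0 : R).
  by rewrite /derive e.
rewrite (deriveE _ dc) diff_comp /=; [|exact/derivable1_diffP|
  by rewrite mul0r; exact/derivable1_diffP].
rewrite mul0r -[X in 'd _ _ X]deriveE; last exact/derivable1_diffP.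
by rewrite l2 deriv1E // derive1E e1 scale0r addr0.
Qed.

End Directional.

(** * Functions of class C^k *)

Section CkGeneral.
Variables (R : realType) (V W : normedModType R).
Implicit Types (f g : V -> W) (O : set V).

Lemma Ck_continuous k O f : Ck k O f -> forall x, O x -> {for x, continuous f}.
Proof. by case: k => [|k] []. Qed.

Lemma CkS_derivable k O f v : Ck k.+1 O f -> forall x, O x -> derivable f x v.
Proof. by move=> [_ /(_ v)[]]. Qed.

Lemma CkS_derive k O f v : Ck k.+1 O f -> Ck k O (fun x => 'D_v f x).
Proof. by move=> [_ /(_ v)[]]. Qed.

Lemma CkW k O f : Ck k.+1 O f -> Ck k O f.
Proof.
elim: k f => [|k ih] f [cf df]; split=> // v.
by have [dv /ih] := df v.
Qed.

Lemma Ck_le k l O f : (k <= l)%N -> Ck l O f -> Ck k O f.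
Proof.
elim: l => [|l ih]; first by rewrite leqn0 => /eqP->.
by rewrite leq_eqVlt => /predU1P[->//|/ih{}ih /CkW].
Qed.

Lemma Ck_subset k O O' f : O' `<=` O -> Ck k O f -> Ck k O' f.
Proof.
move=> sO; elim: k f => [|k ih] f [cf df]; split=> //.
- by move=> x /sO; exact: cf.
- by move=> x /sO; exact: cf.
- by move=> v; have [dv cv] := df v; split; [move=> x /sO; exact: dv|exact: ih].
Qed.

Lemma Ck_cst k O (a : W) : Ck k O (fun=> a).
Proof.
elim: k a => [|k ih] a; split=> //; try by move=> x _; exact: cvg_cst.
move=> v; split; first by move=> x _; exact: derivable_cst.
by have -> : (fun x => 'D_v (fun=> a) x) = (fun=> 0 : W)
  by apply/funext => x; exact: derive_cst.
Qed.

End CkGeneral.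

Section CkOpen.
Variables (R : realType) (V W : normedModType R) (O : set V).
Hypothesis oO : open O.
Implicit Types (f g : V -> W).

Lemma near_open (P : V -> Prop) x : (forall y, O y -> P y) -> O x ->
  \forall y \near x, P y.
Proof. by move=> OP Ox; apply: filterS OP _; exact: open_nbhs_nbhs. Qed.

Lemma eq_derive_open f g v x : (forall y, O y -> f y = g y) -> O x ->
  'D_v f x = 'D_v g x.
Proof. by move=> fg Ox; apply: near_eq_derive; exact: near_open. Qed.

Lemma eq_Ck k f g : (forall x, O x -> f x = g x) -> Ck k O f -> Ck k O g.
Proof.
elim: k f g => [|k ih] f g fg [cf df]; split=> //.
- move=> x Ox; apply: continuous_near_eq (cf _ Ox); exact: near_open.
- move=> x Ox; apply: continuous_near_eq (cf _ Ox); exact: near_open.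
- move=> v; have [dv cv] := df v; split.
    by move=> x Ox; apply: near_eq_derivable (dv _ Ox); exact: near_open.
  by apply: ih cv => x Ox; exact: eq_derive_open.
Qed.

End CkOpen.

Section CkScalar.
Variables (R : realType) (V : normedModType R) (O : set V).
Hypothesis oO : open O.
Implicit Types (f g : V -> R).

Lemma CkD k f g : Ck k O f -> Ck k O g -> Ck k O (fun x => f x + g x).
Proof.
elim: k f g => [|k ih] f g [cf df] [cg dg]; split=> //;
  try by move=> x Ox; apply: cvgD; [exact: cf|exact: cg].
move=> v; have [dfv cfv] := df v; have [dgv cgv] := dg v; split.
  by move=> x Ox; apply: derivableD; [exact: dfv|exact: dgv].
apply: (eq_Ck oO) (ih _ _ cfv cgv) => x Ox.
by rewrite deriveD; [|exact: dfv|exact: dgv].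
Qed.

Lemma CkM k f g : Ck k O f -> Ck k O g -> Ck k O (fun x => f x * g x).
Proof.
elim: k f g => [|k ih] f g Cf Cg; have [cf df] := Cf; have [cg dg] := Cg; split=> //;
  try by move=> x Ox; apply: cvgM; [exact: cf|exact: cg].
move=> v; have [dfv cfv] := df v; have [dgv cgv] := dg v; split.
  by move=> x Ox; apply: derivableM; [exact: dfv|exact: dgv].
apply: (eq_Ck oO) (CkD (ih _ _ (CkW Cf) cgv) (ih _ _ (CkW Cg) cfv)) => x Ox.
by rewrite deriveM; [|exact: dfv|exact: dgv].
Qed.

Lemma CkN k f : Ck k O f -> Ck k O (fun x => - f x).
Proof.
move=> Cf; apply: (eq_Ck oO) (CkM (Ck_cst k O (-1 : R)) Cf) => x _.
by rewrite mulN1r.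
Qed.

Lemma Ck_sum k (I : Type) (s : seq I) (P : pred I) (f : I -> V -> R) :
  (forall i, P i -> Ck k O (f i)) -> Ck k O (fun x => \sum_(i <- s | P i) f i x).
Proof.
move=> Cf; elim: s => [|i s ih].
  by apply: (eq_Ck oO) (Ck_cst k O (0 : R)) => x _; rewrite big_nil.
have [Pi|nPi] := boolP (P i).
  by apply: (eq_Ck oO) (CkD (Cf _ Pi) ih) => x _; rewrite big_cons Pi.
by apply: (eq_Ck oO) ih => x _; rewrite big_cons (negbTE nPi).
Qed.

Lemma CkV k f : (forall x, O x -> f x != 0) -> Ck k O f ->
  Ck k O (fun x => (f x)^-1).
Proof.
move=> f0; elim: k f f0 => [|k ih] f f0 Cf; have [cf df] := Cf; split=> //;
  try by move=> x Ox; apply: cvgV; [exact: f0|exact: cf].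
move=> v; have [dv cv] := df v; split.
  by move=> x Ox; apply: derivableV; [exact: f0|exact: dv].
have C := ih f f0 (CkW Cf).
apply: (eq_Ck oO) (CkN (CkM (CkM C C) cv)) => x Ox.
rewrite deriveV; [|exact: f0|exact: dv].
by rewrite scaleNr expr2 invfM.
Qed.

(** The definition of [Ck] provides derivatives in each direction separately.
    They add up because the increment of [f] along the second leg of the path
    [x], [x + h v], [x + h v + h w] is, by the mean value theorem, a value of
    ['D_w f] near [x], and ['D_w f] is continuous. *)
Lemma deriveDv f x v w : O x -> Ck 1 O f ->
  'D_(v + w) f x = 'D_v f x + 'D_w f x.
Proof.
move=> Ox [cf df].
have Dv := (df v).1 _ Ox; have [Dw Cw] := df w.
have {}Cw := Cw.1 _ Ox.
rewrite [RHS]addrC; apply: cvg_lim => //.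
suff h1 : (fun h : R => h^-1 * (f (x + h *: v + h *: w) - f (x + h *: v)))
    @ 0^' --> 'D_w f x.
  have h2 : (fun h => h^-1 *: ((f \o shift x) (h *: v) - f x)) @ 0^' --> 'D_v f x.
    exact: Dv.
  apply: cvg_trans; last exact: (cvgD h1 h2).
  apply: near_eq_cvg; near=> h; rewrite fctE /=.
  have -> : (h *: (v + w)) + x = x + h *: v + h *: w.
    by rewrite scalerDr addrC addrA.
  by rewrite [h *: v + x]addrC -[h^-1 *: _]/(_ * _) -mulrDr addrA subrK.
apply/cvgrPdist_lt => e e0.
have S : nbhs x [set y | O y /\ `|'D_w f x - 'D_w f y| < e].
  apply: filterI; first exact: open_nbhs_nbhs.
  by move/cvgrPdist_lt: Cw; exact.
have := nbhs_box v w S => near_S; near=> h.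
have hS : forall b : R, 0 <= b <= 1 ->
    O (x + h *: v + (b * h) *: w) /\
    `|'D_w f x - 'D_w f (x + h *: v + (b * h) *: w)| < e.
  move=> b b01.
  have : forall a b : R, 0 <= a <= 1 -> 0 <= b <= 1 ->
    [set y | O y /\ `|'D_w f x - 'D_w f y| < e] (x + (a * h) *: v + (b * h) *: w).
    by near: h; exact: nbhs_dnbhs.
  by move=> /(_ 1 b); rewrite mul1r; apply=> //; rewrite ler01 lexx.
have [|b b01 ->] := @MVT_line _ _ f (x + h *: v) (h *: w).
  move=> b /hS[Ob _]; rewrite scalerA.
  exact: (derivableZv _ (Dw _ Ob)).1.
have [Ob hb] := hS _ b01.
have h0 : h != 0 by near: h; exact: nbhs_dnbhs_neq.
by rewrite scalerA (derivableZv h (Dw _ Ob)).2 mulKf.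
Unshelve. all: by end_near. Qed.

(** Both sides are limits of the second difference quotient of [f] over small
    parallelograms, which is symmetric in [v] and [w]. *)
Lemma derive_comm f x v w : O x -> Ck 2 O f ->
  'D_v (fun y => 'D_w f y) x = 'D_w (fun y => 'D_v f y) x.
Proof.
move=> Ox Cf.
pose quot (h : R) v w := (h * h)^-1 * (f (x + h *: v + h *: w) - f (x + h *: v)
  - (f (x + h *: w) - f x)).
suff lim_quot v' w' : (fun h : R => quot h v' w') @ 0^' -->
    'D_w' (fun y => 'D_v' f y) x.
  have quotC : (fun h : R => quot h v w) @ 0^' --> 'D_v (fun y => 'D_w f y) x.
    apply: cvg_trans; last exact: lim_quot w v.
    apply: near_eq_cvg; near=> h.
    by rewrite /quot; congr (_ * _); rewrite ![_ + h *: w + h *: v]addrAC; ring.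
  rewrite -(cvg_lim (@norm_hausdorff _ _) quotC).
  have quotC' := lim_quot v w.
  by rewrite -(cvg_lim (@norm_hausdorff _ _) quotC').
have [_ /(_ v')[Dv Cv]] := Cf.
have [_ /(_ w')[Dwv Cwv]] := Cv.
have {}Cwv := Cwv.1 _ Ox.
apply/cvgrPdist_lt => e e0.
pose F := fun y => 'D_w' (fun y => 'D_v' f y) y.
have S : nbhs x [set y | O y /\ `|F x - F y| < e].
  apply: filterI; first exact: open_nbhs_nbhs.
  by move/cvgrPdist_lt: Cwv; exact.
have := nbhs_box v' w' S => near_S; near=> h.
have hS : forall a b : R, 0 <= a <= 1 -> 0 <= b <= 1 ->
    [set y | O y /\ `|F x - F y| < e] (x + (a * h) *: v' + (b * h) *: w').
  by near: h; exact: nbhs_dnbhs.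
have h0 : h != 0 by near: h; exact: nbhs_dnbhs_neq.
pose d y := f (y + h *: w') - f y.
have sh y : derivable f (y + h *: w') v' ->
    is_derive y v' (fun y => f (y + h *: w')) ('D_v' f (y + h *: w')).
  have e1 : (fun k : R => k^-1 *: (((fun y => f (y + h *: w')) \o shift y)
      (k *: v') - f (y + h *: w')))
    = (fun k => k^-1 *: ((f \o shift (y + h *: w')) (k *: v') - f (y + h *: w'))).
    by apply/funext => k /=; rewrite addrA.
  by move=> dd; apply: DeriveDef; rewrite /derivable /derive e1.
have one : (0 : R) <= (1 : R) <= (1 : R) by apply/andP; split.
have zero : (0 : R) <= (0 : R) <= (1 : R) by apply/andP; split.
have dd (a : R) : 0 <= a <= 1 -> is_derive (x + (a * h) *: v') v' d
    ('D_v' f (x + (a * h) *: v' + h *: w') - 'D_v' f (x + (a * h) *: v')).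
  move=> a01.
  have [Oy1 _] := hS a 1 a01 one; rewrite mul1r in Oy1.
  have [Oy0 _] := hS a 0 a01 zero; rewrite mul0r scale0r addr0 in Oy0.
  have := sh _ (Dv _ Oy1) => s1.
  have s0 := derivableP (Dv _ Oy0).
  exact: is_deriveB.
(* The mean value theorem along [v'] for the first difference [d], then along
   [w'] for ['D_v' f], turns the quotient into a value of [F] near [x]. *)
have [|a a01] := @MVT_line _ _ d x (h *: v').
  move=> a a01; rewrite scalerA; have [dd' _] := dd _ a01.
  exact: (derivableZv _ dd').1.
rewrite scalerA; have [dd' dE] := dd _ a01; rewrite (derivableZv h dd').2 dE.
have [|b b01] := @MVT_line _ _ (fun y => 'D_v' f y) (x + (a * h) *: v') (h *: w').
  move=> b b01; rewrite scalerA; have [Ob _] := hS _ _ a01 b01.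
  exact: (derivableZv _ (Dwv _ Ob)).1.
have [Ob Fb] := hS _ _ a01 b01.
rewrite scalerA (derivableZv h (Dwv _ Ob)).2 => -> e2.
by rewrite /quot -/(d (x + h *: v')) -/(d x) e2 mulrA mulKf ?mulf_neq0.
Unshelve. all: by end_near. Qed.

End CkScalar.

(** * The chain rule *)

Section CkCol.
Variables (R : realType) (V : normedModType R) (n : nat).
Implicit Types (O : set V) (G : V -> 'cV[R]_n).

Lemma continuous_colP G x :
  {for x, continuous G} <-> forall i, {for x, continuous (fun y => G y i 0)}.
Proof.
split=> [cG i|cG].
  exact: (continuous_comp cG (@coord_continuous _ _ _ i 0 _)).
apply/cvgrPdist_le => /= e e0; near=> y.
rewrite /Num.Def.normr/= mx_normrE (bigmax_le _ (ltW e0))//= => -[i j] _.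
rewrite !mxE ord1 /=; move: i {j}; near: y; apply: filter_forall => /= i.
by have /cvgrPdist_le := cG i; exact.
Unshelve. all: by end_near. Qed.

Lemma derivable_colP G x v :
  derivable G x v <-> forall i, derivable (fun y => G y i 0) x v.
Proof.
split=> [/derivable_mxP dG i|dG]; first exact: dG.
by apply/derivable_mxP => i j; rewrite ord1.
Qed.

Lemma derive_col G x v i : derivable G x v ->
  'D_v G x i 0 = 'D_v (fun y => G y i 0) x.
Proof. by move=> dG; rewrite derive_mx // mxE. Qed.

Lemma Ck_col k O G : open O ->
  Ck k O G <-> forall i, Ck k O (fun x => G x i 0).
Proof.
move=> oO; split.
  elim: k G => [|k ih] G [cG dG] i; split=> //;
    try by move=> x /cG /continuous_colP.
  move=> v; have [dv cv] := dG v; split.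
    by move=> x /dv /derivable_colP.
  apply: (eq_Ck oO) (ih _ cv i) => x Ox.
  by rewrite derive_col //; exact: dv.
elim: k G => [|k ih] G CG; split=> //;
  try by move=> x Ox; apply/continuous_colP => i; have [] := CG i; move=> + _; apply.
move=> v.
have dv x : O x -> derivable G x v.
  by move=> Ox; apply/derivable_colP => i; exact: (CkS_derivable (CG i)).
split=> //; apply: ih => i.
apply: (eq_Ck oO) (CkS_derive v (CG i)) => x Ox.
by rewrite derive_col //; exact: dv.
Qed.

End CkCol.

Lemma col_basis (R : realType) n (v : 'cV[R]_n) :
  v = \sum_i v i 0 *: delta_mx i 0.
Proof.
rewrite [LHS]matrix_sum_delta; apply: eq_bigr => i _.
by rewrite big_ord_recl big_ord0 addr0.
Qed.

Section Chain.
Variables (R : realType) (n : nat).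
Implicit Types (O : set 'cV[R]_n) (f : 'cV[R]_n -> R).

Lemma derive_linear O f x (v w : 'cV[R]_n) a : open O -> O x -> Ck 1 O f ->
  'D_(a *: v + w) f x = a * 'D_v f x + 'D_w f x.
Proof.
move=> oO Ox Cf; rewrite (deriveDv oO) //.
by rewrite (derivableZv a (CkS_derivable Cf Ox)).2.
Qed.

Lemma derive_partial O f x v : open O -> O x -> Ck 1 O f ->
  'D_v f x = \sum_i v i 0 * 'D_(delta_mx i 0) f x.
Proof.
move=> oO Ox Cf; rewrite [in LHS](col_basis v).
elim/big_rec2 : _ => [|i y w _ <-]; first exact: derive0.
exact: derive_linear oO Ox Cf.
Qed.

Variables (V : normedModType R).
Implicit Types (G : V -> 'cV[R]_n).

(** The mean value theorem writes [f (G (x + h v)) - f (G x)] as a derivative of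
    [f] in the direction of the increment of [G], at a point [y h] of the segment
    joining the two images; [y h] tends to [G x], where the partial derivatives
    of [f] are continuous. *)
Lemma chain_rule O f G x v : open O -> O (G x) -> Ck 1 O f ->
    {for x, continuous G} -> derivable G x v ->
  derivable (f \o G) x v /\ 'D_v (f \o G) x = 'D_('D_v G x) f (G x).
Proof.
move=> oO OGx Cf cG dG.
pose D i := 'D_(delta_mx i 0) f.
have cD i : {for G x, continuous (D i)}.
  exact: Ck_continuous (CkS_derive _ Cf) _ OGx.
(* Where the segment leaves [O], [y h] is arbitrary; this does not happen for
   small [h]. *)
have /choice [y yP] : forall h : R, exists y : 'cV[R]_n,
    (forall t : R, 0 <= t <= 1 -> O (G x + t *: (G (h *: v + x) - G x))) ->
    (exists2 t : R, 0 <= t <= 1 & y = G x + t *: (G (h *: v + x) - G x)) /\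
    f (G (h *: v + x)) - f (G x)
      = \sum_i (G (h *: v + x) - G x) i 0 * D i y.
  move=> h.
  have [H|H] := pselect (forall t : R, 0 <= t <= 1 ->
    O (G x + t *: (G (h *: v + x) - G x))); last by exists 0.
  have [|t t01] := @MVT_line _ _ f (G x) (G (h *: v + x) - G x).
    by move=> t /H Ot; exact: CkS_derivable Cf _ Ot.
  rewrite subrKC => fE.
  exists (G x + t *: (G (h *: v + x) - G x)) => _; split; first by exists t.
  by rewrite fE (derive_partial _ oO) //; exact: H.
have cG0 : G (h *: v + x) @[h --> 0^'] --> G x.
  have cl : h *: v + x @[h --> 0^'] --> x.
    have : h *: v + x @[h --> (0 : R)] --> (0 : R) *: v + x.
      by apply: cvgD; [apply: cvgZ; [exact: cvg_id|exact: cvg_cst]|exact: cvg_cst].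
    by rewrite scale0r add0r; exact: cvg_within_filter.
  by apply: (cvg_comp _ _ cl); exact: cG.
have seg (S : set 'cV[R]_n) : nbhs (G x) S -> \forall h \near 0^',
    forall t : R, 0 <= t <= 1 -> S (G x + t *: (G (h *: v + x) - G x)).
  by move=> /nbhs_segment /cG0.
have nO := seg _ (open_nbhs_nbhs (conj oO OGx)).
have ycvg : y h @[h --> 0^'] --> G x.
  move=> S /seg SS; suff : \forall h \near 0^', S (y h) by [].
  near=> h.
  have hO : forall t : R, 0 <= t <= 1 -> O (G x + t *: (G (h *: v + x) - G x)).
    by near: h.
  have [[t t01 ->] _] := yP h hO.
  have : forall t : R, 0 <= t <= 1 -> S (G x + t *: (G (h *: v + x) - G x)).
    by near: h.
  exact.
have lim i : h^-1 * ((G (h *: v + x) - G x) i 0) * D i (y h) @[h --> 0^']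
    --> 'D_v G x i 0 * D i (G x).
  apply: cvgM; last by apply: (cvg_comp _ _ ycvg); exact: cD.
  rewrite derive_col //.
  have /derivable_colP/(_ i) := dG.
  apply: cvg_trans; apply: near_eq_cvg; near=> h.
  by rewrite /= !mxE.
have qlim : h^-1 *: ((f \o G \o shift x) (h *: v) - (f \o G) x) @[h --> 0^']
    --> 'D_('D_v G x) f (G x).
  rewrite (derive_partial _ oO) //.
  apply: cvg_trans; last first.
    exact: (@cvg_big R _ +%R 0 xpredT (@add_continuous _) R _
      (index_enum 'I_n) _ _ _ (fun i _ => lim i)).
  apply: near_eq_cvg; near=> h.
  have hO : forall t : R, 0 <= t <= 1 -> O (G x + t *: (G (h *: v + x) - G x)).
    by near: h.
  have [_ /= ->] := yP h hO.
  by rewrite scaler_sumr; apply: eq_bigr => i _; rewrite -mulrA.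
split; first by apply/cvg_ex; exists ('D_('D_v G x) f (G x)).
exact: cvg_lim qlim.
Unshelve. all: by end_near. Qed.

Lemma Ck_comp k (O : set V) O' f G : open O -> open O' ->
  (forall x, O x -> O' (G x)) -> Ck k O' f -> Ck k O G -> Ck k O (f \o G).
Proof.
move=> oO oO' OG; elim: k f => [|k ih] f Cf CG.
  split=> // x Ox; apply: continuous_comp; first exact: (Ck_continuous CG).
  exact: (Ck_continuous Cf (OG _ Ox)).
have C1 : Ck 1 O' f by exact: Ck_le Cf.
have ch v x : O x -> derivable (f \o G) x v /\
    'D_v (f \o G) x = 'D_('D_v G x) f (G x).
  move=> Ox; apply: (chain_rule oO' (OG x Ox) C1).
    exact: Ck_continuous CG _ Ox.
  exact: CkS_derivable CG _ Ox.
split.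
  move=> x Ox; apply: continuous_comp; first exact: (Ck_continuous CG).
  exact: (Ck_continuous Cf (OG _ Ox)).
move=> v; split; first by move=> x Ox; have [] := ch v x Ox.
apply: (@eq_Ck _ _ _ _ oO _ (fun x =>
    \sum_i 'D_v G x i 0 * ('D_(delta_mx i 0) f \o G) x)).
  move=> x Ox; rewrite (ch v x Ox).2 (derive_partial _ oO') //.
  exact: OG.
apply: Ck_sum => // i _; apply: CkM => //.
  by have /Ck_col := CkS_derive v CG; exact.
by apply: ih; [exact: CkS_derive|exact: CkW].
Qed.

End Chain.

(** * Smooth functions on a manifold *)

Lemma Ck_local (R : realType) (V W : normedModType R) k (O : set V)
    (f : V -> W) :
  (forall x, O x -> exists2 S, open_nbhs x S & Ck k S f) -> Ck k O f.
Proof.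
elim: k f => [|k ih] f H; split=> //.
- by move=> x /H[S [_ Ox] /Ck_continuous]; exact.
- by move=> x /H[S [_ Ox] /Ck_continuous]; exact.
move=> v; split.
  by move=> x /H[S [_ Ox] /CkS_derivable]; exact.
by apply: ih => x /H[S nO /CkS_derive C]; exists S.
Qed.

Section SmoothFunctions.
Variables (R : realType) (m : nat) (M : manifold R m).
Implicit Types (p q : M) (U : set M).

Lemma chartV_chart p : chartV p (chart p p) = p.
Proof. exact: chartK (chart_dom_mem p). Qed.

Lemma cimgP p U x : (chart p @` (chart_dom p `&` U)) x ->
  [/\ chart_dom p (chartV p x), U (chartV p x), chart p (chartV p x) = x
    & (chart p @` chart_dom p) x].
Proof. by move=> [q [dq Uq] <-]; rewrite chartK //; split=> //; exists q. Qed.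

Lemma cimg_mem p q U : chart_dom p q -> U q ->
  (chart p @` (chart_dom p `&` U)) (chart p q).
Proof. by move=> dq Uq; exists q. Qed.

Lemma open_cimg p U : open U -> open (chart p @` (chart_dom p `&` U)).
Proof.
move=> oU; rewrite openE => x /cimgP[dx Ux xE ix].
have n1 : nbhs x (chart p @` chart_dom p).
  by apply: open_nbhs_nbhs; split=> //; exact: img_open.
have n2 : nbhs x (chartV p @^-1` U).
  by apply: (chartV_cont ix); exact: open_nbhs_nbhs.
rewrite /interior; apply: filterS (filterI n1 n2) => y [[q dq <-]] /=.
by rewrite chartK // => Uq; exists q.
Qed.

Lemma nbhs_chartV p q (P : set M) : chart_dom p q -> nbhs q P ->
  nbhs (chart p q) (chartV p @^-1` P).
Proof.
move=> dq nP; apply: (@chartV_cont _ _ _ p _ _); first by exists q.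
by rewrite chartK.
Qed.

Section General.
Variable W : normedModType R.
Implicit Types F G : M -> W.

Lemma smooth_at_near p F : smooth_at p F -> \forall q \near p, smooth_at q F.
Proof.
move=> [U [oU Up] sF]; near=> q; exists U => //; split=> //.
near: q; exact: open_nbhs_nbhs.
Unshelve. all: by end_near. Qed.

Lemma smooth_on_at U F p : open U -> smooth_on U F -> U p -> smooth_at p F.
Proof. by move=> oU sF Up; exists U. Qed.

Lemma smooth_onP U F : open U ->
  smooth_on U F <-> (forall p, U p -> smooth_at p F).
Proof.
move=> oU; split=> [sF p|sF p k]; first exact: smooth_on_at.
apply: Ck_local => x /cimgP[dx Ux xE ix].
have [U' [oU' Ux'] sF'] := sF _ Ux.
exists (chart p @` (chart_dom p `&` U')); last exact: sF'.
by split; [exact: open_cimg|rewrite -xE; exact: cimg_mem].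
Qed.

Lemma smooth_at_Ck p q k F : chart_dom p q -> smooth_at q F ->
  exists O, [/\ open O, O (chart p q), Ck k O (F \o chartV p)
    & forall x, O x -> [/\ chart_dom p (chartV p x), chart p (chartV p x) = x
        & smooth_at (chartV p x) F]].
Proof.
move=> dq [U [oU Uq] sF]; exists (chart p @` (chart_dom p `&` U)); split.
- exact: open_cimg.
- exact: cimg_mem.
- exact: sF.
- by move=> x /cimgP[dx Ux xE _]; split=> //; exists U.
Qed.

Lemma eq_smooth_at p F G : (\forall q \near p, F q = G q) ->
  smooth_at p F -> smooth_at p G.
Proof.
move=> FG [U [oU Up] sF].
exists (U `&` [set q | F q = G q]^°).
  by split; [apply: openI => //; exact: open_interior|split].
move=> q k; apply: (@eq_Ck _ _ _ _ _ k (F \o chartV q)).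
- by apply: open_cimg; apply: openI => //; exact: open_interior.
- by move=> x /cimgP[_ [_ /interior_subset ]].
- by apply: Ck_subset (sF q k) => _ [y [dy [Uy _]] <-]; exists y.
Qed.

(** The smooth transition maps carry smoothness in one chart to the others. *)
Lemma smooth_at_chart p q (O : set 'cV[R]_m) (F : M -> R) : open O ->
  chart_dom p q -> O (chart p q) -> Cinf O (F \o chartV p) -> smooth_at q F.
Proof.
move=> oO dq Oq CF.
pose U := chart_dom p `&` chart p @^-1` O.
have oU : open U.
  rewrite openE => y [dy Oy]; apply: filterI.
    by apply: open_nbhs_nbhs; split=> //; exact: chart_dom_open.
  by apply: (chart_cont dy); exact: open_nbhs_nbhs.
exists U => // r k.
apply: (@eq_Ck _ _ _ _ _ k ((F \o chartV p) \o (chart p \o chartV r))).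
- exact: open_cimg.
- by move=> x /cimgP[_ [dx _] _ _] /=; rewrite chartK.
- apply: (@Ck_comp _ _ _ k _ O) => //.
  + exact: open_cimg.
  + by move=> x /cimgP[_ []].
  + apply: Ck_subset (transition_smooth r p k) => _ [y [dy [py _]] <-].
    by exists y.
Qed.

Lemma smooth_at_cst p (a : W) : smooth_at p (fun=> a).
Proof.
exists setT; first by split=> //; exact: openT.
by move=> q k; exact: Ck_cst.
Qed.

End General.

Implicit Types F G : M -> R.

Lemma smooth_at2 p F G : smooth_at p F -> smooth_at p G ->
  exists2 U, open_nbhs p U & smooth_on U F /\ smooth_on U G.
Proof.
move=> [U [oU Up] sF] [V [oV Vp] sG]; exists (U `&` V).
  by split; [exact: openI|].
by split=> q k; [apply: Ck_subset (sF q k)|apply: Ck_subset (sG q k)];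
  move=> _ [y [dy [Uy Vy]] <-]; exists y.
Qed.

Lemma smooth_atD p F G : smooth_at p F -> smooth_at p G ->
  smooth_at p (fun q => F q + G q).
Proof.
move=> sF sG; have [U [oU Up] [{}sF {}sG]] := smooth_at2 sF sG.
by exists U => // q k; apply: CkD; [exact: open_cimg|exact: sF|exact: sG].
Qed.

Lemma smooth_atM p F G : smooth_at p F -> smooth_at p G ->
  smooth_at p (fun q => F q * G q).
Proof.
move=> sF sG; have [U [oU Up] [{}sF {}sG]] := smooth_at2 sF sG.
by exists U => // q k; apply: CkM; [exact: open_cimg|exact: sF|exact: sG].
Qed.

Lemma smooth_atN p F : smooth_at p F -> smooth_at p (fun q => - F q).
Proof.
move=> [U [oU Up] sF].
by exists U => // q k; apply: CkN; [exact: open_cimg|exact: sF].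
Qed.

Lemma smooth_at_sum p (I : Type) (s : seq I) (P : pred I) (F : I -> M -> R) :
  (forall i, P i -> smooth_at p (F i)) ->
  smooth_at p (fun q => \sum_(i <- s | P i) F i q).
Proof.
move=> sF; elim: s => [|i s ih].
  apply: eq_smooth_at (smooth_at_cst p (0 : R)).
  by apply: nearW => q; rewrite big_nil.
have [Pi|nPi] := boolP (P i).
  apply: eq_smooth_at (smooth_atD (sF _ Pi) ih).
  by apply: nearW => q; rewrite big_cons Pi.
by apply: eq_smooth_at ih; apply: nearW => q; rewrite big_cons (negbTE nPi).
Qed.

Lemma smooth_at_prod p (I : Type) (s : seq I) (F : I -> M -> R) :
  (forall i, smooth_at p (F i)) -> smooth_at p (fun q => \prod_(i <- s) F i q).
Proof.
move=> sF; elim: s => [|i s ih].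
  apply: eq_smooth_at (smooth_at_cst p (1 : R)).
  by apply: nearW => q; rewrite big_nil.
apply: eq_smooth_at (smooth_atM (sF i) ih).
by apply: nearW => q; rewrite big_cons.
Qed.

Lemma smooth_atV p F : (\forall q \near p, F q != 0) -> smooth_at p F ->
  smooth_at p (fun q => (F q)^-1).
Proof.
move=> F0 [U [oU Up] sF].
exists (U `&` [set q | F q != 0]^°).
  by split; [apply: openI => //; exact: open_interior|split].
move=> q k; apply: CkV.
- by apply: open_cimg; apply: openI => //; exact: open_interior.
- by move=> x /cimgP[_ [_ /interior_subset ]].
- by apply: Ck_subset (sF q k) => _ [y [dy [Uy _]] <-]; exists y.
Qed.

Lemma smooth_at_col p n (F : M -> 'cV[R]_n) :
  smooth_at p F <-> forall i, smooth_at p (fun q => F q i 0).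
Proof.
split=> [[U [oU Up] sF] i|sF].
  by exists U => // q k; have /Ck_col := sF q k; apply; exact: open_cimg.
have /choice [U Uo] : forall i, exists U, open_nbhs p U /\
    smooth_on U (fun q => F q i 0) by move=> i; have [U ] := sF i; exists U.
pose V := [set q | forall i, U i q]^°.
have Vp : open_nbhs p V.
  split; first exact: open_interior.
  by apply: filter_forall => i; apply: open_nbhs_nbhs; exact: (Uo i).1.
exists V => // q k; apply/Ck_col => [|i].
  by apply: open_cimg; case: Vp.
apply: Ck_subset ((Uo i).2 q k) => _ [y [dy /interior_subset Vy] <-].
by exists y => //; split=> //; exact: Vy.
Qed.

Lemma smooth_chart p q i : chart_dom p q ->
  smooth_at q (fun q => chart p q i 0).
Proof.
move=> dq; exists (chart_dom p); first by split=> //; exact: chart_dom_open.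
move=> r k.
have /Ck_col := transition_smooth r p k; apply.
by apply: open_cimg; exact: chart_dom_open.
Qed.

End SmoothFunctions.

(** * Tangent vectors as derivations *)

Section Derivations.
#[local] Opaque derive.
Variables (R : realType) (m : nat) (M : manifold R m).
Implicit Types (p q : M) (U : set M) (v w : 'cV[R]_m) (X Y Z : vfield M).

Lemma near_chartV p q : chart_dom p q ->
  \forall x \near chart p q, chart_dom p (chartV p x) /\ chart p (chartV p x) = x.
Proof.
move=> dq; have oc := @open_cimg _ _ M p _ openT.
have : (chart p @` (chart_dom p `&` setT)) (chart p q) by exists q.
move=> /(conj oc) /open_nbhs_nbhs; apply: filterS => x /cimgP[? _ ? _].
by split.
Qed.

Lemma eq_dir (W : normedModType R) p v (F G : M -> W) :
  (\forall q \near p, F q = G q) -> dir p v F = dir p v G.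
Proof.
move=> FG; apply: near_eq_derive.
exact: (nbhs_chartV (chart_dom_mem p) FG).
Qed.

Lemma dir_chart_id p v : dir p v (chart p) = v.
Proof.
rewrite -[RHS](derive_id (chart p p)); apply: near_eq_derive.
by apply: filterS (near_chartV (chart_dom_mem p)) => x [].
Qed.

Implicit Types F G : M -> R.

Lemma smooth_at_derivable p F v : smooth_at p F ->
  derivable (F \o chartV p) (chart p p) v.
Proof.
move=> /(smooth_at_Ck 1 (chart_dom_mem p))[S [oS Sp CF _]].
exact: CkS_derivable CF _ Sp.
Qed.

Lemma dir_linear p a v w F : smooth_at p F ->
  dir p (a *: v + w) F = a * dir p v F + dir p w F.
Proof.
move=> /(smooth_at_Ck 1 (chart_dom_mem p))[S [oS Sp CF _]].
exact: derive_linear oS Sp CF.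
Qed.

Lemma dir0 p F : dir p 0 F = 0.
Proof. exact: derive0. Qed.

Lemma dirZv p a v F : smooth_at p F -> dir p (a *: v) F = a * dir p v F.
Proof. by move=> sF; rewrite -[a *: v]addr0 (dir_linear _ _ _ sF) dir0 addr0. Qed.

Lemma dirDv p v w F : smooth_at p F ->
  dir p (v + w) F = dir p v F + dir p w F.
Proof. by move=> sF; rewrite -[v]scale1r (dir_linear _ _ _ sF) mul1r scale1r. Qed.

Lemma dir_sum p (I : Type) (s : seq I) (P : pred I) (a : I -> R)
    (v : I -> 'cV[R]_m) F : smooth_at p F ->
  dir p (\sum_(i <- s | P i) a i *: v i) F
  = \sum_(i <- s | P i) a i * dir p (v i) F.
Proof.
move=> sF; elim/big_rec2 : _ => [|i y1 y2 _ <-]; first exact: derive0.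
exact: dir_linear.
Qed.

Lemma dirD p v F G : smooth_at p F -> smooth_at p G ->
  dir p v (fun q => F q + G q) = dir p v F + dir p v G.
Proof.
move=> sF sG.
have := deriveD (smooth_at_derivable (v := v) sF) (smooth_at_derivable (v := v) sG).
exact.
Qed.

Lemma dirM p v F G : smooth_at p F -> smooth_at p G ->
  dir p v (fun q => F q * G q) = F p * dir p v G + G p * dir p v F.
Proof.
move=> sF sG.
have := deriveM (smooth_at_derivable (v := v) sF) (smooth_at_derivable (v := v) sG).
rewrite /= chartV_chart; exact.
Qed.

Lemma dir_cst p v (a : R) : dir p v (fun=> a) = 0.
Proof. exact: derive_cst. Qed.

Lemma dir_sum_fun p v (I : Type) (s : seq I) (G : I -> M -> R) :
  (forall i, smooth_at p (G i)) -> dir p v (fun q => \sum_(i <- s) G i q)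
  = \sum_(i <- s) dir p v (G i).
Proof.
move=> sG; elim: s => [|i s ih].
  rewrite [RHS]big_nil -[RHS](dir_cst p v 0); apply: eq_dir; apply: nearW => q.
  by rewrite big_nil.
rewrite big_cons -ih -dirD //; last exact: smooth_at_sum.
by apply: eq_dir; apply: nearW => q; rewrite big_cons.
Qed.

Lemma dir_col p v n (G : M -> 'cV[R]_n) i :
  (forall j, smooth_at p (fun q => G q j 0)) ->
  dir p v G i 0 = dir p v (fun q => G q i 0).
Proof.
move=> sG; rewrite /dir derive_col //; apply/derivable_colP => j.
exact: smooth_at_derivable (sG j).
Qed.

Lemma dir_chart_fun p v (h : 'cV[R]_m -> R) :
  dir p v (fun q => h (chart p q)) = 'D_v h (chart p p).
Proof.
rewrite /dir; apply: near_eq_derive.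
by apply: filterS (near_chartV (chart_dom_mem p)) => x [_ /= ->].
Qed.

Lemma dir_coord p q v i : chart_dom p q ->
  dir q v (chart p) i 0 = dir q v (fun q => chart p q i 0).
Proof.
by move=> dq; apply: dir_col => j; exact: smooth_chart.
Qed.

(** Identities between vectors, such as the laws of brackets, are reduced by this
    lemma to identities between derivations. *)
Lemma dir_inj p v w :
  (forall i, dir p v (fun q => chart p q i 0) = dir p w (fun q => chart p q i 0))
  -> v = w.
Proof.
move=> vw; rewrite -(dir_chart_id p v) -(dir_chart_id p w).
apply/matrixP => i j; have d := chart_dom_mem p.
by rewrite ord1 (dir_coord _ _ d) (dir_coord _ _ d).
Qed.

(** [dir] is taken in the chart chosen at the base point, which may jump with it.
    The chain rule rewrites it in a fixed chart, where its dependence on the base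
    point can be followed. *)
Lemma dir_chart p q v F : chart_dom p q -> smooth_at q F ->
  dir q v F = 'D_(dir q v (chart p)) (F \o chartV p) (chart p q).
Proof.
move=> dq sF; have [S [oS Sq CF _]] := smooth_at_Ck 1 dq sF.
have E : dir q v F
    = 'D_v ((F \o chartV p) \o (chart p \o chartV q)) (chart q q).
  apply: near_eq_derive.
  have nd : nbhs q (chart_dom p).
    by apply: open_nbhs_nbhs; split=> //; exact: chart_dom_open.
  apply: filterS (nbhs_chartV (chart_dom_mem q) nd) => x /= dx.
  by rewrite chartK.
have dT : derivable (chart p \o chartV q) (chart q q) v.
  by apply/derivable_colP => i; exact: smooth_at_derivable (smooth_chart i dq).
have cT : {for chart q q, continuous (chart p \o chartV q)}.
  apply/continuous_colP => i.
  have [S' [_ S'q CC _]] := smooth_at_Ck 0 (chart_dom_mem q) (smooth_chart i dq).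
  exact: Ck_continuous CC _ S'q.
have Sq' : S ((chart p \o chartV q) (chart q q)) by rewrite /= chartV_chart.
by rewrite E (chain_rule oS Sq' CF cT dT).2 /= chartV_chart.
Qed.

(** ** Coordinate vector fields *)

(** The vector field whose components in [chart p] are constantly [v]. *)
Definition coord_vf p v : vfield M := fun q =>
  'D_v (chart q \o chartV p) (chart p q).

Lemma dir_coord_vf p v q F : chart_dom p q -> smooth_at q F ->
  dir q (coord_vf p v q) F = 'D_v (F \o chartV p) (chart p q).
Proof.
move=> dq sF; have [S [oS Sq CF _]] := smooth_at_Ck 1 (chart_dom_mem q) sF.
have nd : nbhs q (chart_dom q).
  apply: open_nbhs_nbhs; split; [exact: chart_dom_open|exact: chart_dom_mem].
have -> : 'D_v (F \o chartV p) (chart p q)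
    = 'D_v ((F \o chartV q) \o (chart q \o chartV p)) (chart p q).
  apply: near_eq_derive; apply: filterS (nbhs_chartV dq nd) => x /= dx.
  by rewrite chartK.
have cs i := smooth_at_Ck 1 dq (smooth_chart i (chart_dom_mem q)).
have dT : derivable (chart q \o chartV p) (chart p q) v.
  apply/derivable_colP => i; have [S' [_ S'q CC _]] := cs i.
  exact: CkS_derivable CC _ S'q.
have cT : {for chart p q, continuous (chart q \o chartV p)}.
  apply/continuous_colP => i; have [S' [_ S'q CC _]] := cs i.
  exact: Ck_continuous CC _ S'q.
have Sq' : S ((chart q \o chartV p) (chart p q)) by rewrite /= chartK.
by rewrite (chain_rule oS Sq' CF cT dT).2 /= chartK.
Qed.

Lemma vf_coord p q v : chart_dom p q -> v = coord_vf p (dir q v (chart p)) q.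
Proof.
move=> dq; apply: (@dir_inj q) => i.
have sc := smooth_chart i (chart_dom_mem q).
by rewrite dir_coord_vf // -dir_chart.
Qed.

Lemma coord_vf_center p v : coord_vf p v p = v.
Proof.
by rewrite [RHS](vf_coord v (chart_dom_mem p)) dir_chart_id.
Qed.

Lemma coord_vf_sum p q (v : 'cV[R]_m) : chart_dom p q ->
  coord_vf p v q = \sum_i v i 0 *: coord_vf p (delta_mx i 0) q.
Proof.
move=> dq; apply: (@dir_inj q) => i.
have sc := smooth_chart i (chart_dom_mem q).
rewrite (dir_sum _ _ _ _ sc) (dir_coord_vf _ dq sc).
have [S [oS Sq CF _]] := smooth_at_Ck 1 dq sc.
rewrite (derive_partial _ oS Sq CF); apply: eq_bigr => j _.
by rewrite (dir_coord_vf _ dq sc).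
Qed.

#[local] Opaque dir.

(** ** Smooth vector fields *)

Lemma smooth_vf_near p X : smooth_vf_at p X ->
  \forall q \near p, smooth_vf_at q X.
Proof.
move=> [U [oU Up] sX]; near=> q; exists U => //; split=> //.
near: q; exact: open_nbhs_nbhs.
Unshelve. all: by end_near. Qed.

(** Smoothness of vector fields is reduced to that of scalar functions, for which
    sums, products and quotients are available. *)
Lemma smooth_vf_atP p X :
  smooth_vf_at p X <->
  exists2 U, open_nbhs p U & forall q, U q -> forall r, chart_dom r q -> forall i,
    smooth_at q (fun q => dir q (X q) (fun q => chart r q i 0)).
Proof.
split=> [[U Up sX]|[U [oU Up] sX]]; exists U => //.
  move=> q Uq r dq i; have : smooth_at q (fun q => dir q (X q) (chart r)).
    exists (U `&` chart_dom r); last exact: sX.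
    by split=> //; apply: openI; [case: Up|exact: chart_dom_open].
  move/smooth_at_col => /(_ i); apply: eq_smooth_at.
  have nd : nbhs q (chart_dom r).
    by apply: open_nbhs_nbhs; split=> //; exact: chart_dom_open.
  by apply: filterS nd => y dy; rewrite dir_coord.
move=> r; apply/smooth_onP.
  by apply: openI => //; exact: chart_dom_open.
move=> q [Uq dq]; apply/smooth_at_col => i.
apply: eq_smooth_at (sX q Uq r dq i).
have nd : nbhs q (chart_dom r).
  by apply: open_nbhs_nbhs; split=> //; exact: chart_dom_open.
by apply: filterS nd => y dy; rewrite dir_coord.
Qed.

Lemma smooth_vf_onP U X : open U ->
  smooth_vf_on U X <-> (forall p, U p -> smooth_vf_at p X).
Proof.
move=> oU; split=> [sX p Up|sX r]; first by exists U.
apply/smooth_onP; first by apply: openI => //; exact: chart_dom_open.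
move=> q [Uq dq]; have [V [oV Vq] sV] := sX _ Uq.
exists (V `&` chart_dom r); last exact: sV.
by split=> //; apply: openI => //; exact: chart_dom_open.
Qed.

Lemma near_smooth_vf p X :
  (\forall q \near p, forall r, chart_dom r q -> forall i,
    smooth_at q (fun q => dir q (X q) (fun q => chart r q i 0))) ->
  smooth_vf_at p X.
Proof.
move=> H; apply/smooth_vf_atP.
exists [set q | forall r, chart_dom r q -> forall i,
    smooth_at q (fun q => dir q (X q) (fun q => chart r q i 0))]^°.
  by split=> //; exact: open_interior.
by move=> q /interior_subset.
Qed.

Lemma eq_smooth_vf p X Y : (\forall q \near p, X q = Y q) ->
  smooth_vf_at p X -> smooth_vf_at p Y.
Proof.
move=> XY /smooth_vf_atP[U oU sX]; apply: near_smooth_vf.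
have nXY : \forall q \near p, \forall q' \near q, X q' = Y q'.
  by move/nbhs_interior : XY.
near=> q => r dq i.
have Uq : U q by near: q; exact: open_nbhs_nbhs.
apply: eq_smooth_at (sX q Uq r dq i).
have : \forall q' \near q, X q' = Y q' by near: q.
by apply: filterS => y ->.
Unshelve. all: by end_near. Qed.

(** In a fixed chart this function is a sum of products of the components of [X]
    with the partial derivatives of [F]. *)
Lemma smooth_dir p X F : smooth_vf_at p X -> smooth_at p F ->
  smooth_at p (fun q => dir q (X q) F).
Proof.
move=> /smooth_vf_atP[U [oU Up] sX] sF.
have dp := chart_dom_mem p.
have nU : nbhs p U by exact: open_nbhs_nbhs.
have nd : nbhs p (chart_dom p).
  by apply: open_nbhs_nbhs; split=> //; exact: chart_dom_open.
apply: (@eq_smooth_at _ _ _ _ _ (fun q =>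
    \sum_i dir q (X q) (fun q => chart p q i 0)
           * 'D_(delta_mx i 0) (F \o chartV p) (chart p q))).
  near=> q.
  have dq : chart_dom p q by near: q.
  have sq : smooth_at q F by near: q; exact: smooth_at_near.
  rewrite [RHS](dir_chart _ dq sq).
  have [S [oS Sq CF _]] := smooth_at_Ck 1 dq sq.
  rewrite (derive_partial _ oS) //; apply: eq_bigr => i _.
  by rewrite dir_coord.
apply: smooth_at_sum => i _; apply: smooth_atM; first exact: sX.
have [V [oV Vp] sV] := sF.
apply: (@smooth_at_chart _ _ _ p p (chart p @` (chart_dom p `&` V))) => //.
- exact: open_cimg.
- exact: cimg_mem.
- move=> k; apply: (@eq_Ck _ _ _ _ _ k
    ('D_(delta_mx i 0) (F \o chartV p))).
  + exact: open_cimg.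
  + by move=> x /cimgP[_ _ /= ->].
  + exact: CkS_derive (sV p k.+1).
Unshelve. all: by end_near. Qed.

Lemma smooth_vf0 p : smooth_vf_at p (fun=> 0).
Proof.
apply: near_smooth_vf; apply: nearW => q r dq i.
apply: eq_smooth_at (smooth_at_cst q (0 : R)).
by apply: nearW => y; rewrite dir0.
Qed.

Lemma smooth_vfD p X Y : smooth_vf_at p X -> smooth_vf_at p Y ->
  smooth_vf_at p (fun q => X q + Y q).
Proof.
move=> /smooth_vf_near nX /smooth_vf_near nY; apply: near_smooth_vf.
apply: filterS2 nX nY => q sX sY r dq i.
have sc := smooth_chart i dq.
apply: eq_smooth_at (smooth_atD (smooth_dir sX sc) (smooth_dir sY sc)).
apply: filterS (smooth_at_near sc) => y sy.
by rewrite dirDv.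
Qed.

Lemma smooth_vfZ p F X : smooth_at p F -> smooth_vf_at p X ->
  smooth_vf_at p (fun q => F q *: X q).
Proof.
move=> /smooth_at_near nF /smooth_vf_near nX; apply: near_smooth_vf.
apply: filterS2 nX nF => q sX sF r dq i.
have sc := smooth_chart i dq.
apply: eq_smooth_at (smooth_atM sF (smooth_dir sX sc)).
apply: filterS (smooth_at_near sc) => y sy.
by rewrite dirZv.
Qed.

Lemma smooth_vf_sum p (I : Type) (s : seq I) (P : pred I) (X : I -> vfield M) :
  (forall i, P i -> smooth_vf_at p (X i)) ->
  smooth_vf_at p (fun q => \sum_(i <- s | P i) X i q).
Proof.
move=> sX; elim: s => [|i s ih].
  by apply: eq_smooth_vf (smooth_vf0 p); apply: nearW => q; rewrite big_nil.
have [Pi|nPi] := boolP (P i).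
  apply: eq_smooth_vf (smooth_vfD (sX _ Pi) ih).
  by apply: nearW => q; rewrite big_cons Pi.
by apply: eq_smooth_vf ih; apply: nearW => q; rewrite big_cons (negbTE nPi).
Qed.

Lemma smooth_coord_vf p v q : chart_dom p q -> smooth_vf_at q (coord_vf p v).
Proof.
move=> dq; apply: near_smooth_vf.
have nd : nbhs q (chart_dom p).
  by apply: open_nbhs_nbhs; split=> //; exact: chart_dom_open.
apply: filterS nd => {dq}q dq r dr i.
have nd : nbhs q (chart_dom p).
  by apply: open_nbhs_nbhs; split=> //; exact: chart_dom_open.
have [V [oV Vq] sV] := smooth_chart i dr.
apply: (@smooth_at_chart _ _ _ p q (chart p @` (chart_dom p `&` V))) => //.
- exact: open_cimg.
- exact: cimg_mem.
- move=> k; apply: (@eq_Ck _ _ _ _ _ k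
    ('D_v ((fun q => chart r q i 0) \o chartV p))).
  + exact: open_cimg.
  + move=> x /cimgP[dx Vx xE _] /=; rewrite dir_coord_vf //; first by rewrite xE.
    by exists V.
  + exact: CkS_derive (sV p k.+1).
Qed.

Lemma smooth_coord_vf_center p v : smooth_vf_at p (coord_vf p v).
Proof. exact: smooth_coord_vf (chart_dom_mem p). Qed.

(** ** The Lie bracket *)

(** [lie] is defined through the coordinate functions of one chart. For any other
    function the commutator of derivations contains second derivatives, which
    cancel by their symmetry. *)
Lemma lie_dir p X Y F :
    smooth_vf_at p X -> smooth_vf_at p Y -> smooth_at p F ->
  dir p (lie X Y p) F
  = dir p (X p) (fun q => dir q (Y q) F) - dir p (Y p) (fun q => dir q (X q) F).
Proof.
move=> sX sY sF.
have dp := chart_dom_mem p.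
have nd : nbhs p (chart_dom p).
  by apply: open_nbhs_nbhs; split=> //; exact: chart_dom_open.
have [S [oS Sp CF SF]] := smooth_at_Ck 2 dp sF.
pose f := F \o chartV p.
have comm v w := @derive_comm _ _ _ oS f (chart p p) v w Sp CF.
have sD (v : 'cV[R]_m) : smooth_at p (fun q => 'D_v f (chart p q)).
  apply: eq_smooth_at (smooth_dir (smooth_coord_vf_center p v) sF).
  near=> q; rewrite dir_coord_vf //; near: q => //; exact: smooth_at_near.
have half (Z Z' : vfield M) : smooth_vf_at p Z -> smooth_vf_at p Z' ->
    dir p (Z p) (fun q => dir q (Z' q) F)
    = 'D_(dir p (Z p) (fun q => dir q (Z' q) (chart p))) f (chart p p)
      + 'D_(Z' p) (fun x => 'D_(Z p) f x) (chart p p).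
  move=> sZ sZ'.
  have sc i : smooth_at p (fun q => dir q (Z' q) (fun q => chart p q i 0)).
    by apply: smooth_dir => //; exact: smooth_chart.
  transitivity (dir p (Z p) (fun q =>
      \sum_i dir q (Z' q) (fun q => chart p q i 0) * 'D_(delta_mx i 0) f (chart p q))).
    apply: eq_dir; near=> q.
    have dq : chart_dom p q by near: q.
    have sq : smooth_at q F by near: q; exact: smooth_at_near.
    rewrite (dir_chart _ dq sq).
    have [S' [oS' Sq CF' _]] := smooth_at_Ck 1 dq sq.
    rewrite (derive_partial _ oS') //; apply: eq_bigr => i _.
    by rewrite dir_coord.
  rewrite dir_sum_fun; last by move=> i; apply: smooth_atM.
  rewrite (derive_partial _ oS Sp); last exact: Ck_le CF.
  rewrite (derive_partial _ oS Sp); last exact: CkS_derive.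
  rewrite -big_split; apply: eq_bigr => i _ /=.
  rewrite (dirM _ (sc i) (sD _)).
  have -> : dir p (Z p) (fun q => dir q (Z' q) (fun q => chart p q i 0))
      = dir p (Z p) (fun q => dir q (Z' q) (chart p)) i 0.
    have sc' j : smooth_at p (fun q => dir q (Z' q) (chart p) j 0).
      apply: eq_smooth_at (sc j).
      by apply: filterS nd => q dq; rewrite (dir_coord _ _ dq).
    rewrite (dir_col _ _ sc'); apply: eq_dir.
    by apply: filterS nd => q dq; rewrite (dir_coord _ _ dq).
  have -> : dir p (Z' p) (fun q => chart p q i 0) = Z' p i 0.
    by rewrite -dir_coord // dir_chart_id.
  have -> : dir p (Z p) (fun q => 'D_(delta_mx i 0) f (chart p q))
      = 'D_(delta_mx i 0) (fun x => 'D_(Z p) f x) (chart p p).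
    by rewrite -comm; exact: dir_chart_fun.
  by ring.
have cancel (a b c : R) : a + c - (b + c) = a - b by ring.
rewrite (half _ _ sX sY) (half _ _ sY sX) comm cancel.
have lieE : lie X Y p = -1 *: dir p (Y p) (fun q => dir q (X q) (chart p))
    + dir p (X p) (fun q => dir q (Y q) (chart p)).
  by rewrite scaleN1r addrC.
by rewrite lieE (dir_linear _ _ _ sF) mulN1r addrC.
Unshelve. all: by end_near. Qed.

Lemma lieC X Y p : lie X Y p = - lie Y X p.
Proof. by rewrite /lie opprB. Qed.

Lemma smooth_lie p X Y : smooth_vf_at p X -> smooth_vf_at p Y ->
  smooth_vf_at p (lie X Y).
Proof.
move=> /smooth_vf_near nX /smooth_vf_near nY; apply: near_smooth_vf.
apply: filterS2 nX nY => q sX sY r dq i.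
have sc := smooth_chart i dq.
apply: (@eq_smooth_at _ _ _ _ _ (fun q =>
  dir q (X q) (fun q => dir q (Y q) (fun q => chart r q i 0))
  - dir q (Y q) (fun q => dir q (X q) (fun q => chart r q i 0)))); last first.
  by apply: smooth_atD; [|apply: smooth_atN]; do 2?apply: smooth_dir.
apply: filterS3 (smooth_vf_near sX) (smooth_vf_near sY) (smooth_at_near sc).
by move=> y sXy sYy sy; rewrite -lie_dir.
Qed.

Lemma eq_lie p X Y X' Y' : (\forall q \near p, X q = X' q) ->
  (\forall q \near p, Y q = Y' q) -> lie X Y p = lie X' Y' p.
Proof.
move=> XX' YY'; rewrite /lie (nbhs_singleton XX') (nbhs_singleton YY').
have -> : dir p (X' p) (fun q => dir q (Y q) (chart p))
    = dir p (X' p) (fun q => dir q (Y' q) (chart p)).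
  by apply: eq_dir; apply: filterS YY' => q ->.
have -> : dir p (Y' p) (fun q => dir q (X q) (chart p))
    = dir p (Y' p) (fun q => dir q (X' q) (chart p)).
  by apply: eq_dir; apply: filterS XX' => q ->.
by [].
Qed.

End Derivations.

(** * The algebraic laws of derivations

    The geometry below uses smoothness, derivatives and brackets only through
    their algebraic laws. The following copies are locked, so that rewriting with
    these laws never unfolds them to limits of difference quotients. *)

HB.lock Definition smoothf (R : realType) m (M : manifold R m) (p : M)
  (F : M -> R) : Prop := smooth_at p F.
HB.lock Definition smoothv (R : realType) m (M : manifold R m) (p : M)
  (X : vfield M) : Prop := smooth_vf_at p X.
HB.lock Definition ddir (R : realType) m (M : manifold R m) (p : M)
  (v : 'cV[R]_m) (F : M -> R) : R := dir p v F.
HB.lock Definition brk (R : realType) m (M : manifold R m) (X Y : vfield M) :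
  vfield M := lie X Y.

Ltac unseal :=
  rewrite ?smoothf.unlock ?smoothv.unlock ?ddir.unlock ?brk.unlock.

Section Sealed.
Variables (R : realType) (m : nat) (M : manifold R m).
Implicit Types (p q : M) (v w : 'cV[R]_m) (X Y Z : vfield M) (F G : M -> R).

Lemma smoothfE p F : smooth_at p F = smoothf p F.
Proof. by unseal. Qed.
Lemma smoothvE p X : smooth_vf_at p X = smoothv p X.
Proof. by unseal. Qed.
Lemma dirE p v F : dir p v F = ddir p v F.
Proof. by unseal. Qed.
Lemma lieE X Y : lie X Y = brk X Y.
Proof. by unseal. Qed.

Lemma smoothf_near p F : smoothf p F -> \forall q \near p, smoothf q F.
Proof. unseal; exact: smooth_at_near. Qed.
Lemma eq_smoothf p F G : (\forall q \near p, F q = G q) ->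
  smoothf p F -> smoothf p G.
Proof. unseal; exact: eq_smooth_at. Qed.
Lemma smoothf_cst p (a : R) : smoothf p (fun=> a).
Proof. unseal; exact: smooth_at_cst. Qed.
Lemma smoothf_chart p q i : chart_dom p q -> smoothf q (fun q => chart p q i 0).
Proof. unseal; exact: smooth_chart. Qed.

Lemma eq_ddir p v F G : (\forall q \near p, F q = G q) -> ddir p v F = ddir p v G.
Proof. unseal; exact: eq_dir. Qed.
Lemma ddir0 p F : ddir p 0 F = 0.
Proof. unseal; exact: dir0. Qed.
Lemma ddirDv p v w F : smoothf p F ->
  ddir p (v + w) F = ddir p v F + ddir p w F.
Proof. unseal; exact: dirDv. Qed.
Lemma ddirZv p a v F : smoothf p F -> ddir p (a *: v) F = a * ddir p v F.
Proof. unseal; exact: dirZv. Qed.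
Lemma ddirD p v F G : smoothf p F -> smoothf p G ->
  ddir p v (fun q => F q + G q) = ddir p v F + ddir p v G.
Proof. unseal; exact: dirD. Qed.
Lemma ddirM p v F G : smoothf p F -> smoothf p G ->
  ddir p v (fun q => F q * G q) = F p * ddir p v G + G p * ddir p v F.
Proof. unseal; exact: dirM. Qed.
Lemma ddir_cst p v (a : R) : ddir p v (fun=> a) = 0.
Proof. unseal; exact: dir_cst. Qed.
Lemma ddir_inj p v w :
  (forall i, ddir p v (fun q => chart p q i 0) = ddir p w (fun q => chart p q i 0))
  -> v = w.
Proof. unseal; exact: dir_inj. Qed.
Lemma chart_ddir p q v i : chart_dom p q ->
  dir q v (chart p) i 0 = ddir q v (fun q => chart p q i 0).
Proof. unseal; exact: dir_coord. Qed.

Lemma smoothv_on p X : smoothv p X <->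
  exists2 U, open U & U p /\ smooth_vf_on U X.
Proof.
rewrite smoothv.unlock; split=> [[U [oU Up] sX]|[U oU [Up sX]]]; exists U => //.
Qed.
Lemma smoothv_near p X : smoothv p X -> \forall q \near p, smoothv q X.
Proof. unseal; exact: smooth_vf_near. Qed.
Lemma smoothv0 p : smoothv p (fun=> 0).
Proof. unseal; exact: smooth_vf0. Qed.
Lemma smoothvD p X Y : smoothv p X -> smoothv p Y ->
  smoothv p (fun q => X q + Y q).
Proof. unseal; exact: smooth_vfD. Qed.
Lemma smoothvZ p F X : smoothf p F -> smoothv p X ->
  smoothv p (fun q => F q *: X q).
Proof. unseal; exact: smooth_vfZ. Qed.
Lemma smoothv_sum p (I : Type) (s : seq I) (P : pred I) (X : I -> vfield M) :
  (forall i, P i -> smoothv p (X i)) ->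
  smoothv p (fun q => \sum_(i <- s | P i) X i q).
Proof. unseal; exact: smooth_vf_sum. Qed.
Lemma smoothv_coord p v q : chart_dom p q -> smoothv q (coord_vf p v).
Proof. unseal; exact: smooth_coord_vf. Qed.
Lemma smoothv_coord_center p v : smoothv p (coord_vf p v).
Proof. exact: smoothv_coord (chart_dom_mem p). Qed.

Lemma smoothv_ext p v : exists2 X, smoothv p X & X p = v.
Proof.
by exists (coord_vf p v); [exact: smoothv_coord_center|exact: coord_vf_center].
Qed.

Lemma smooth_ddir p X F : smoothv p X -> smoothf p F ->
  smoothf p (fun q => ddir q (X q) F).
Proof. unseal; exact: smooth_dir. Qed.

Lemma brk_ddir p X Y F : smoothv p X -> smoothv p Y -> smoothf p F ->
  ddir p (brk X Y p) F
  = ddir p (X p) (fun q => ddir q (Y q) F)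
    - ddir p (Y p) (fun q => ddir q (X q) F).
Proof. unseal; exact: lie_dir. Qed.
Lemma brkC X Y p : brk X Y p = - brk Y X p.
Proof. unseal; exact: lieC. Qed.
Lemma eq_brk p X Y X' Y' : (\forall q \near p, X q = X' q) ->
  (\forall q \near p, Y q = Y' q) -> brk X Y p = brk X' Y' p.
Proof. rewrite brk.unlock; exact: eq_lie. Qed.
Lemma smooth_brk p X Y : smoothv p X -> smoothv p Y -> smoothv p (brk X Y).
Proof. unseal; exact: smooth_lie. Qed.

Lemma brkDl p X X' Y : smoothv p X -> smoothv p X' -> smoothv p Y ->
  brk (fun q => X q + X' q) Y p = brk X Y p + brk X' Y p.
Proof.
move=> sX sX' sY; apply: (@ddir_inj p) => i.
have sc := smoothf_chart i (chart_dom_mem p).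
have dX := smooth_ddir sX sc; have dX' := smooth_ddir sX' sc.
have dY := smooth_ddir sY sc.
rewrite ddirDv // !brk_ddir //; last exact: smoothvD.
rewrite (ddirDv _ _ dY).
have -> : ddir p (Y p) (fun q => ddir q (X q + X' q) (fun q => chart p q i 0))
    = ddir p (Y p) (fun q => ddir q (X q) (fun q => chart p q i 0)
                            + ddir q (X' q) (fun q => chart p q i 0)).
  by apply: eq_ddir; apply: filterS (smoothf_near sc) => q sq; rewrite ddirDv.
by rewrite (ddirD _ dX dX') opprD addrACA.
Qed.

Lemma brkZl p F X Y : smoothf p F -> smoothv p X -> smoothv p Y ->
  brk (fun q => F q *: X q) Y p = F p *: brk X Y p - ddir p (Y p) F *: X p.
Proof.
move=> sF sX sY; apply: (@ddir_inj p) => i.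
have sc := smoothf_chart i (chart_dom_mem p).
have dX := smooth_ddir sX sc; have dY := smooth_ddir sY sc.
rewrite -scaleNr (ddirDv _ _ sc) !ddirZv // !brk_ddir //; last exact: smoothvZ.
rewrite (ddirZv _ _ dY).
have -> : ddir p (Y p) (fun q => ddir q (F q *: X q) (fun q => chart p q i 0))
    = ddir p (Y p) (fun q => F q * ddir q (X q) (fun q => chart p q i 0)).
  by apply: eq_ddir; apply: filterS (smoothf_near sc) => q sq; rewrite ddirZv.
by rewrite (ddirM _ sF dX) mulrBr opprD addrA mulNr [ddir p (Y p) F * _]mulrC.
Qed.

Lemma coord_vf_expand p X : smoothv p X ->
  \forall q \near p, X q = \sum_i dir q (X q) (chart p) i 0
                                   *: coord_vf p (delta_mx i 0) q.
Proof.
move=> sX; have nd : nbhs p (chart_dom p).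
  by apply: open_nbhs_nbhs; split; [exact: chart_dom_open|exact: chart_dom_mem].
apply: filterS nd => q dq; rewrite -coord_vf_sum //.
exact: vf_coord.
Qed.

Lemma smoothf_component p X i : smoothv p X ->
  smoothf p (fun q => dir q (X q) (chart p) i 0).
Proof.
move=> sX; apply: eq_smoothf (smooth_ddir sX (smoothf_chart i (chart_dom_mem p))).
have nd : nbhs p (chart_dom p).
  by apply: open_nbhs_nbhs; split; [exact: chart_dom_open|exact: chart_dom_mem].
by apply: filterS nd => q dq; rewrite chart_ddir.
Qed.

End Sealed.

(** * Smooth maps *)

Section SmoothMaps.
Variables (R : realType) (m d : nat) (M : manifold R m) (N : manifold R d).
Variables (U : set M) (f : M -> N).
Hypotheses (oU : open U) (sf : smooth_map_on U f).
Implicit Types (p q : M) (X : vfield M) (Y : vfield N).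

Lemma smooth_map_cont p : U p -> {for p, continuous f}.
Proof. by move=> Up; have [cf _] := sf; exact: cf. Qed.

Lemma near_smooth_map p (P : set N) : U p -> nbhs (f p) P ->
  \forall q \near p, P (f q).
Proof. by move=> Up nP; exact: (smooth_map_cont Up nP). Qed.

Lemma open_smooth_preimage (V : set N) : open V -> open (U `&` f @^-1` V).
Proof.
move=> oV; rewrite openE => p [Up Vp]; apply: filterI.
  exact: open_nbhs_nbhs.
by apply: near_smooth_map => //; exact: open_nbhs_nbhs.
Qed.

Lemma smooth_map_coord p b i : U p -> chart_dom b (f p) ->
  smooth_at p (fun q => chart b (f q) i 0).
Proof.
move=> Up db; move: i; apply/smooth_at_col.
exists (U `&` f @^-1` chart_dom b); last exact: sf.2.
by split=> //; apply: open_smooth_preimage; exact: chart_dom_open.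
Qed.

Lemma smooth_comp p (F : N -> R) : U p -> smooth_at (f p) F ->
  smooth_at p (F \o f).
Proof.
move=> Up [V [oV Vp] sF].
pose U1 := U `&` f @^-1` (chart_dom (f p) `&` V).
have oU1 : open U1.
  by apply: open_smooth_preimage; apply: openI => //; exact: chart_dom_open.
have U1p : U1 p by split=> //; split=> //; exact: chart_dom_mem.
have dp := chart_dom_mem p.
apply: (@smooth_at_chart _ _ _ p p (chart p @` (chart_dom p `&` U1))) => //.
- exact: open_cimg.
- exact: cimg_mem.
move=> k; apply: (@eq_Ck _ _ _ _ _ k ((F \o chartV (f p)) \o
    ((fun q => chart (f p) (f q)) \o chartV p))).
- exact: open_cimg.
- by move=> x /cimgP[_ [_ [df _]] _ _] /=; rewrite chartK.
- apply: (@Ck_comp _ _ _ k _ (chart (f p) @` (chart_dom (f p) `&` V))) => //.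
  + exact: open_cimg.
  + exact: open_cimg.
  + by move=> x /cimgP[_ [_ [df Vf]] _ _] /=; exact: cimg_mem.
  + exact: sF.
  + have C := sf.2 (f p) p k; apply: Ck_subset C => _ [y [dy [Uy [df _]]] <-].
    by exists y.
Qed.

Lemma tmap_coord p v i : U p ->
  tmap f p v i 0 = dir p v (fun q => chart (f p) (f q) i 0).
Proof.
move=> Up; rewrite /tmap /dir derive_col //; apply/derivable_colP => j.
apply: (@smooth_at_derivable _ _ _ p (fun q => chart (f p) (f q) j 0)).
by apply: smooth_map_coord => //; exact: chart_dom_mem.
Qed.

Lemma dir_tmap p v (F : N -> R) : U p -> smooth_at (f p) F ->
  dir p v (F \o f) = dir (f p) (tmap f p v) F.
Proof.
move=> Up sF; have db := chart_dom_mem (f p); have dp := chart_dom_mem p.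
have [S [oS Sp CF _]] := smooth_at_Ck 1 db sF.
have nd : nbhs (f p) (chart_dom (f p)).
  by apply: open_nbhs_nbhs; split=> //; exact: chart_dom_open.
have -> : dir p v (F \o f) = 'D_v ((F \o chartV (f p)) \o
    ((fun q => chart (f p) (f q)) \o chartV p)) (chart p p).
  apply: near_eq_derive.
  apply: filterS (nbhs_chartV dp (near_smooth_map Up nd)) => x /= dx.
  by rewrite chartK.
have sc i := smooth_map_coord i Up db.
have cT : {for chart p p, continuous ((fun q => chart (f p) (f q)) \o chartV p)}.
  apply/continuous_colP => i; have [S' [_ S'p CC _]] := smooth_at_Ck 0 dp (sc i).
  exact: Ck_continuous CC _ S'p.
have dT : derivable ((fun q => chart (f p) (f q)) \o chartV p) (chart p p) v.
  by apply/derivable_colP => i; exact: (smooth_at_derivable (sc i)).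
have Sp' : S (((fun q => chart (f p) (f q)) \o chartV p) (chart p p)).
  by rewrite /= chartV_chart.
by rewrite (chain_rule oS Sp' CF cT dT).2 /= chartV_chart.
Qed.

Lemma smoothf_comp p (F : N -> R) : U p -> smoothf (f p) F -> smoothf p (F \o f).
Proof. rewrite !smoothf.unlock; exact: smooth_comp. Qed.

Lemma ddir_tmap p v (F : N -> R) : U p -> smoothf (f p) F ->
  ddir p v (F \o f) = ddir (f p) (tmap f p v) F.
Proof. rewrite !smoothf.unlock !ddir.unlock; exact: dir_tmap. Qed.

(** As a matrix, the differential is linear by construction, also at points where
    [tmap] is not. *)
Definition jacmx p : 'M[R]_(d, m) := \matrix_(i, j) tmap f p (delta_mx j 0) i 0.

Lemma jacmxE p v : U p -> tmap f p v = jacmx p *m v.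
Proof.
move=> Up; have sc i := smooth_map_coord i Up (chart_dom_mem (f p)).
apply/matrixP => i j; rewrite ord1 !mxE [in LHS](col_basis v).
rewrite (tmap_coord _ _ Up) (dir_sum _ _ _ _ (sc i)).
by apply: eq_bigr => k _; rewrite !mxE (tmap_coord _ _ Up) mulrC.
Qed.

(** On functions pulled back from [N], related fields act like the fields of [N],
    hence so do their commutators; tangent vectors of [N] are determined by their
    action on functions. *)
Lemma brk_related p X1 X2 Y1 Y2 : U p ->
    smoothv p X1 -> smoothv p X2 -> smoothv (f p) Y1 -> smoothv (f p) Y2 ->
    (\forall q \near p, jacmx q *m X1 q = Y1 (f q)) ->
    (\forall q \near p, jacmx q *m X2 q = Y2 (f q)) ->
  jacmx p *m brk X1 X2 p = brk Y1 Y2 (f p).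
Proof.
move=> Up sX1 sX2 sY1 sY2 r1 r2; apply: (@ddir_inj _ _ _ (f p)) => i.
have sc := smoothf_chart i (chart_dom_mem (f p)).
have nU : nbhs p U by exact: open_nbhs_nbhs.
have ns := near_smooth_map Up (smoothf_near sc).
have ddJ q v F : U q -> smoothf (f q) F ->
    ddir (f q) (jacmx q *m v) F = ddir q v (F \o f).
  by move=> Uq sF; rewrite -jacmxE // -ddir_tmap.
rewrite ddJ // (brk_ddir sX1 sX2 (smoothf_comp Up sc)) (brk_ddir sY1 sY2 sc).
have half X X' Y Y' : smoothv (f p) Y' ->
    (\forall q \near p, jacmx q *m X q = Y (f q)) ->
    (\forall q \near p, jacmx q *m X' q = Y' (f q)) ->
    ddir p (X p) (fun q => ddir q (X' q) ((fun b => chart (f p) b i 0) \o f))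
    = ddir (f p) (Y (f p)) (fun b => ddir b (Y' b) (fun b => chart (f p) b i 0)).
  move=> sY' r r'.
  rewrite -(nbhs_singleton r) (ddJ _ _ _ Up (smooth_ddir sY' sc)).
  by apply: eq_ddir; apply: filterS3 r' nU ns => q /= <- Uq sq; rewrite ddJ.
by rewrite (half X1 X2 Y1 Y2) // (half X2 X1 Y2 Y1).
Qed.

End SmoothMaps.

(** * Smoothness tested against a coframe *)

Section Coframe.
Variables (R : realType) (m : nat) (M : manifold R m).
Implicit Types (p q : M) (X : vfield M).

Lemma smooth_det p n (A : M -> 'M[R]_n) :
  (forall i j, smooth_at p (fun q => A q i j)) -> smooth_at p (fun q => \det (A q)).
Proof.
move=> sA; rewrite /determinant; apply: smooth_at_sum => s _.
by apply: smooth_atM; [exact: smooth_at_cst|apply: smooth_at_prod].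
Qed.

Lemma smooth_invmx p n (A : M -> 'M[R]_n) :
    (\forall q \near p, A q \in unitmx) ->
    (forall i j, smooth_at p (fun q => A q i j)) ->
  forall i j, smooth_at p (fun q => invmx (A q) i j).
Proof.
move=> uA sA i j.
apply: (@eq_smooth_at _ _ _ _ _ (fun q => (\det (A q))^-1 * \adj (A q) i j)).
  by apply: filterS uA => q uq; rewrite /invmx uq [RHS]mxE.
apply: smooth_atM.
  apply: smooth_atV; last exact: smooth_det.
  by apply: filterS uA => q; rewrite unitmxE unitfE.
apply: (@eq_smooth_at _ _ _ _ _ (fun q =>
    (-1) ^+ (j + i)%N * \det (row' j (col' i (A q))))).
  by apply: nearW => q; rewrite mxE /cofactor.
apply: smooth_atM; first exact: smooth_at_cst.
apply: smooth_det => k l; apply: eq_smooth_at (sA (lift j k) (lift i l)).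
by apply: nearW => q; rewrite !mxE.
Qed.

(** The components of a vector field in a smooth coframe determine its components
    in a chart by Cramer's rule, a smooth expression in both. *)
Lemma smooth_vf_coframe p (theta : M -> 'M[R]_m) X :
    (\forall q \near p, theta q \in unitmx) ->
    (forall Y, smooth_vf_at p Y -> smooth_at p (fun q => theta q *m Y q)) ->
    smooth_at p (fun q => theta q *m X q) ->
  smooth_vf_at p X.
Proof.
move=> uT sT sX.
(* The columns of [B q] are the coordinate fields of [chart p]: the matrix
   [theta q *m B q] is the coframe in coordinates. *)
pose B q : 'M[R]_m := \matrix_(i, j) coord_vf p (delta_mx j 0) q i 0.
have nd : nbhs p (chart_dom p).
  by apply: open_nbhs_nbhs; split; [exact: chart_dom_open|exact: chart_dom_mem].
have BE q (v : 'cV[R]_m) : chart_dom p q -> B q *m v = coord_vf p v q.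
  move=> dq; rewrite coord_vf_sum //; apply/matrixP => i j.
  rewrite ord1 !mxE summxE; apply: eq_bigr => k _.
  by rewrite !mxE mulrC.
have uB : \forall q \near p, B q \in unitmx.
  apply: filterS nd => q dq.
  pose C : 'M[R]_m := \matrix_(i, j) dir q (delta_mx j 0) (chart p) i 0.
  have BC : B q *m C = 1%:M.
    apply/matrixP => i j.
    have -> : (B q *m C) i j = (B q *m dir q (delta_mx j 0) (chart p)) i 0.
      by rewrite !mxE; apply: eq_bigr => k _; rewrite [C _ _]mxE.
    by rewrite BE // -vf_coord // !mxE eqxx andbT.
  have [uBq _] := mulmx1_unit BC; exact: uBq.
have sA i j : smooth_at p (fun q => (theta q *m B q) i j).
  have /smooth_at_col/(_ i) := sT _ (smooth_coord_vf_center p (delta_mx j 0)).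
  apply: eq_smooth_at; apply: nearW => q; rewrite !mxE.
  by apply: eq_bigr => k _; rewrite !mxE.
have uA : \forall q \near p, theta q *m B q \in unitmx.
  by near=> q; rewrite unitmx_mul; apply/andP; split; near: q.
pose c q := invmx (theta q *m B q) *m (theta q *m X q).
have sc i : smooth_at p (fun q => c q i 0).
  rewrite /c; apply: (@eq_smooth_at _ _ _ _ _ (fun q =>
      \sum_k invmx (theta q *m B q) i k * (theta q *m X q) k 0)).
    by apply: nearW => q; rewrite [RHS]mxE.
  apply: smooth_at_sum => k _; apply: smooth_atM; first exact: smooth_invmx.
  by have /smooth_at_col := sX; exact.
apply: (@eq_smooth_vf _ _ _ _ (fun q =>
    \sum_i c q i 0 *: coord_vf p (delta_mx i 0) q)).
  near=> q.
  rewrite -coord_vf_sum; last by near: q.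
  rewrite -BE; last by near: q.
  have uq : theta q *m B q \in unitmx by near: q.
  have ut : theta q \in unitmx by near: q.
  by apply: (can_inj (mulKmx ut)); rewrite mulmxA /c mulmxA mulmxV // mul1mx.
apply: smooth_vf_sum => i _; apply: smooth_vfZ => //.
exact: smooth_coord_vf_center.
Unshelve. all: by end_near. Qed.

End Coframe.

(** * Connections and the curvature tensor *)

HB.lock Definition crv (R : realType) m (M : manifold R m) (nabla : connection M)
  (X Y Z : vfield M) : vfield M := curv nabla X Y Z.

(** Tangent vectors are extended by fields with constant components; by [RmE] any
    other smooth extensions give the same value. *)
HB.lock Definition Rm (R : realType) m (M : manifold R m) (nabla : connection M)
  (p : M) (u v w : 'cV[R]_m) : 'cV[R]_m :=
  crv nabla (coord_vf p u) (coord_vf p v) (coord_vf p w) p.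

Section Connections.
Variables (R : realType) (m : nat) (M : manifold R m) (nabla : connection M).
Hypothesis hc : is_connection nabla.
Implicit Types (p q : M) (X Y Z : vfield M) (F : M -> R).

Lemma conn_linear_s p a v w Y : smoothv p Y ->
  nabla p (a *: v + w) Y = a *: nabla p v Y + nabla p w Y.
Proof. rewrite -smoothvE; exact: (conn_linear hc). Qed.

Lemma conn_add_s p v Y Z : smoothv p Y -> smoothv p Z ->
  nabla p v (fun q => Y q + Z q) = nabla p v Y + nabla p v Z.
Proof. rewrite -!smoothvE; exact: (conn_add hc). Qed.

Lemma conn_leibniz_s p v F Y : smoothf p F -> smoothv p Y ->
  nabla p v (fun q => F q *: Y q) = ddir p v F *: Y p + F p *: nabla p v Y.
Proof. rewrite -smoothvE -smoothfE -dirE; exact: (conn_leibniz hc). Qed.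

Lemma conn_local_s p v Y Z : smoothv p Y ->
  (\forall q \near p, Y q = Z q) -> nabla p v Y = nabla p v Z.
Proof. rewrite -smoothvE; exact: (conn_local hc). Qed.

Lemma conn_dir0 p Y : smoothv p Y -> nabla p 0 Y = 0.
Proof.
move=> sY; have := conn_linear_s 1 0 0 sY.
rewrite !scale1r addr0 => /eqP.
by rewrite -[X in X == _]addr0 (inj_eq (addrI _)) eq_sym => /eqP.
Qed.

Lemma conn_dirZ p a v Y : smoothv p Y ->
  nabla p (a *: v) Y = a *: nabla p v Y.
Proof.
by move=> sY; rewrite -[a *: v]addr0 conn_linear_s // conn_dir0 // addr0.
Qed.

Lemma conn_dirD p v w Y : smoothv p Y ->
  nabla p (v + w) Y = nabla p v Y + nabla p w Y.
Proof. by move=> sY; rewrite -[v]scale1r conn_linear_s // !scale1r. Qed.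

Lemma conn_dirN p v Y : smoothv p Y -> nabla p (- v) Y = - nabla p v Y.
Proof. by move=> sY; rewrite -scaleN1r conn_dirZ // scaleN1r. Qed.

Lemma conn_dir_sum p (I : Type) (s : seq I) (v : I -> 'cV[R]_m) Y :
  smoothv p Y ->
  nabla p (\sum_(i <- s) v i) Y = \sum_(i <- s) nabla p (v i) Y.
Proof.
move=> sY; elim/big_rec2 : _ => [|i y1 y2 _ <-]; first exact: conn_dir0.
exact: conn_dirD.
Qed.

Lemma conn0 p v : nabla p v (fun=> 0) = 0.
Proof.
have := conn_leibniz_s v (smoothf_cst p (0 : R)) (smoothv0 p).
by rewrite ddir_cst !scale0r addr0.
Qed.

Lemma connZ p v a Y : smoothv p Y ->
  nabla p v (fun q => a *: Y q) = a *: nabla p v Y.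
Proof.
move=> sY; rewrite (conn_leibniz_s v (smoothf_cst p a) sY).
by rewrite ddir_cst scale0r add0r.
Qed.

Lemma smooth_cov p X Y : smoothv p X -> smoothv p Y ->
  smoothv p (cov nabla X Y).
Proof.
rewrite -!smoothvE => -[U [oU Up] sX] [V [oV Vp] sY]; exists (U `&` V).
  by split; [exact: openI|].
apply: (conn_smooth hc); first exact: openI.
- by apply/smooth_vf_onP => [|q [Uq _]]; [exact: openI|exists U].
- by apply/smooth_vf_onP => [|q [_ Vq]]; [exact: openI|exists V].
Qed.

Lemma eq_cov p X X' Y Y' : smoothv p Y -> X p = X' p ->
  (\forall q \near p, Y q = Y' q) -> cov nabla X Y p = cov nabla X' Y' p.
Proof. by move=> sY; rewrite /cov => ->; exact: conn_local_s. Qed.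

Lemma crvE X Y Z p : crv nabla X Y Z p
  = cov nabla X (cov nabla Y Z) p - cov nabla Y (cov nabla X Z) p
    - cov nabla (brk X Y) Z p.
Proof. by rewrite crv.unlock -lieE. Qed.

Lemma curvC X Y Z p : smoothv p X -> smoothv p Y ->
  smoothv p Z -> crv nabla X Y Z p = - crv nabla Y X Z p.
Proof.
move=> sX sY sZ; rewrite !crvE.
have -> : cov nabla (brk X Y) Z p = - cov nabla (brk Y X) Z p.
  by rewrite /cov (brkC X Y) conn_dirN.
by rewrite !opprD !opprK [_ + cov nabla X _ _]addrC.
Qed.

Lemma eq_crv X X' Y Y' Z Z' p :
    smoothv p X -> smoothv p Y -> smoothv p Z ->
    (\forall q \near p, X q = X' q) -> (\forall q \near p, Y q = Y' q) ->
    (\forall q \near p, Z q = Z' q) ->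
  crv nabla X Y Z p = crv nabla X' Y' Z' p.
Proof.
move=> sX sY sZ XX' YY' ZZ'; rewrite !crvE.
have half A A' B B' : smoothv p B -> (\forall q \near p, A q = A' q) ->
    (\forall q \near p, B q = B' q) ->
    cov nabla A (cov nabla B Z) p = cov nabla A' (cov nabla B' Z') p.
  move=> sB AA' BB'; apply: eq_cov; [exact: smooth_cov|exact: nbhs_singleton AA'|].
  have nZ : \forall q \near p, \forall y \near q, Z y = Z' y.
    by move/nbhs_interior : ZZ'.
  by apply: filterS3 BB' (smoothv_near sZ) nZ => q Bq sq Zq; exact: eq_cov.
rewrite (half _ _ _ _ sY XX' YY') (half _ _ _ _ sX YY' XX').
by rewrite (@eq_cov p (brk X Y) (brk X' Y') Z Z') // (eq_brk XX' YY').
Qed.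

Lemma curvDl X X' Y Z p : smoothv p X -> smoothv p X' ->
    smoothv p Y -> smoothv p Z ->
  crv nabla (fun q => X q + X' q) Y Z p
  = crv nabla X Y Z p + crv nabla X' Y Z p.
Proof.
move=> sX sX' sY sZ; rewrite !crvE.
have sYZ := smooth_cov sY sZ; have sXZ := smooth_cov sX sZ.
have sXZ' := smooth_cov sX' sZ.
have -> : cov nabla (fun q => X q + X' q) (cov nabla Y Z) p
    = cov nabla X (cov nabla Y Z) p + cov nabla X' (cov nabla Y Z) p.
  exact: conn_dirD.
have -> : cov nabla Y (cov nabla (fun q => X q + X' q) Z) p
    = cov nabla Y (cov nabla X Z) p + cov nabla Y (cov nabla X' Z) p.
  rewrite /cov -conn_add_s //; apply: conn_local_s.
    by apply: smooth_cov => //; exact: smoothvD.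
  by apply: filterS (smoothv_near sZ) => q sq; rewrite -conn_dirD.
have -> : cov nabla (brk (fun q => X q + X' q) Y) Z p
    = cov nabla (brk X Y) Z p + cov nabla (brk X' Y) Z p.
  by rewrite /cov brkDl // conn_dirD.
by apply/matrixP => i j; rewrite !mxE; ring.
Qed.

Lemma curvZl F X Y Z p : smoothf p F -> smoothv p X ->
    smoothv p Y -> smoothv p Z ->
  crv nabla (fun q => F q *: X q) Y Z p = F p *: crv nabla X Y Z p.
Proof.
move=> sF sX sY sZ; rewrite !crvE.
have sYZ := smooth_cov sY sZ; have sXZ := smooth_cov sX sZ.
have -> : cov nabla (fun q => F q *: X q) (cov nabla Y Z) p
    = F p *: cov nabla X (cov nabla Y Z) p.
  exact: conn_dirZ.
have -> : cov nabla Y (cov nabla (fun q => F q *: X q) Z) p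
    = ddir p (Y p) F *: cov nabla X Z p + F p *: cov nabla Y (cov nabla X Z) p.
  rewrite /cov -conn_leibniz_s //; apply: conn_local_s.
    by apply: smooth_cov => //; exact: smoothvZ.
  by apply: filterS (smoothv_near sZ) => q sq; rewrite -conn_dirZ.
have -> : cov nabla (brk (fun q => F q *: X q) Y) Z p
    = F p *: cov nabla (brk X Y) Z p - ddir p (Y p) F *: cov nabla X Z p.
  by rewrite /cov brkZl // conn_dirD // conn_dirN // !conn_dirZ.
by apply/matrixP => i j; rewrite !mxE; ring.
Qed.

Lemma curvDr X Y Z Z' p : smoothv p X -> smoothv p Y ->
    smoothv p Z -> smoothv p Z' ->
  crv nabla X Y (fun q => Z q + Z' q) p
  = crv nabla X Y Z p + crv nabla X Y Z' p.
Proof.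
move=> sX sY sZ sZ'; rewrite !crvE.
have half A B : smoothv p A -> smoothv p B ->
    cov nabla A (cov nabla B (fun q => Z q + Z' q)) p
    = cov nabla A (cov nabla B Z) p + cov nabla A (cov nabla B Z') p.
  move=> sA sB; have sBZ := smooth_cov sB sZ; have sBZ' := smooth_cov sB sZ'.
  rewrite /cov -conn_add_s //; apply: conn_local_s.
    by apply: smooth_cov => //; exact: smoothvD.
  near=> q; rewrite conn_add_s //; near: q; exact: smoothv_near.
rewrite !half //.
have -> : cov nabla (brk X Y) (fun q => Z q + Z' q) p
    = cov nabla (brk X Y) Z p + cov nabla (brk X Y) Z' p by exact: conn_add_s.
by apply/matrixP => i j; rewrite !mxE; ring.
Unshelve. all: by end_near. Qed.

Lemma curvZr F X Y Z p : smoothf p F -> smoothv p X ->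
    smoothv p Y -> smoothv p Z ->
  crv nabla X Y (fun q => F q *: Z q) p = F p *: crv nabla X Y Z p.
Proof.
move=> sF sX sY sZ; rewrite !crvE.
have half A B : smoothv p A -> smoothv p B ->
    cov nabla A (cov nabla B (fun q => F q *: Z q)) p
    = ddir p (A p) (fun q => ddir q (B q) F) *: Z p
      + ddir p (B p) F *: cov nabla A Z p
      + (ddir p (A p) F *: cov nabla B Z p
         + F p *: cov nabla A (cov nabla B Z) p).
  move=> sA sB; have sBZ := smooth_cov sB sZ.
  have sBF := smooth_ddir sB sF.
  rewrite /cov -conn_leibniz_s // -conn_leibniz_s // -conn_add_s.
  - apply: conn_local_s; first by apply: smooth_cov => //; exact: smoothvZ.
    near=> q; rewrite conn_leibniz_s //; near: q.
      exact: smoothf_near.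
    exact: smoothv_near.
  - exact: smoothvZ.
  - exact: smoothvZ.
rewrite !half //.
have -> : cov nabla (brk X Y) (fun q => F q *: Z q) p
    = ddir p (brk X Y p) F *: Z p + F p *: cov nabla (brk X Y) Z p.
  exact: conn_leibniz_s.
rewrite brk_ddir //.
apply/matrixP => i j; rewrite !mxE; ring.
Unshelve. all: by end_near. Qed.

(** A field vanishing at [p] is a combination of coordinate fields with
    coefficients vanishing at [p], and curvature is linear over functions. *)
Lemma crv0l X Y Z p : smoothv p X -> smoothv p Y -> smoothv p Z ->
  X p = 0 -> crv nabla X Y Z p = 0.
Proof.
move=> sX sY sZ X0; pose c i q := dir q (X q) (chart p) i 0.
pose E i := coord_vf p (delta_mx i 0).
have sE i : smoothv p (E i) by exact: smoothv_coord_center.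
have sc i : smoothf p (c i) by exact: smoothf_component.
have sl (s : seq 'I_m) : smoothv p (fun q => \sum_(i <- s) c i q *: E i q).
  by apply: smoothv_sum => i _; exact: smoothvZ.
rewrite (@eq_crv _ (fun q => \sum_i c i q *: E i q) Y Y Z Z) //;
  [|exact: coord_vf_expand|exact: nearW|exact: nearW].
suff -> (s : seq 'I_m) : crv nabla (fun q => \sum_(i <- s) c i q *: E i q) Y Z p
    = \sum_(i <- s) c i p *: crv nabla (E i) Y Z p.
  apply: big1 => i _.
  by rewrite /c X0 (chart_ddir _ _ (chart_dom_mem p)) ddir0 scale0r.
have nr (W : vfield M) : \forall q \near p, W q = W q by exact: nearW.
elim: s => [|i s ih].
  have e0 : \forall q \near p, \sum_(i <- [::]) c i q *: E i q = 0 *: (fun=> 0) q.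
    by apply: nearW => q; rewrite big_nil scale0r.
  have s0 := smoothf_cst p (0 : R); have sv0 := smoothv0 p.
  rewrite (eq_crv (sl [::]) sY sZ e0 (nr Y) (nr Z)) (curvZl s0) // scale0r.
  by rewrite big_nil.
have e1 : \forall q \near p, \sum_(j <- i :: s) c j q *: E j q
    = c i q *: E i q + \sum_(j <- s) c j q *: E j q.
  by apply: nearW => q; rewrite big_cons.
have sci := smoothvZ (sc i) (sE i).
by rewrite (eq_crv (sl (i :: s)) sY sZ e1 (nr Y) (nr Z)) big_cons -ih curvDl // curvZl.
Qed.

Lemma crv0r X Y Z p : smoothv p X -> smoothv p Y -> smoothv p Z ->
  Z p = 0 -> crv nabla X Y Z p = 0.
Proof.
move=> sX sY sZ Z0; pose c i q := dir q (Z q) (chart p) i 0.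
pose E i := coord_vf p (delta_mx i 0).
have sE i : smoothv p (E i) by exact: smoothv_coord_center.
have sc i : smoothf p (c i) by exact: smoothf_component.
have sl (s : seq 'I_m) : smoothv p (fun q => \sum_(i <- s) c i q *: E i q).
  by apply: smoothv_sum => i _; exact: smoothvZ.
rewrite (@eq_crv X X Y Y _ (fun q => \sum_i c i q *: E i q)) //;
  [|exact: nearW|exact: nearW|exact: coord_vf_expand].
suff -> (s : seq 'I_m) : crv nabla X Y (fun q => \sum_(i <- s) c i q *: E i q) p
    = \sum_(i <- s) c i p *: crv nabla X Y (E i) p.
  apply: big1 => i _.
  by rewrite /c Z0 (chart_ddir _ _ (chart_dom_mem p)) ddir0 scale0r.
have nr (W : vfield M) : \forall q \near p, W q = W q by exact: nearW.
elim: s => [|i s ih].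
  have e0 : \forall q \near p, \sum_(i <- [::]) c i q *: E i q = 0 *: (fun=> 0) q.
    by apply: nearW => q; rewrite big_nil scale0r.
  have s0 := smoothf_cst p (0 : R); have sv0 := smoothv0 p.
  rewrite (eq_crv sX sY (sl [::]) (nr X) (nr Y) e0) (curvZr s0) // scale0r.
  by rewrite big_nil.
have e1 : \forall q \near p, \sum_(j <- i :: s) c j q *: E j q
    = c i q *: E i q + \sum_(j <- s) c j q *: E j q.
  by apply: nearW => q; rewrite big_cons.
have sci := smoothvZ (sc i) (sE i).
by rewrite (eq_crv sX sY (sl (i :: s)) (nr X) (nr Y) e1) big_cons -ih curvDr // curvZr.
Qed.

Lemma crv_tensorl X X' Y Z p : smoothv p X -> smoothv p X' -> smoothv p Y ->
  smoothv p Z -> X p = X' p -> crv nabla X Y Z p = crv nabla X' Y Z p.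
Proof.
move=> sX sX' sY sZ XX'; have s1 := smoothf_cst p (-1 : R).
have sN := smoothvZ s1 sX'.
have := crv0l (smoothvD sX sN) sY sZ.
rewrite curvDl // curvZl // XX' scaleN1r subrr => /(_ erefl) /eqP.
by rewrite scaleN1r subr_eq0 => /eqP.
Qed.

(** Fields with equal values at [p] differ by a field to which [crv0l] or [crv0r]
    applies. *)
Lemma crv_tensor X X' Y Y' Z Z' p :
    smoothv p X -> smoothv p X' -> smoothv p Y -> smoothv p Y' ->
    smoothv p Z -> smoothv p Z' -> X p = X' p -> Y p = Y' p -> Z p = Z' p ->
  crv nabla X Y Z p = crv nabla X' Y' Z' p.
Proof.
move=> sX sX' sY sY' sZ sZ' XX' YY' ZZ'.
rewrite (crv_tensorl sX sX') // curvC // (crv_tensorl sY sY') // -curvC //.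
have s1 := smoothf_cst p (-1 : R); have sN := smoothvZ s1 sZ'.
have := crv0r sX' sY' (smoothvD sZ sN).
rewrite curvDr // curvZr // ZZ' scaleN1r subrr => /(_ erefl) /eqP.
by rewrite scaleN1r subr_eq0 => /eqP.
Qed.

Lemma RmE X Y Z p : smoothv p X -> smoothv p Y -> smoothv p Z ->
  crv nabla X Y Z p = Rm nabla p (X p) (Y p) (Z p).
Proof.
move=> sX sY sZ; rewrite Rm.unlock; apply: crv_tensor => //;
  by [exact: smoothv_coord_center|rewrite coord_vf_center].
Qed.

Lemma Rm_linearl p a u u' v w :
  Rm nabla p (a *: u + u') v w = a *: Rm nabla p u v w + Rm nabla p u' v w.
Proof.
have sc x := smoothv_coord_center p x.
rewrite !Rm.unlock -(curvZl (smoothf_cst p a)) // -curvDl //; last exact: smoothvZ (smoothf_cst p a) _.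
apply: crv_tensor => //; rewrite ?coord_vf_center //.
by apply: smoothvD => //; exact: smoothvZ (smoothf_cst p a) _.
Qed.

Lemma RmC p u v w : Rm nabla p u v w = - Rm nabla p v u w.
Proof. by rewrite !Rm.unlock curvC //; exact: smoothv_coord_center. Qed.

Lemma Rm_linear_mid p a u v v' w :
  Rm nabla p u (a *: v + v') w = a *: Rm nabla p u v w + Rm nabla p u v' w.
Proof. by rewrite RmC Rm_linearl opprD -scalerN -!RmC. Qed.

Lemma Rm_linearr p a u v w w' :
  Rm nabla p u v (a *: w + w') = a *: Rm nabla p u v w + Rm nabla p u v w'.
Proof.
have sc x := smoothv_coord_center p x.
rewrite !Rm.unlock -(curvZr (smoothf_cst p a)) // -curvDr //; last exact: smoothvZ (smoothf_cst p a) _.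
apply: crv_tensor => //; rewrite ?coord_vf_center //.
by apply: smoothvD => //; exact: smoothvZ (smoothf_cst p a) _.
Qed.

End Connections.

(** * Linear algebra of bivectors *)

Section Even3.

(** The even permutations of the indices are the triples [i], [nx i],
    [nx (nx i)]; in this form the cyclic identities become rewriting rules. *)
Definition nx (i : 'I_3) : 'I_3 := i + 1.

Lemma nx3 i : nx (nx (nx i)) = i.
Proof. by apply/val_inj; case: i => [[|[|[|//]]]]. Qed.

Lemma even3_nx i : even3 i (nx i) (nx (nx i)).
Proof.
pose z : 'I_3 := 0; pose o : 'I_3 := 1; pose t : 'I_3 := 2%:R.
have zo : z != o by []. have zt : z != t by []. have ot : o != t by [].
have oz : o != z by []. have tz : t != z by []. have to : t != o by [].
have [->|[->|->]] : i = 0 \/ i = 1 \/ i = 2%:R.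
- case: i => [[|[|[|//]]]] h; [left|right; left|right; right]; exact/val_inj.
- by exists (1 : 'S_3)%g; rewrite odd_perm1 !perm1; split=> //; exact/val_inj.
- exists (tperm z o * tperm z t : 'S_3)%g.
  rewrite odd_permM !odd_tperm ?zo ?zt -[0]/z -[1]/o -[2%:R]/t !permM.
  rewrite !tpermL !tpermR (tpermD zo to) (tpermD zt ot) tpermR tpermL.
  by split=> //; exact/val_inj.
- exists (tperm z t * tperm z o : 'S_3)%g.
  rewrite odd_permM !odd_tperm ?zo ?zt -[0]/z -[1]/o -[2%:R]/t !permM.
  rewrite !tpermL !tpermR (tpermD zt ot) (tpermD zo to) tpermR tpermL.
  by split=> //; exact/val_inj.
Qed.

Lemma sum3 (V : nmodType) (F : 'I_3 -> V) i :
  \sum_l F l = F i + F (nx i) + F (nx (nx i)).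
Proof.
rewrite !big_ord_recl big_ord0 addr0.
have [->|[->|->]] : i = 0 \/ i = 1 \/ i = 2%:R.
- case: i => [[|[|[|//]]]] h; [left|right; left|right; right]; exact/val_inj.
- by rewrite addrA; congr (_ + F _ + F _); exact/val_inj.
- rewrite addrC; congr (F _ + F _ + F _); exact/val_inj.
- rewrite addrA addrC addrA; congr (F _ + F _ + F _); exact/val_inj.
Qed.

End Even3.

Local Notation skew := Defs.skewmx.

Section Forms.
Variables (R : realType) (m : nat).
Implicit Types (G A B w : 'M[R]_m) (u v z t : 'cV[R]_m) (a b : 'rV[R]_m).

Lemma ipC G u v : G^T = G -> ip G u v = ip G v u.
Proof.
move=> sG; rewrite /ip -[in LHS](trmxK (u^T *m G *m v)) mxE.
by rewrite !trmx_mul sG trmxK mulmxA.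
Qed.

Lemma eq_mulmx_col k (A B : 'M[R]_(k, m)) : (forall u, A *m u = B *m u) -> A = B.
Proof.
move=> AB; apply/matrixP => i j.
by have := congr1 (fun c : 'cV[R]_k => c i 0) (AB (delta_mx j 0)); rewrite -!colE !mxE.
Qed.

Lemma ipDl G u v z : ip G (u + v) z = ip G u z + ip G v z.
Proof. by rewrite /ip linearD /= !mulmxDl mxE. Qed.
Lemma ipZl G c u z : ip G (c *: u) z = c * ip G u z.
Proof. by rewrite /ip linearZ /= -!scalemxAl mxE. Qed.
Lemma ipNl G u z : ip G (- u) z = - ip G u z.
Proof. by rewrite -scaleN1r ipZl mulN1r. Qed.
Lemma ip0l G z : ip G 0 z = 0.
Proof. by rewrite -(scale0r 0) ipZl mul0r. Qed.
Lemma ipDr G u v z : ip G z (u + v) = ip G z u + ip G z v.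
Proof. by rewrite /ip mulmxDr mxE. Qed.
Lemma ipZr G c u z : ip G z (c *: u) = c * ip G z u.
Proof. by rewrite /ip -!scalemxAr mxE. Qed.
Lemma ipNr G u z : ip G z (- u) = - ip G z u.
Proof. by rewrite -scaleN1r ipZr mulN1r. Qed.

Lemma evD a u v : ev a (u + v) = ev a u + ev a v.
Proof. by rewrite /ev mulmxDr mxE. Qed.
Lemma evZ a c u : ev a (c *: u) = c * ev a u.
Proof. by rewrite /ev -scalemxAr mxE. Qed.
Lemma evN a u : ev a (- u) = - ev a u.
Proof. by rewrite -scaleN1r evZ mulN1r. Qed.
Lemma ev0 a : ev a 0 = 0.
Proof. by rewrite /ev mulmx0 mxE. Qed.
Lemma evM a A u : ev a (A *m u) = ev (a *m A) u.
Proof. by rewrite /ev mulmxA. Qed.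
Lemma outer_ev v a u : (v *m a) *m u = ev a u *: v.
Proof. by rewrite -mulmxA [a *m u]mx11_scalar mul_mx_scalar. Qed.

Lemma ip_inj G u v : (forall x, x != 0 -> 0 < ip G x x) ->
  (forall x, ip G u x = ip G v x) -> u = v.
Proof.
move=> pG uv; apply/eqP; rewrite -subr_eq0; apply: contraTT isT => uv0.
by have := pG _ uv0; rewrite ipDl ipNl uv subrr ltxx.
Qed.

Lemma pos_unit G : (forall x, x != 0 -> 0 < ip G x x) -> G \in unitmx.
Proof.
move=> pG; rewrite unitmxE unitfE; apply/det0P => -[w w0 wG].
have wT0 : w^T != 0 by rewrite -(inj_eq trmx_inj) trmxK trmx0.
by have := pG _ wT0; rewrite /ip trmxK wG mul0mx mxE ltxx.
Qed.

Lemma bipC G A B : G^T = G -> bip G A B = bip G B A.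
Proof.
move=> sG; rewrite /bip; congr (_ * _).
by rewrite -mxtrace_tr !trmx_mul !trmxK !sG mxtrace_mulC !mulmxA.
Qed.

(** For [L] the horizontal lift and [J] the differential of a Riemannian
    submersion, this transfers quadratic forms on bivectors from the base to the
    total space. *)
Lemma bip_adjoint k G (H : 'M[R]_k) (L : 'M[R]_(m, k)) (J : 'M[R]_(k, m))
    (B : 'M[R]_k) w :
  G^T = G -> H^T = H -> L^T *m G = H *m J ->
  bip G (L *m B *m L^T) w = bip H B (J *m w *m J^T).
Proof.
move=> sG sH LG; have GL : G *m L = J^T *m H.
  by rewrite -[LHS]trmxK trmx_mul sG LG trmx_mul sH.
rewrite /bip sG sH !trmx_mul trmxK -!mulmxA mxtrace_mulC -!mulmxA GL.
by rewrite (mulmxA L^T G) LG !mulmxA.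
Qed.

Lemma bipDl G A B w : bip G (A + B) w = bip G A w + bip G B w.
Proof. by rewrite /bip linearD /= !mulmxDl linearD /= mulrDr. Qed.
Lemma bipZl G c A w : bip G (c *: A) w = c * bip G A w.
Proof. by rewrite /bip linearZ /= -!scalemxAl linearZ /= mulrCA. Qed.
Lemma bipNl G A w : bip G (- A) w = - bip G A w.
Proof. by rewrite -scaleN1r bipZl mulN1r. Qed.
Lemma bipDr G A B w : bip G w (A + B) = bip G w A + bip G w B.
Proof. by rewrite /bip mulmxDr mulmxDl linearD /= mulrDr. Qed.
Lemma bipZr G c A w : bip G w (c *: A) = c * bip G w A.
Proof. by rewrite /bip -scalemxAr -scalemxAl linearZ /= mulrCA. Qed.
Lemma bipNr G A w : bip G w (- A) = - bip G w A.
Proof. by rewrite -scaleN1r bipZr mulN1r. Qed.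
Lemma bip_suml G (I : Type) (s : seq I) (F : I -> 'M[R]_m) w :
  bip G (\sum_(i <- s) F i) w = \sum_(i <- s) bip G (F i) w.
Proof.
elim: s => [|i s ih]; last by rewrite !big_cons bipDl ih.
by rewrite !big_nil -(scale0r 0) bipZl mul0r.
Qed.
Lemma bip_sumr G (I : Type) (s : seq I) (F : I -> 'M[R]_m) w :
  bip G w (\sum_(i <- s) F i) = \sum_(i <- s) bip G w (F i).
Proof.
elim: s => [|i s ih]; last by rewrite !big_cons bipDr ih.
by rewrite !big_nil -(scale0r 0) bipZr mul0r.
Qed.

Lemma skew_wedge u v : skew (wedge_vec u v).
Proof.
by rewrite /Defs.skewmx /wedge_vec linearB /= !trmx_mul !trmxK opprB.
Qed.

Lemma skewD A B : skew A -> skew B -> skew (A + B).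
Proof. by rewrite /Defs.skewmx linearD /= => -> ->; rewrite opprD. Qed.
Lemma skewZ c A : skew A -> skew (c *: A).
Proof. by rewrite /Defs.skewmx linearZ /= => ->; rewrite scalerN. Qed.
Lemma skew_conj k (C : 'M[R]_(k, m)) A : skew A -> skew (C *m A *m C^T).
Proof.
by rewrite /Defs.skewmx !trmx_mul trmxK => ->; rewrite mulNmx mulmxN mulmxA.
Qed.
Lemma skew_sum (I : Type) (s : seq I) (F : I -> 'M[R]_m) :
  (forall i, skew (F i)) -> skew (\sum_(i <- s) F i).
Proof.
move=> sF; elim: s => [|i s ih]; last by rewrite big_cons; exact: skewD.
by rewrite big_nil /Defs.skewmx trmx0 oppr0.
Qed.

(** The metric turns a bivector [B] into the skew endomorphism [B *m G]; in this
    way values of a curvature operator become curvature endomorphisms. *)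
Lemma bip_wedge_endo G B z t : G^T = G -> skew B ->
  bip G B (wedge_vec z t) = - ip G (B *m G *m z) t.
Proof.
move=> sG sB; rewrite /bip /wedge_vec sB sG.
have E (x y : 'cV[R]_m) : \tr (- B *m G *m (x *m y^T) *m G)
    = - ip G y (B *m G *m x).
  rewrite !mulmxA -[X in \tr X]mulmxA mxtrace_mulC trace_mx11 /ip.
  by rewrite !mulNmx mulmxN mxE !mulmxA.
rewrite mulmxBr mulmxBl raddfB /= !E.
have -> : ip G z (B *m G *m t) = - ip G t (B *m G *m z).
  rewrite /ip -[in LHS](trmxK (z^T *m _ *m _)) mxE !trmx_mul sG sB trmxK.
  by rewrite !(mulmxN, mulNmx) !mulmxA mxE.
by rewrite (ipC _ _ sG); lra.
Qed.

Lemma skew_decomp w : skew w ->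
  w = 2^-1 *: \sum_i \sum_j w i j *: wedge_vec (delta_mx i 0) (delta_mx j 0).
Proof.
move=> sw; have wT i j : w j i = - w i j.
  by have := congr1 (fun A : 'M[R]_m => A i j) sw; rewrite /= !mxE.
have E : \sum_i \sum_j w i j *: ((delta_mx i 0 : 'cV[R]_m) *m
      (delta_mx j 0 : 'cV[R]_m)^T) = w.
  rewrite [RHS]matrix_sum_delta; apply: eq_bigr => i _; apply: eq_bigr => j _.
  by rewrite trmx_delta mul_delta_mx.
have -> : \sum_i \sum_j w i j *: wedge_vec (delta_mx i 0) (delta_mx j 0) = w + w.
  rewrite -[in X in _ = X + _]E -[in X in _ = _ + X]E.
  rewrite [X in _ = _ + X]exchange_big /= -big_split /=; apply: eq_bigr => i _.
  rewrite -big_split /=; apply: eq_bigr => j _.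
  by rewrite (wT i j) /wedge_vec scalerBr scaleNr.
rewrite scalerDr -scalerDl.
have -> : 2^-1 + 2^-1 = 1 :> R by lra.
by rewrite scale1r.
Qed.

(** Linear identities on bivectors need only be checked on decomposable ones. *)
Lemma skew_ind (P : 'M[R]_m -> Prop) :
  (forall A B, P A -> P B -> P (A + B)) -> (forall c A, P A -> P (c *: A)) ->
  (forall u v, P (wedge_vec u v)) -> forall w, skew w -> P w.
Proof.
move=> PD PZ Pw w /skew_decomp ->; apply: (PZ).
have P0 : P 0 by rewrite -(scale0r (wedge_vec 0 0)); exact: (PZ).
by elim/big_ind: _ => // i _; elim/big_ind: _ => // j _; exact: (PZ).
Qed.

(** For [E] skew with respect to [G], [E *m invmx G] is the bivector dual to
    the 2-form [G u (E v)]. *)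
Lemma skew_dual G E : G^T = G -> G \in unitmx -> E^T *m G = - (G *m E) ->
  skew (E *m invmx G).
Proof.
move=> sG uG sE; rewrite /Defs.skewmx trmx_mul trmx_inv sG.
apply: (can_inj (mulKmx uG)); rewrite mulKVmx // mulmxN mulmxA -mulNmx -sE.
by rewrite mulmxK.
Qed.

Lemma skew_endoP G E : G^T = G ->
  (forall u v, ip G (E *m u) v = - ip G u (E *m v)) -> E^T *m G = - (G *m E).
Proof.
move=> sG sE; have entry A i j :
    ((delta_mx i 0 : 'cV[R]_m)^T *m A *m (delta_mx j 0 : 'cV[R]_m)) 0 0 = A i j.
  by rewrite trmx_delta -rowE -colE !mxE.
apply/matrixP => i j; rewrite [RHS]mxE -!entry.
have := sE (delta_mx i 0) (delta_mx j 0); rewrite /ip trmx_mul.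
by rewrite !mulmxA.
Qed.

Lemma bip_dual G E z t : G^T = G -> G \in unitmx -> E^T *m G = - (G *m E) ->
  bip G (E *m invmx G) (wedge_vec z t) = ip G z (E *m t).
Proof.
move=> sG uG sE; rewrite bip_wedge_endo //; last exact: skew_dual.
rewrite mulmxKV // /ip trmx_mul -(mulmxA z^T E^T G) sE mulmxN mulNmx mxE opprK.
by rewrite !mulmxA.
Qed.

Lemma bip_dual_tr G A E : G^T = G -> G \in unitmx -> skew A ->
  bip G A (E *m invmx G) = - 2^-1 * \tr (A *m G *m E).
Proof.
move=> sG uG sA; rewrite /bip sA sG -!mulmxA mulVmx // mulmx1 !mulNmx.
by rewrite raddfN /= mulrN mulNr !mulmxA.
Qed.

End Forms.

(** * Curvature operators commuting with a quaternionic structure *)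

Section Quaternionic.
Variables (R : realType) (n : nat) (d : nat) (H : 'M[R]_d).
Variables (J : 'I_3 -> 'M[R]_d) (A : {linear 'M[R]_d -> 'M[R]_d}) (c : R).
Hypotheses (n_gt0 : (0 < n)%N) (dn : d = (4 * n)%N).
Hypotheses (sH : H^T = H) (uH : H \in unitmx).
Hypothesis sJ : forall i, (J i)^T *m H = - (H *m J i).
Hypothesis JJ : forall i, J i *m J i = - 1%:M.
Hypothesis Jij : forall i, J i *m J (nx i) = J (nx (nx i)).
Hypothesis Jji : forall i, J (nx i) *m J i = - J (nx (nx i)).
Hypothesis skA : forall w, skew w -> skew (A w).
Hypothesis symA : forall w t, skew w -> skew t -> bip H (A w) t = bip H w (A t).

(** The bivector dual to the Kaehler form of [J i]. *)
Definition kform i : 'M[R]_d := J i *m invmx H.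
Definition kval i (w : 'M[R]_d) : R := bip H (kform i) w.

(** The commutators of [A w] with the structure are those prescribed by the
    curvature of the bundle it spans. *)
Hypothesis commA : forall i w, skew w ->
  (A w *m H) *m J i - J i *m (A w *m H)
  = (4 * c) *: (kval (nx (nx i)) w *: J (nx i) - kval (nx i) w *: J (nx (nx i))).

Lemma skew_kform i : skew (kform i).
Proof. exact: skew_dual. Qed.

Let n0 : n%:R != 0 :> R. Proof. by rewrite pnatr_eq0 -lt0n. Qed.

Lemma trJJ i : \tr (J i *m J i) = - (4 * n%:R).
Proof. by rewrite JJ raddfN /= mxtrace1 dn natrM. Qed.

Lemma trJ_next i : \tr (J i *m J (nx i)) = 0.
Proof.
have := mxtrace_mulC (J i) (J (nx i)); rewrite Jij Jji raddfN /= => e.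
by lra.
Qed.

Lemma bip_kform i A' : skew A' -> bip H A' (kform i) = - 2^-1 * \tr (A' *m H *m J i).
Proof. exact: bip_dual_tr. Qed.

Lemma bip_kformE i j : bip H (kform i) (kform j) = - 2^-1 * \tr (J i *m J j).
Proof. by rewrite bip_kform ?mulmxKV //; exact: skew_kform. Qed.

Lemma bip_kform_same i : bip H (kform i) (kform i) = 2 * n%:R.
Proof. by rewrite bip_kformE trJJ; field. Qed.

Lemma bip_kform_next i : bip H (kform i) (kform (nx i)) = 0.
Proof. by rewrite bip_kformE trJ_next mulr0. Qed.

(** Taking the trace of the commutation relation against the next structure
    shows that the dual forms are eigenvectors of [A]. *)
Lemma bip_A_kform k w : skew w -> bip H (A w) (kform k) = 4 * n%:R * c * kval k w.
Proof.
move=> sw; rewrite bip_kform; last exact: skA.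
rewrite -(nx3 k); set i := nx k; set j := nx i.
have e := congr1 (fun B => \tr (B *m J j)) (commA i sw); rewrite -/j /= in e.
have l : \tr ((A w *m H *m J i - J i *m (A w *m H)) *m J j)
    = 2 * \tr (A w *m H *m J (nx j)).
  rewrite mulmxBl raddfB /= -(mulmxA _ (J i) (J j)) Jij.
  rewrite -(mulmxA (J i)) (mxtrace_mulC (J i)) -(mulmxA _ (J j) (J i)).
  have -> : J j *m J i = - J (nx j) by exact: Jji.
  rewrite mulmxN raddfN /= -/j.
  by ring.
have r : \tr ((4 * c) *: (kval (nx j) w *: J j - kval j w *: J (nx j)) *m J j)
    = - (16 * n%:R * c * kval (nx j) w).
  rewrite -scalemxAl mulmxBl -!scalemxAl mxtraceZ raddfB /= !mxtraceZ trJJ.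
  rewrite (mxtrace_mulC (J (nx j))) trJ_next; ring.
by move: e; rewrite l r => e; lra.
Qed.

Definition kproj (w : 'M[R]_d) : 'M[R]_d :=
  w - \sum_i (kval i w / (2 * n%:R)) *: kform i.

Lemma skew_kproj w : skew w -> skew (kproj w).
Proof.
move=> sw; apply: skewD => //; rewrite -scaleN1r; apply: skewZ.
by apply: skew_sum => i; apply: skewZ; exact: skew_kform.
Qed.

Lemma kval_proj_part i (a : 'I_3 -> R) :
  kval i (\sum_j a j *: kform j) = 2 * n%:R * a i.
Proof.
have e : bip H (kform i) (kform (nx (nx i))) = 0.
  have := bip_kform_next (nx (nx i)); rewrite nx3 => <-.
  by rewrite (bipC _ _ sH).
rewrite /kval bip_sumr (sum3 _ i) !bipZr bip_kform_same bip_kform_next e.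
by rewrite !mulr0 !addr0 mulrC.
Qed.

(** The symmetric operator [A] respects the splitting into the span of the
    [kform i] and its orthogonal complement. On the span it is [4 * n * c], and
    [kform i] has squared length [2 * n]; the quotient is the factor [2 * c]. *)
Lemma bip_kproj w : skew w ->
  bip H (A (kproj w)) (kproj w) = bip H (A w) w - 2 * c * \sum_i kval i w ^+ 2.
Proof.
move=> sw; rewrite /kproj; set s := \sum_i _ *: _.
have ss : skew s by apply: skew_sum => i; apply: skewZ; exact: skew_kform.
have bs t : skew t -> bip H (A t) s
    = 2 * c * \sum_i kval i w * kval i t.
  move=> st; rewrite bip_sumr mulr_sumr; apply: eq_bigr => i _.
  by rewrite bipZr bip_A_kform //; field.
rewrite linearB /= bipDl bipNl !bipDr !bipNr (symA ss sw) (bipC s _ sH).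
rewrite (bs _ sw) (bs _ ss).
have -> : \sum_i kval i w * kval i s = \sum_i kval i w * kval i w.
  apply: eq_bigr => i _; rewrite /s kval_proj_part.
  by congr (_ * _); field.
have -> : \sum_i kval i w ^+ 2 = \sum_i kval i w * kval i w.
  by apply: eq_bigr => i _; rewrite expr2.
by ring.
Qed.

Lemma bip_A_kform_same i :
  bip H (A (kform i)) (kform i) = 8 * n%:R ^+ 2 * c.
Proof.
by rewrite bip_A_kform ?/kval ?bip_kform_same; [ring|exact: skew_kform].
Qed.

End Quaternionic.

(** * 3-(alpha, delta)-Sasaki geometry *)

Section Structure.
Variables (R : realType) (m : nat) (M : manifold R m).
Variables (phi : 'I_3 -> M -> 'M[R]_m) (xi : 'I_3 -> vfield M).
Variables (eta : 'I_3 -> M -> 'rV[R]_m) (g : M -> 'M[R]_m).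
Variables (alpha delta : R).
Hypothesis hS : sasaki3 phi xi eta g alpha delta.
Implicit Types (p q : M) (u v w : 'cV[R]_m) (X Y Z : vfield M) (i : 'I_3).

Let h3 := s3_a3 hS.
Let acm i := a3_acm h3 i.
Let met := acm_metric (acm 0).

Lemma gS p : (g p)^T = g p. Proof. exact: (Defs.metric_sym met p). Qed.
Lemma g_pos p v : v != 0 -> 0 < ip (g p) v v. Proof. exact: (Defs.metric_pos met). Qed.
Lemma g_unit p : g p \in unitmx. Proof. by apply: pos_unit => v; exact: g_pos. Qed.
Lemma g_inj p u v : (forall w, ip (g p) u w = ip (g p) v w) -> u = v.
Proof. by apply: ip_inj => w; exact: g_pos. Qed.

Lemma phi_xi_same i p : phi i p *m xi i p = 0.
Proof. exact: (acm_phi_xi (acm i) p). Qed.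

Lemma phi_xi_next i p : phi i p *m xi (nx i) p = xi (nx (nx i)) p.
Proof. by have [] := a3_xi h3 (even3_nx i) p. Qed.

Lemma phi_xi_prev i p : phi i p *m xi (nx (nx i)) p = - xi (nx i) p.
Proof.
have := even3_nx (nx (nx i)); rewrite nx3 => e.
by have [_ ->] := a3_xi h3 e p; rewrite opprK.
Qed.

Lemma eta_xi_same i p : ev (eta i p) (xi i p) = 1.
Proof. exact: (acm_eta_xi (acm i) p). Qed.

Lemma eta_xi_next i p : ev (eta i p) (xi (nx i) p) = 0.
Proof.
have := even3_nx (nx i); rewrite nx3 => e.
have [_ ->] := a3_eta h3 e p.
by rewrite /ev mulNmx -mulmxA phi_xi_same mulmx0 oppr0 mxE.
Qed.

Lemma eta_xi_prev i p : ev (eta i p) (xi (nx (nx i)) p) = 0.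
Proof.
have := even3_nx (nx i); rewrite nx3 => e.
have [-> _] := a3_eta h3 e p.
by rewrite /ev -mulmxA phi_xi_same mulmx0 mxE.
Qed.

Lemma eta_xi i j p : ev (eta i p) (xi j p) = (i == j)%:R.
Proof.
have [->|[->|->]] : j = i \/ j = nx i \/ j = nx (nx i).
- by case: i j => [[|[|[|//]]] hi] [[|[|[|//]]] hj];
    (try by left; exact/val_inj); (try by right; left; exact/val_inj);
    right; right; exact/val_inj.
- by rewrite eqxx eta_xi_same.
- by rewrite eta_xi_next; case: i => [[|[|[|//]]] hi].
- by rewrite eta_xi_prev; case: i => [[|[|[|//]]] hi].
Qed.

Lemma eta_phi_same i p v : ev (eta i p) (phi i p *m v) = 0.
Proof. by rewrite evM (acm_eta_phi (acm i)) /ev mul0mx mxE. Qed.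

Lemma eta_phi_next i p v :
  ev (eta i p) (phi (nx i) p *m v) = ev (eta (nx (nx i)) p) v.
Proof. by rewrite evM; have [<- _] := a3_eta h3 (even3_nx i) p. Qed.

Lemma eta_phi_prev i p v :
  ev (eta i p) (phi (nx (nx i)) p *m v) = - ev (eta (nx i) p) v.
Proof.
have := even3_nx (nx (nx i)); rewrite nx3 => e.
have [_ ->] := a3_eta h3 e p.
by rewrite evM [in RHS]/ev mulNmx [in RHS]mxE opprK.
Qed.

Lemma phi_sq i p v :
  phi i p *m (phi i p *m v) = - v + ev (eta i p) v *: xi i p.
Proof.
by rewrite mulmxA (acm_phi2 (acm i)) mulmxDl mulNmx mul1mx outer_ev.
Qed.

Lemma phi_phi_next i p v : phi i p *m (phi (nx i) p *m v)
  = phi (nx (nx i)) p *m v + ev (eta (nx i) p) v *: xi i p.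
Proof.
by have [-> _] := a3_phi h3 (even3_nx i) p; rewrite mulmxA mulmxBl outer_ev subrK.
Qed.

Lemma phi_next_phi i p v : phi (nx i) p *m (phi i p *m v)
  = - (phi (nx (nx i)) p *m v) + ev (eta i p) v *: xi (nx i) p.
Proof.
have [_ ->] := a3_phi h3 (even3_nx i) p.
by rewrite mulmxA mulmxDl mulNmx outer_ev opprD opprK subrK.
Qed.

Lemma g_phi2 i p u v : ip (g p) (phi i p *m u) (phi i p *m v)
  = ip (g p) u v - ev (eta i p) u * ev (eta i p) v.
Proof. exact: (acm_compat (acm i) p u v). Qed.

Lemma g_xi i p v : ip (g p) v (xi i p) = ev (eta i p) v.
Proof.
have := g_phi2 i p v (xi i p); rewrite phi_xi_same eta_xi_same mulr1.
by rewrite (ipC _ _ (gS p)) ip0l => e; lra.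
Qed.

Lemma g_phi i p u v : ip (g p) (phi i p *m u) v = - ip (g p) u (phi i p *m v).
Proof.
have := g_phi2 i p u (phi i p *m v); rewrite phi_sq eta_phi_same mulr0 subr0.
by rewrite ipDr ipNr ipZr g_xi eta_phi_same mulr0 addr0 => <-; rewrite opprK.
Qed.

(** ** Smoothness of the structure tensors *)

Lemma smooth_xi p i : smoothv p (xi i).
Proof.
apply/smoothv_on; exists setT; first exact: openT.
by split=> //; exact: (acm_xi_smooth (acm i)).
Qed.

Lemma smooth_phi p i X : smoothv p X -> smoothv p (fun q => phi i q *m X q).
Proof.
move=> /smoothv_on[U oU [Up sX]]; apply/smoothv_on; exists U; first exact: oU.
split; first exact: Up.
exact: (acm_phi_smooth (acm i) oU sX).
Qed.

Lemma smooth_eta p i X : smoothv p X -> smoothf p (fun q => ev (eta i q) (X q)).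
Proof.
move=> /smoothv_on[U oU [Up sX]]; rewrite smoothf.unlock; exists U; first by split.
exact: (acm_eta_smooth (acm i) oU sX).
Qed.

Lemma eta_brk i p X Y : smoothv p X -> smoothv p Y ->
  ev (eta i p) (brk X Y p)
  = ddir p (X p) (fun q => ev (eta i q) (Y q))
    - ddir p (Y p) (fun q => ev (eta i q) (X q))
    - 2 * alpha * ip (g p) (X p) (phi i p *m Y p)
    - 2 * (alpha - delta)
      * wedge11 (eta (nx i) p) (eta (nx (nx i)) p) (X p) (Y p).
Proof.
rewrite -!smoothvE => sX sY.
have := s3_deta hS (even3_nx i) sX sY; rewrite /dform /Phi !dirE lieE => e.
by lra.
Qed.

(** ** The canonical connection *)

Variable nabla : connection M.
Let beta := 2 * (delta - 2 * alpha).
Hypothesis hn : canonical_connection phi eta g beta nabla.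
Let hc := cc_connection hn.

Lemma metric_cov p v Y Z : smoothv p Y -> smoothv p Z ->
  ddir p v (fun q => ip (g q) (Y q) (Z q))
  = ip (g p) (nabla p v Y) (Z p) + ip (g p) (Y p) (nabla p v Z).
Proof.
rewrite -!smoothvE => sY sZ.
have := cc_metric hn (smooth_coord_vf_center p v) sY sZ.
by rewrite dirE /cov coord_vf_center.
Qed.

Lemma cov_phi p v i Y : smoothv p Y ->
  nabla p v (fun q => phi i q *m Y q) = phi i p *m nabla p v Y
  + beta *: (ev (eta (nx (nx i)) p) v *: (phi (nx i) p *m Y p)
             - ev (eta (nx i) p) v *: (phi (nx (nx i)) p *m Y p)).
Proof.
rewrite -smoothvE => sY.
have := cc_phi hn (even3_nx i) (smooth_coord_vf_center p v) sY.
by rewrite /cov_endo /cov coord_vf_center => <-; rewrite addrC subrK.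
Qed.

(** As [phi i] annihilates [xi i], its derivative prescribes
    [phi i (nabla xi_i)]; the remaining component along [xi i] vanishes because
    [xi i] has constant length. *)
Lemma cov_xi p v i : nabla p v (xi i)
  = beta *: (ev (eta (nx (nx i)) p) v *: xi (nx i) p
             - ev (eta (nx i) p) v *: xi (nx (nx i)) p).
Proof.
have sx := smooth_xi p i.
have ex : ev (eta i p) (nabla p v (xi i)) = 0.
  have := metric_cov v sx sx.
  rewrite (@eq_ddir _ _ _ _ _ _ (fun=> 1)); last first.
    by apply: nearW => q; rewrite g_xi eta_xi_same.
  by rewrite ddir_cst (ipC (xi i p) _ (gS p)) g_xi => e; lra.
have := cov_phi v i sx.
have -> : (fun q => phi i q *m xi i q) = (fun=> 0).
  by apply/funext => q; rewrite phi_xi_same.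
rewrite (conn0 hc).
have pn : phi (nx i) p *m xi i p = - xi (nx (nx i)) p.
  by have := phi_xi_prev (nx i) p; rewrite nx3.
have pp : phi (nx (nx i)) p *m xi i p = xi (nx i) p.
  by have := phi_xi_next (nx (nx i)) p; rewrite nx3.
rewrite pn pp => e.
have {}e : phi i p *m nabla p v (xi i)
    = beta *: (ev (eta (nx (nx i)) p) v *: xi (nx (nx i)) p
               + ev (eta (nx i) p) v *: xi (nx i) p).
  by move/eqP: e; rewrite eq_sym addr_eq0 => /eqP ->;
    rewrite scalerN -opprD scalerN opprK.
have := phi_sq i p (nabla p v (xi i)); rewrite ex scale0r addr0 e.
rewrite -scalemxAr mulmxDr -!scalemxAr phi_xi_next phi_xi_prev => /eqP.
rewrite -eqr_oppLR => /eqP <-; rewrite -scalerN opprD scalerN opprK.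
by [].
Qed.

(** A metric connection preserving the vertical distribution, as [cov_xi] shows
    for [nabla], also preserves its orthogonal complement. *)
Lemma eta_cov p v i Y : smoothv p Y -> (\forall q \near p, ev (eta i q) (Y q) = 0) ->
  ev (eta (nx i) p) (Y p) = 0 -> ev (eta (nx (nx i)) p) (Y p) = 0 ->
  ev (eta i p) (nabla p v Y) = 0.
Proof.
move=> sY Y0 Y1 Y2; have := metric_cov v sY (smooth_xi p i).
rewrite (@eq_ddir _ _ _ _ _ _ (fun=> 0)); last first.
  by apply: filterS Y0 => q; rewrite g_xi.
rewrite ddir_cst g_xi cov_xi ipZr ipDr ipNr !ipZr !g_xi Y1 Y2 !mulr0 subr0 mulr0.
by rewrite addr0.
Qed.

(** ** The curvature of the bundle spanned by the structure endomorphisms *)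

(** Up to the factor [2 * alpha * beta], the curvature forms of [nabla] on the
    bundle spanned by the [phi i]; see [Rm_phi]. *)
Definition om i p u v : R :=
  ip (g p) u (phi i p *m v) - wedge11 (eta (nx i) p) (eta (nx (nx i)) p) u v.

(** The connection forms of [nabla] on the bundle spanned by the [phi i] are the
    [beta * eta i]. Their curvature forms combine exterior derivatives and
    products, and the structure equation evaluates this combination. *)
Lemma om_deta i p X Y : smoothv p X -> smoothv p Y ->
  2 * alpha * om i p (X p) (Y p)
  = ddir p (X p) (fun q => ev (eta i q) (Y q))
    - ddir p (Y p) (fun q => ev (eta i q) (X q)) - ev (eta i p) (brk X Y p)
    + beta * wedge11 (eta (nx i) p) (eta (nx (nx i)) p) (X p) (Y p).
Proof. by move=> sX sY; rewrite eta_brk // /om /beta; ring. Qed.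

(** The commutator of curvature with [phi i] comes from differentiating [cov_phi]
    once more: exterior derivatives and products of the connection forms assemble
    into [om] by [om_deta]. *)
Lemma Rm_phi i p u v w :
  Rm nabla p u v (phi i p *m w) - phi i p *m Rm nabla p u v w
  = (2 * alpha * beta) *: (om (nx (nx i)) p u v *: (phi (nx i) p *m w)
                           - om (nx i) p u v *: (phi (nx (nx i)) p *m w)).
Proof.
have [X sX Xp] := smoothv_ext p u; have [Y sY Yp] := smoothv_ext p v.
have [Z sZ Zp] := smoothv_ext p w.
have sPZ := smooth_phi i sZ.
have -> : Rm nabla p u v (phi i p *m w) = crv nabla X Y (fun q => phi i q *m Z q) p.
  by rewrite (RmE hc sX sY sPZ) Xp Yp Zp.
have -> : Rm nabla p u v w = crv nabla X Y Z p.
  by rewrite (RmE hc sX sY sZ) Xp Yp Zp.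
rewrite !crvE.
have second A B : smoothv p A -> smoothv p B ->
    cov nabla A (cov nabla B (fun q => phi i q *m Z q)) p
    = phi i p *m cov nabla A (cov nabla B Z) p
      + beta *: (ev (eta (nx (nx i)) p) (A p) *: (phi (nx i) p *m cov nabla B Z p)
                 - ev (eta (nx i) p) (A p) *: (phi (nx (nx i)) p *m cov nabla B Z p))
      + beta *: (ddir p (A p) (fun q => ev (eta (nx (nx i)) q) (B q))
                   *: (phi (nx i) p *m Z p)
                 + ev (eta (nx (nx i)) p) (B p) *: (phi (nx i) p *m cov nabla A Z p
                    + beta *: (ev (eta i p) (A p) *: (phi (nx (nx i)) p *m Z p)
                               - ev (eta (nx (nx i)) p) (A p) *: (phi i p *m Z p)))
                 - (ddir p (A p) (fun q => ev (eta (nx i) q) (B q))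
                      *: (phi (nx (nx i)) p *m Z p)
                    + ev (eta (nx i) p) (B p)
                      *: (phi (nx (nx i)) p *m cov nabla A Z p
                          + beta *: (ev (eta (nx i) p) (A p) *: (phi i p *m Z p)
                             - ev (eta i p) (A p) *: (phi (nx i) p *m Z p))))).
  move=> sA sB; have sBZ := smooth_cov hc sB sZ.
  have sk := smooth_eta (nx (nx i)) sB; have sj := smooth_eta (nx i) sB.
  have s1 := smooth_phi i sBZ.
  have s2 := smoothvZ sk (smooth_phi (nx i) sZ).
  have s3 := smoothvZ sj (smooth_phi (nx (nx i)) sZ).
  have s3' := smoothvZ (smoothf_cst p (-1)) s3.
  have s23 := smoothvD s2 s3'.
  have sb := smoothvZ (smoothf_cst p beta) s23.
  have sC := smooth_cov hc sB sPZ.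
  rewrite /cov -/(cov nabla B _).
  rewrite (@conn_local_s _ _ _ _ hc p (A p) _ _ sC (_ : \forall q \near p,
    _ = phi i q *m cov nabla B Z q
        + beta *: (ev (eta (nx (nx i)) q) (B q) *: (phi (nx i) q *m Z q)
                   + -1 *: (ev (eta (nx i) q) (B q)
                            *: (phi (nx (nx i)) q *m Z q))))); last first.
    by apply: filterS (smoothv_near sZ) => q sq; rewrite scaleN1r; exact: cov_phi.
  rewrite (conn_add_s hc) // cov_phi // (connZ hc) // (conn_add_s hc) // (connZ hc) //.
  rewrite !(conn_leibniz_s hc) //; try exact: smooth_phi.
  by rewrite !cov_phi // !nx3 scaleN1r.
have third : cov nabla (brk X Y) (fun q => phi i q *m Z q) p
    = phi i p *m cov nabla (brk X Y) Z p
      + beta *: (ev (eta (nx (nx i)) p) (brk X Y p) *: (phi (nx i) p *m Z p)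
                 - ev (eta (nx i) p) (brk X Y p) *: (phi (nx (nx i)) p *m Z p)).
  exact: cov_phi.
rewrite (second _ _ sX sY) (second _ _ sY sX) third Zp !mulmxBr.
have ok := om_deta (nx (nx i)) sX sY; have oj := om_deta (nx i) sX sY.
rewrite !nx3 /wedge11 Xp Yp in ok oj.
move: ok oj; rewrite Xp Yp.
set ok := om (nx (nx i)) p u v; set oj := om (nx i) p u v.
set ek := ev (eta (nx (nx i)) p) (brk X Y p); set ej := ev (eta (nx i) p) (brk X Y p).
move=> okE ojE.
have -> : (2 * alpha * beta) *: (ok *: (phi (nx i) p *m w) - oj *: (phi (nx (nx i)) p *m w))
  = beta *: ((2 * alpha * ok) *: (phi (nx i) p *m w)
             - (2 * alpha * oj) *: (phi (nx (nx i)) p *m w)).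
  by apply/matrixP => r c; rewrite !mxE; ring.
rewrite okE ojE.
move: (ddir _ _ _) (ddir _ _ _) (ddir _ _ _) (ddir _ _ _) => d1 d2 d3 d4.
move: (phi i p *m cov _ _ _ _) (phi i p *m cov _ _ _ _) (phi i p *m cov _ _ _ _) => a1 a2 a3.
move: (phi i p *m w) (phi (nx i) p *m w) (phi (nx (nx i)) p *m w) => b1 b2 b3.
move: (phi (nx i) p *m _) (phi (nx i) p *m _) => c1 c2.
move: (phi (nx (nx i)) p *m _) (phi (nx (nx i)) p *m _) => c3 c4.
by apply/matrixP => r c; rewrite !mxE; ring.
Qed.

(** The same computation as for [Rm_phi], starting from [cov_xi]. *)
Lemma Rm_xi i p u v : Rm nabla p u v (xi i p)
  = (2 * alpha * beta) *: (om (nx (nx i)) p u v *: xi (nx i) p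
                           - om (nx i) p u v *: xi (nx (nx i)) p).
Proof.
have [X sX Xp] := smoothv_ext p u; have [Y sY Yp] := smoothv_ext p v.
have sx j := smooth_xi p j.
have -> : Rm nabla p u v (xi i p) = crv nabla X Y (xi i) p.
  by rewrite (RmE hc sX sY (sx i)) Xp Yp.
rewrite !crvE.
have second A B : smoothv p A -> smoothv p B ->
    cov nabla A (cov nabla B (xi i)) p
    = beta *: (ddir p (A p) (fun q => ev (eta (nx (nx i)) q) (B q)) *: xi (nx i) p
        + ev (eta (nx (nx i)) p) (B p)
          *: (beta *: (ev (eta i p) (A p) *: xi (nx (nx i)) p
                       - ev (eta (nx (nx i)) p) (A p) *: xi i p))
        - (ddir p (A p) (fun q => ev (eta (nx i) q) (B q)) *: xi (nx (nx i)) p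
           + ev (eta (nx i) p) (B p)
             *: (beta *: (ev (eta (nx i) p) (A p) *: xi i p
                          - ev (eta i p) (A p) *: xi (nx i) p)))).
  move=> sA sB.
  have sk := smooth_eta (nx (nx i)) sB; have sj := smooth_eta (nx i) sB.
  have s2 := smoothvZ sk (sx (nx i)); have s3 := smoothvZ sj (sx (nx (nx i))).
  have s3' := smoothvZ (smoothf_cst p (-1)) s3; have s23 := smoothvD s2 s3'.
  have sC := smooth_cov hc sB (sx i).
  have near_cov : \forall q \near p, cov nabla B (xi i) q
      = beta *: (ev (eta (nx (nx i)) q) (B q) *: xi (nx i) q
                 + -1 *: (ev (eta (nx i) q) (B q) *: xi (nx (nx i)) q)).
    by apply: nearW => q; rewrite scaleN1r; exact: cov_xi.
  rewrite [LHS](conn_local_s hc (A p) sC near_cov).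
  rewrite (connZ hc _ _ s23) (conn_add_s hc _ s2 s3') (connZ hc _ _ s3).
  rewrite (conn_leibniz_s hc _ sk (sx _)) (conn_leibniz_s hc _ sj (sx _)).
  by rewrite !cov_xi !nx3 scaleN1r.
have third : cov nabla (brk X Y) (xi i) p
    = beta *: (ev (eta (nx (nx i)) p) (brk X Y p) *: xi (nx i) p
               - ev (eta (nx i) p) (brk X Y p) *: xi (nx (nx i)) p).
  exact: cov_xi.
rewrite (second _ _ sX sY) (second _ _ sY sX) third.
have := om_deta (nx (nx i)) sX sY; have := om_deta (nx i) sX sY.
rewrite !nx3 /wedge11 Xp Yp => ojE okE.
set ok := om (nx (nx i)) p u v in okE *; set oj := om (nx i) p u v in ojE *.
have -> : (2 * alpha * beta) *: (ok *: xi (nx i) p - oj *: xi (nx (nx i)) p)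
  = beta *: ((2 * alpha * ok) *: xi (nx i) p - (2 * alpha * oj) *: xi (nx (nx i)) p).
  by apply/matrixP => r c; rewrite !mxE; ring.
rewrite okE ojE.
move: (ddir _ _ _) (ddir _ _ _) (ddir _ _ _) (ddir _ _ _) => d1 d2 d3 d4.
by apply/matrixP => r c; rewrite !mxE; ring.
Qed.

End Structure.

(** * Horizontal lifts along the canonical submersion *)

Lemma inj_unitmx (R : realType) n (A : 'M[R]_n) :
  (forall v : 'cV[R]_n, A *m v = 0 -> v = 0) -> A \in unitmx.
Proof.
move=> injA; rewrite -unitmx_tr unitmxE unitfE; apply/det0P => -[v v0 vA].
have /injA/eqP : A *m v^T = 0 by rewrite -[LHS]trmxK trmx_mul trmxK vA trmx0.
by rewrite -(inj_eq trmx_inj) trmxK trmx0 (negbTE v0).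
Qed.

Lemma brk0 (R : realType) m (M : manifold R m) (p : M) (Y : vfield M) :
  smoothv p Y -> brk (fun=> 0) Y p = 0.
Proof.
move=> sY; have s0 := smoothv0 p.
have e : \forall q \near p, 0 = 0 *: (fun=> 0 : 'cV[R]_m) q.
  by apply: nearW => q; rewrite scale0r.
have eY : \forall q \near p, Y q = Y q by exact: nearW.
rewrite (eq_brk e eY).
by rewrite (brkZl (smoothf_cst p 0) s0 sY) scale0r ddir_cst scale0r subrr.
Qed.

Section Submersion.
Variables (R : realType) (d : nat) (M : manifold R (d + 3)).
Variables (phi : 'I_3 -> M -> 'M[R]_(d + 3)) (xi : 'I_3 -> vfield M).
Variables (eta : 'I_3 -> M -> 'rV[R]_(d + 3)) (g : M -> 'M[R]_(d + 3)).
Variables (alpha delta : R).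
Hypothesis hS : sasaki3 phi xi eta g alpha delta.
Variable nabla : connection M.
Let beta := 2 * (delta - 2 * alpha).
Hypothesis hn : canonical_connection phi eta g beta nabla.
Let hc := cc_connection hn.
Variable sub : local_canonical_submersion d xi g nabla.
Let U := cs_dom sub.
Let N := cs_base sub.
Let f : M -> N := cs_proj sub.
Let lc := cs_lc sub.
Let gN := cs_metric sub.
Let oU : open U := @cs_dom_open _ _ _ _ _ _ _ sub.
Let sf : smooth_map_on U f := rs_smooth (cs_projP sub).
Implicit Types (p q : M) (i : 'I_3) (X Y Z : vfield N).
Implicit Types (x : 'cV[R]_d) (v w : 'cV[R]_(d + 3)).

Let J q := jacmx f q.

Lemma J_xi q i : U q -> J q *m xi i q = 0.
Proof.
move=> Uq; rewrite -(jacmxE oU sf) //; apply/(cs_fibers _ Uq).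
exists (fun j => (j == i)%:R); rewrite (bigD1 i) //= eqxx scale1r big1 ?addr0 //.
by move=> j /negbTE ->; rewrite scale0r.
Qed.

Lemma ev_sum q i (a : 'I_3 -> R) :
  ev (eta i q) (\sum_j a j *: xi j q) = a i.
Proof.
rewrite (sum3 _ i) !evD !evZ (eta_xi_same hS) (eta_xi_next hS) (eta_xi_prev hS).
by rewrite !mulr0 !addr0 mulr1.
Qed.

Lemma J_ker q v : U q -> J q *m v = 0 -> (forall i, ev (eta i q) v = 0) -> v = 0.
Proof.
move=> Uq; rewrite -(jacmxE oU sf) // => /(cs_fibers _ Uq)[a ->] ea.
by apply: big1 => i _; have := ea i; rewrite ev_sum => ->; rewrite scale0r.
Qed.

Let E q : 'M[R]_(3, d + 3) := \matrix_(i, j) eta i q 0 j.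

Lemma E_ev q v i : (E q *m v) i 0 = ev (eta i q) v.
Proof. by rewrite /ev !mxE; apply: eq_bigr => j _; rewrite mxE. Qed.

Let K q : 'M[R]_(d + 3) := col_mx (J q) (E q).

(** A vector killed by the differential of the submersion is vertical, and then
    determined by the [eta i]: together they form a coframe. *)
Lemma K_unit q : U q -> K q \in unitmx.
Proof.
move=> Uq; apply: inj_unitmx => v Kv.
have /eq_col_mx[Jv Ev] : col_mx (J q *m v) (E q *m v) = col_mx 0 0.
  by rewrite col_mx0 -mul_col_mx.
by apply: (J_ker Uq Jv) => i; rewrite -E_ev Ev mxE.
Qed.

(** The horizontal lift: the vector whose components in the coframe [K] are the
    given vector of the base and zero. *)
Definition lift_mx q : 'M[R]_(d + 3, d) := invmx (K q) *m col_mx 1%:M 0.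
Local Notation L := lift_mx.

Lemma KL q : U q -> J q *m L q = 1%:M /\ E q *m L q = 0.
Proof.
move=> Uq; apply: eq_col_mx; rewrite -mul_col_mx mulmxA mulmxV ?mul1mx //.
exact: K_unit.
Qed.

Lemma JL q x : U q -> J q *m (L q *m x) = x.
Proof. by move=> Uq; rewrite mulmxA (KL Uq).1 mul1mx. Qed.

Lemma eta_L q i x : U q -> ev (eta i q) (L q *m x) = 0.
Proof. by move=> Uq; rewrite -E_ev mulmxA (KL Uq).2 mul0mx mxE. Qed.

Lemma horizontalE q v : U q -> (forall i, ev (eta i q) v = 0) ->
  v = L q *m (J q *m v).
Proof.
move=> Uq ev0; apply/eqP; rewrite -subr_eq0; apply/eqP; apply: (J_ker Uq).
  by rewrite mulmxBr JL // subrr.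
by move=> i; rewrite evD evN eta_L // ev0 subrr.
Qed.

Lemma split_vec q v : U q ->
  v = L q *m (J q *m v) + \sum_i ev (eta i q) v *: xi i q.
Proof.
move=> Uq; set s := \sum_i _; rewrite -[v in LHS](subrK s); congr (_ + _).
have Js : J q *m s = 0.
  by rewrite mulmx_sumr big1 // => i _; rewrite -scalemxAr J_xi // scaler0.
rewrite [LHS](horizontalE Uq); first by rewrite (mulmxBr (J q)) Js subr0.
by move=> i; rewrite evD evN ev_sum subrr.
Qed.

Lemma eta_phi_horizontal q v : (forall i, ev (eta i q) v = 0) ->
  forall i l, ev (eta i q) (phi l q *m v) = 0.
Proof.
move=> ev0 i l.
have [->|[->|->]] : l = i \/ l = nx i \/ l = nx (nx i).
- by case: i l => [[|[|[|//]]] hi] [[|[|[|//]]] hl];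
    (try by left; exact/val_inj); (try by right; left; exact/val_inj);
    right; right; exact/val_inj.
- exact: (eta_phi_same hS).
- by rewrite (eta_phi_next hS).
- by rewrite (eta_phi_prev hS) ev0 oppr0.
Qed.

Lemma g_xi_L q i x : U q -> ip (g q) (L q *m x) (xi i q) = 0.
Proof. by move=> Uq; rewrite (g_xi hS) eta_L. Qed.

Lemma horizontal_L q x : U q -> horizontal g f q (L q *m x).
Proof.
move=> Uq w /(cs_fibers _ Uq)[a ->]; rewrite (sum3 _ 0) !ipDr !ipZr !g_xi_L //.
by rewrite !mulr0 !addr0.
Qed.

Lemma gL q x v : U q -> ip (g q) (L q *m x) v = ip (gN (f q)) x (J q *m v).
Proof.
move=> Uq; rewrite {1}(split_vec v Uq) ipDr (sum3 _ 0) !ipDr !ipZr !g_xi_L //.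
rewrite !mulr0 !addr0.
have hx := horizontal_L x Uq; have hv := horizontal_L (J q *m v) Uq.
have := rs_isometry (cs_projP sub) Uq hx hv.
by rewrite !(jacmxE oU sf) // -/(J q) !JL // => <-.
Qed.

Definition hlift (X : vfield N) : vfield M := fun q => L q *m X (f q).
Local Notation hl := hlift.

Lemma near_U p : U p -> \forall q \near p, U q.
Proof. by move=> Up; exact: open_nbhs_nbhs. Qed.

Lemma near_fv p X : U p -> smoothv (f p) X -> \forall q \near p, smoothv (f q) X.
Proof. by move=> Up sX; exact: (near_smooth_map sf Up (smoothv_near sX)). Qed.

(** Horizontal lifts are smooth: in the coframe made of the [eta i] and of the
    differentials of coordinates of the base, their components are. *)
Lemma smooth_hl p X : U p -> smoothv (f p) X -> smoothv p (hl X).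
Proof.
move=> Up sX; have db := chart_dom_mem (f p).
pose F j (q : M) : R := chart (f p) (f q) j 0.
pose T q : 'M[R]_(d, d + 3) := \matrix_(i, j) ddir q (delta_mx j 0) (F i).
have sF j q : U q -> chart_dom (f p) (f q) -> smoothf q (F j).
  by move=> Uq dq; exact: (smoothf_comp oU sf Uq (smoothf_chart j dq)).
have nd : \forall q \near p, U q /\ chart_dom (f p) (f q).
  have nc : nbhs (f p) (chart_dom (f p)).
    by apply: open_nbhs_nbhs; split; [exact: chart_dom_open|exact: db].
  exact: filterI (near_U Up) (near_smooth_map sf Up nc).
have TE q v (i : 'I_d) : U q -> chart_dom (f p) (f q) -> (T q *m v) i 0 = ddir q v (F i).
  move=> Uq dq; have sFi := sF i q Uq dq.
  have ds (s : seq 'I_(d + 3)) : ddir q (\sum_(k <- s) v k 0 *: delta_mx k 0) (F i)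
      = \sum_(k <- s) v k 0 * ddir q (delta_mx k 0) (F i).
    elim: s => [|k s ih]; first by rewrite !big_nil ddir0.
    by rewrite !big_cons (ddirDv _ _ sFi) (ddirZv _ _ sFi) ih.
  rewrite [in RHS](col_basis v) ds mxE; apply: eq_bigr => k _.
  by rewrite mxE mulrC.
pose theta q : 'M[R]_(d + 3) := col_mx (T q) (E q).
have smooth_theta (Y : vfield M) : (forall j, smoothf p (fun q => ddir q (Y q) (F j))) ->
    (forall i, smoothf p (fun q => ev (eta i q) (Y q))) ->
    smooth_at p (fun q => theta q *m Y q).
  move=> sT sE; apply/smooth_at_col => i; rewrite smoothfE.
  rewrite -(fintype.splitK i); case: (fintype.split i) => k /=.
    apply: eq_smoothf (sT k); apply: filterS nd => q [Uq dq].
    by rewrite mul_col_mx col_mxEu TE.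
  apply: eq_smoothf (sE k); apply: nearW => q.
  by rewrite mul_col_mx col_mxEd E_ev.
rewrite smoothv.unlock; apply: (@smooth_vf_coframe _ _ _ _ theta).
- apply: filterS nd => q [Uq dq]; apply: inj_unitmx => v Kv.
  have /eq_col_mx[Tv Ev] : col_mx (T q *m v) (E q *m v) = col_mx 0 0.
    by rewrite col_mx0 -mul_col_mx.
  apply: (J_ker Uq) => [|i]; last by rewrite -E_ev Ev mxE.
  rewrite (vf_coord (J q *m v) dq).
  suff -> : dir (f q) (J q *m v) (chart (f p)) = 0 by rewrite /coord_vf derive0.
  apply/matrixP => i j; rewrite ord1 [RHS]mxE (chart_ddir _ _ dq).
  rewrite -(jacmxE oU sf) // -(ddir_tmap oU sf _ Uq (smoothf_chart i dq)).
  by rewrite -[LHS]/(ddir q v (F i)) -TE // Tv mxE.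
- move=> Y sY; rewrite smoothvE in sY; apply: smooth_theta => [j|i].
    exact: smooth_ddir sY (sF j p Up db).
  exact: (smooth_eta hS).
- apply: smooth_theta => [j|i].
    have sj := smooth_ddir sX (smoothf_chart j db).
    apply: eq_smoothf (smoothf_comp oU sf Up sj); apply: filterS nd => q [Uq dq] /=.
    rewrite -(JL (X (f q)) Uq) -(jacmxE oU sf) //.
    by rewrite -(ddir_tmap oU sf _ Uq (smoothf_chart j dq)).
  apply: eq_smoothf (smoothf_cst p 0); apply: filterS (near_U Up) => q Uq.
  by rewrite eta_L.
Qed.

Lemma eta_hl_near p i X : U p -> \forall q \near p, ev (eta i q) (hl X q) = 0.
Proof. by move=> Up; apply: filterS (near_U Up) => q Uq; exact: eta_L. Qed.

Lemma eta_cov_hl p v i X : U p -> smoothv (f p) X ->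
  ev (eta i p) (nabla p v (hl X)) = 0.
Proof.
move=> Up sX; apply: (eta_cov hS hn); try exact: eta_L.
  exact: smooth_hl.
exact: eta_hl_near.
Qed.

(** The horizontal part is prescribed by the canonical submersion, and there is
    no vertical part since [nabla] preserves horizontality. *)
Lemma cov_hl p X Y : U p -> smoothv (f p) X -> smoothv (f p) Y ->
  nabla p (hl X p) (hl Y) = hl (cov lc X Y) p.
Proof.
move=> Up sX sY; rewrite [LHS](horizontalE Up); last first.
  by move=> i; exact: eta_cov_hl.
congr (_ *m _).
have [V oV [Vp sV]] := (smoothv_on (f p) X).1 sX.
have [V' oV' [Vp' sV']] := (smoothv_on (f p) Y).1 sY.
pose W := V `&` V'; have oW : open W by exact: openI.
have sXW : smooth_vf_on W X.
  by apply/(smooth_vf_onP _ oW) => q [Vq _]; exists V.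
have sYW : smooth_vf_on W Y.
  by apply/(smooth_vf_onP _ oW) => q [_ Vq]; exists V'.
have lift (Z : vfield N) : horizontal_lift U g f W Z (hl Z).
  move=> q Uq Wq; split; first exact: horizontal_L.
  by rewrite (jacmxE oU sf) //; exact: JL.
have Wp : W (f p) by split.
rewrite -(jacmxE oU sf) // (cs_nabla oW sXW sYW (lift X) (lift Y) Up Wp).
by [].
Qed.

Lemma near_J_hl p X : U p -> \forall q \near p, jacmx f q *m hl X q = X (f q).
Proof. by move=> Up; apply: filterS (near_U Up) => q Uq; exact: JL. Qed.

Lemma near_J_xi p i : U p ->
  \forall q \near p, jacmx f q *m xi i q = (fun=> 0 : 'cV[R]_d) (f q).
Proof. by move=> Up; apply: filterS (near_U Up) => q Uq; exact: J_xi. Qed.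

Lemma J_brk_hl p X Y : U p -> smoothv (f p) X -> smoothv (f p) Y ->
  J p *m brk (hl X) (hl Y) p = brk X Y (f p).
Proof.
move=> Up sX sY; apply: (brk_related oU sf Up) => //; try exact: smooth_hl.
  exact: near_J_hl.
exact: near_J_hl.
Qed.

Lemma J_brk_xi_hl p i X : U p -> smoothv (f p) X -> J p *m brk (xi i) (hl X) p = 0.
Proof.
move=> Up sX; rewrite -(brk0 sX).
apply: (brk_related oU sf Up (smooth_xi hS p i) (smooth_hl Up sX) (smoothv0 _) sX).
  exact: near_J_xi.
exact: near_J_hl.
Qed.

Lemma J_brk_xi p i j : U p -> J p *m brk (xi i) (xi j) p = 0.
Proof.
move=> Up; rewrite -(brk0 (smoothv0 (f p))).
by apply: (brk_related oU sf Up (smooth_xi hS p i) (smooth_xi hS p j)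
  (smoothv0 _) (smoothv0 _)); exact: near_J_xi.
Qed.

Lemma eta_brk_hl p i X Y : U p -> smoothv (f p) X -> smoothv (f p) Y ->
  ev (eta i p) (brk (hl X) (hl Y) p)
  = - (2 * alpha * ip (g p) (hl X p) (phi i p *m hl Y p)).
Proof.
move=> Up sX sY; rewrite (eta_brk hS _ (smooth_hl Up sX) (smooth_hl Up sY)).
rewrite (eq_ddir _ (eta_hl_near i Y Up)) (eq_ddir _ (eta_hl_near i X Up)) !ddir_cst.
by rewrite /wedge11 !eta_L // !mul0r; ring.
Qed.

(** Basic fields are transported along the fibres by [- 2 alpha phi]. By total
    skew-symmetry of the torsion, the derivative along [xi i] is read off from
    the vertical part of the bracket of two basic fields. *)
Lemma cov_xi_hl p i X : U p -> smoothv (f p) X ->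
  nabla p (xi i p) (hl X) = (- (2 * alpha)) *: (phi i p *m hl X p).
Proof.
move=> Up sX; apply: (g_inj hS (p := p)) => w.
have sx := smooth_xi hS p i; have sh := smooth_hl Up sX.
have hX j : ev (eta j p) (hl X p) = 0 by exact: eta_L.
rewrite (split_vec w Up) !ipDr; congr (_ + _); last first.
  rewrite (sum3 _ 0) !ipDr !ipZr !(g_xi hS) !eta_cov_hl // !evZ.
  by rewrite !eta_phi_horizontal // !mulr0.
have [Y sY <-] := smoothv_ext (f p) (J p *m w).
have sh' := smooth_hl Up sY.
rewrite -/(hl Y p).
have := cc_torsion hn; rewrite /skew_torsion => sk.
have := sk p (hl X) (xi i) (hl Y); rewrite !smoothvE /torsion /cov !lieE.
move=> /(_ sh sx sh').
have -> : nabla p (hl X p) (xi i) = 0.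
  by rewrite (cov_xi hS hn) !hX !scale0r subrr scaler0.
rewrite sub0r !ipDl !ipNl.
have -> : ip (g p) (brk (hl X) (xi i) p) (hl Y p) = 0.
  rewrite brkC ipNl (ipC _ _ (gS hS p)) gL // J_brk_xi_hl //.
  by rewrite /ip mulmx0 mxE oppr0.
rewrite !(g_xi hS) !eta_cov_hl // eta_brk_hl // ipZl (g_phi hS) => e.
by lra.
Qed.

(** [xi i] is related to the zero field of the base, so this bracket is vertical;
    the structure equation shows that its vertical components vanish. *)
Lemma brk_xi_hl p i X : U p -> smoothv (f p) X -> brk (hl X) (xi i) p = 0.
Proof.
move=> Up sX; have sx := smooth_xi hS p i; have sh := smooth_hl Up sX.
have hX j : ev (eta j p) (hl X p) = 0 by exact: eta_L.
apply: (J_ker Up); first by rewrite brkC mulmxN J_brk_xi_hl // oppr0.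
move=> j; rewrite (eta_brk hS _ sh sx) (eq_ddir _ (eta_hl_near j X Up)).
rewrite (@eq_ddir _ _ _ _ _ _ (fun=> (j == i)%:R)); last first.
  by apply: nearW => q; exact: (eta_xi hS).
rewrite !ddir_cst /wedge11 !hX !mul0r.
have -> : ip (g p) (hl X p) (phi j p *m xi i p) = 0.
  have := g_phi hS j p (hl X p) (xi i p); rewrite (g_xi hS) eta_phi_horizontal //.
  by move=> e; lra.
by rewrite mulr0; ring.
Qed.

Lemma brk_xi_xi p i : U p ->
  brk (xi (nx i)) (xi (nx (nx i))) p = (2 * delta) *: xi i p.
Proof.
move=> Up; have sx j := smooth_xi hS p j.
apply/eqP; rewrite -subr_eq0; apply/eqP; apply: (J_ker Up).
  by rewrite mulmxBr J_brk_xi // -scalemxAr J_xi // scaler0 subrr.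
move=> l; rewrite evD evN evZ (eta_brk hS _ (sx _) (sx _)).
have dc j k (v : 'cV[R]_(d + 3)) : ddir p v (fun q => ev (eta j q) (xi k q)) = 0.
  rewrite (@eq_ddir _ _ _ _ _ _ (fun=> (j == k)%:R)) ?ddir_cst //.
  by apply: nearW => q; exact: (eta_xi hS).
rewrite !dc; have nx_eq a : (nx a == a) = false by case: a => [[|[|[|//]]] ?].
have nx_eq' a : (a == nx a) = false by rewrite eq_sym.
have nx2_eq a : (nx (nx a) == a) = false by case: a => [[|[|[|//]]] ?].
have nx2_eq' a : (a == nx (nx a)) = false by rewrite eq_sym.
have xx a b : ip (g p) (xi a p) (xi b p) = (b == a)%:R.
  by rewrite (g_xi hS) (eta_xi hS).
have [->|[->|->]] : l = i \/ l = nx i \/ l = nx (nx i).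
- by case: i l => [[|[|[|//]]] hi] [[|[|[|//]]] hl];
    (try by left; exact/val_inj); (try by right; left; exact/val_inj);
    right; right; exact/val_inj.
- rewrite (phi_xi_prev hS) ipNr xx /wedge11 !(eta_xi hS) !eqxx.
  by rewrite !(nx_eq, nx_eq', nx2_eq, nx2_eq') /=; ring.
- rewrite (phi_xi_next hS) ?nx3 xx /wedge11 !(eta_xi hS) ?nx3 !eqxx.
  by rewrite !(nx_eq, nx_eq', nx2_eq, nx2_eq') /=; ring.
- rewrite (phi_xi_same hS) /wedge11 !(eta_xi hS) ?nx3 !eqxx.
  rewrite /ip mulmx0 mxE.
  by rewrite !(nx_eq, nx_eq', nx2_eq, nx2_eq') /=; ring.
Qed.

End Submersion.

(** * The curvature of the canonical connection *)

Section Curvature.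
Variables (R : realType) (d : nat) (M : manifold R (d + 3)).
Variables (phi : 'I_3 -> M -> 'M[R]_(d + 3)) (xi : 'I_3 -> vfield M).
Variables (eta : 'I_3 -> M -> 'rV[R]_(d + 3)) (g : M -> 'M[R]_(d + 3)).
Variables (alpha delta : R).
Hypothesis hS : sasaki3 phi xi eta g alpha delta.
Variable nabla : connection M.
Let beta := 2 * (delta - 2 * alpha).
Hypothesis hn : canonical_connection phi eta g beta nabla.
Let hc := cc_connection hn.
Variable sub : local_canonical_submersion d xi g nabla.
Let U := cs_dom sub.
Let N := cs_base sub.
Let f : M -> N := cs_proj sub.
Let lc := cs_lc sub.
Let gN := cs_metric sub.
Let oU : open U := @cs_dom_open _ _ _ _ _ _ _ sub.
Let sf : smooth_map_on U f := rs_smooth (cs_projP sub).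
Let hlc := lc_connection (cs_lcP sub).
Implicit Types (p q : M) (i : 'I_3) (X Y Z : vfield N).
Implicit Types (x y z : 'cV[R]_d) (u v w : 'cV[R]_(d + 3)).

Let J q := jacmx f q.
Local Notation L := (lift_mx eta sub).
Local Notation hl := (hlift eta (sub := sub)).

Lemma cov_cov_hl p X Y Z : U p -> smoothv (f p) X -> smoothv (f p) Y ->
    smoothv (f p) Z ->
  cov nabla (hl X) (cov nabla (hl Y) (hl Z)) p = hl (cov lc X (cov lc Y Z)) p.
Proof.
move=> Up sX sY sZ.
have sYZ := smooth_cov hlc sY sZ.
have sC := smooth_cov hc (smooth_hl hS Up sY) (smooth_hl hS Up sZ).
have e : \forall q \near p, cov nabla (hl Y) (hl Z) q = hl (cov lc Y Z) q.
  apply: filterS3 (near_U (sub := sub) Up) (near_fv Up sY) (near_fv Up sZ) => q Uq sYq sZq.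
  exact: (cov_hl hS hn).
by rewrite [LHS](conn_local_s hc _ sC e) (cov_hl hS hn).
Qed.

(** The bracket of two basic fields is the lift of the bracket on the base plus a
    vertical field with components [- 2 alpha Phi i], along which basic fields are
    differentiated by [cov_xi_hl]. The derivatives themselves lift. *)
Lemma Rm_horizontal p x y z : U p ->
  Rm nabla p (L p *m x) (L p *m y) (L p *m z)
  = L p *m Rm lc (f p) x y z
    - (4 * alpha ^+ 2) *: \sum_i ip (g p) (L p *m x) (phi i p *m (L p *m y))
                                  *: (phi i p *m (L p *m z)).
Proof.
move=> Up; have [X sX <-] := smoothv_ext (f p) x.
have [Y sY <-] := smoothv_ext (f p) y; have [Z sZ <-] := smoothv_ext (f p) z.
have shX := smooth_hl hS Up sX; have shY := smooth_hl hS Up sY.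
have shZ := smooth_hl hS Up sZ.
rewrite -(RmE hlc sX sY sZ) -!/(hl _ p) -(RmE hc shX shY shZ) !crvE.
rewrite !cov_cov_hl //.
have -> : cov nabla (brk (hl X) (hl Y)) (hl Z) p
    = hl (cov lc (brk X Y) Z) p
      + (4 * alpha ^+ 2) *: \sum_i ip (g p) (hl X p) (phi i p *m hl Y p)
                                   *: (phi i p *m hl Z p).
  rewrite {1}/cov (split_vec hS (brk (hl X) (hl Y) p) Up).
  rewrite (conn_dirD hc _ _ shZ) (conn_dir_sum hc _ _ shZ); congr (_ + _).
    rewrite (J_brk_hl hS Up sX sY) -(cov_hl hS hn Up (smooth_brk sX sY) sZ).
    by [].
  rewrite scaler_sumr; apply: eq_bigr => i _.
  rewrite (conn_dirZ hc _ _ shZ) (cov_xi_hl hS hn _ Up sZ) (eta_brk_hl hS _ Up sX sY).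
  by rewrite !scalerA; congr (_ *: _); ring.
rewrite opprD addrA; congr (_ - _).
by rewrite /hlift crvE !mulmxBr.
Qed.

(** [xi i] commutes with basic fields, and [phi i], by which it differentiates
    them, is parallel in horizontal directions. *)
Lemma Rm_mixed p i x z : U p -> Rm nabla p (L p *m x) (xi i p) (L p *m z) = 0.
Proof.
move=> Up; have [X sX <-] := smoothv_ext (f p) x.
have [Z sZ <-] := smoothv_ext (f p) z.
have shX := smooth_hl hS Up sX; have shZ := smooth_hl hS Up sZ.
have sx := smooth_xi hS p i; have sph := smooth_phi hS i shZ.
rewrite -!/(hl _ p) -(RmE hc shX sx shZ) crvE.
have -> : cov nabla (brk (hl X) (xi i)) (hl Z) p = 0.
  by rewrite /cov (brk_xi_hl hS _ Up sX) (conn_dir0 hc shZ).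
have -> : cov nabla (hl X) (cov nabla (xi i) (hl Z)) p
    = (- (2 * alpha)) *: (phi i p *m nabla p (hl X p) (hl Z)).
  have e : \forall q \near p,
      cov nabla (xi i) (hl Z) q = (- (2 * alpha)) *: (phi i q *m hl Z q).
    apply: filterS2 (near_U (sub := sub) Up) (near_fv Up sZ) => q Uq sZq.
    exact: (cov_xi_hl hS hn).
  rewrite [LHS](conn_local_s hc _ (smooth_cov hc sx shZ) e) (connZ hc _ _ sph).
  rewrite (cov_phi hn _ _ shZ) !(eta_L hS) // !scale0r subrr scaler0 addr0.
  by [].
have -> : cov nabla (xi i) (cov nabla (hl X) (hl Z)) p
    = (- (2 * alpha)) *: (phi i p *m nabla p (hl X p) (hl Z)).
  have e : \forall q \near p, cov nabla (hl X) (hl Z) q = hl (cov lc X Z) q.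
    apply: filterS3 (near_U (sub := sub) Up) (near_fv Up sX) (near_fv Up sZ) => q Uq sXq sZq.
    exact: (cov_hl hS hn).
  rewrite [LHS](conn_local_s hc _ (smooth_cov hc shX shZ) e).
  by rewrite (cov_xi_hl hS hn _ Up (smooth_cov hlc sX sZ)) (cov_hl hS hn).
by rewrite subrr subr0.
Qed.

(** The products of two structure endomorphisms and the bracket of the [xi]
    contribute [- 8 alpha^2 + 4 alpha delta], which is [2 alpha beta]; the
    derivatives of the structure contribute [- 4 alpha beta]. *)
Lemma Rm_vertical p i z : U p ->
  Rm nabla p (xi (nx i) p) (xi (nx (nx i)) p) (L p *m z)
  = (- (2 * alpha * beta)) *: (phi i p *m (L p *m z)).
Proof.
move=> Up; have [Z sZ <-] := smoothv_ext (f p) z.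
have shZ := smooth_hl hS Up sZ.
have sx j := smooth_xi hS p j; have sph j := smooth_phi hS j shZ.
rewrite -!/(hl _ p) -(RmE hc (sx _) (sx _) shZ) crvE.
have vert j : \forall q \near p,
    cov nabla (xi j) (hl Z) q = (- (2 * alpha)) *: (phi j q *m hl Z q).
  apply: filterS2 (near_U (sub := sub) Up) (near_fv Up sZ) => q Uq sZq.
  exact: (cov_xi_hl hS hn).
have second j k : cov nabla (xi j) (cov nabla (xi k) (hl Z)) p
    = (- (2 * alpha)) *: ((- (2 * alpha)) *: (phi k p *m (phi j p *m hl Z p))
      + beta *: (ev (eta (nx (nx k)) p) (xi j p) *: (phi (nx k) p *m hl Z p)
                 - ev (eta (nx k) p) (xi j p) *: (phi (nx (nx k)) p *m hl Z p))).
  rewrite [LHS](conn_local_s hc _ (smooth_cov hc (sx k) shZ) (vert k)).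
  rewrite (connZ hc _ _ (sph k)) (cov_phi hn _ _ shZ) (cov_xi_hl hS hn _ Up sZ).
  by rewrite -scalemxAr.
rewrite !second.
have -> : cov nabla (brk (xi (nx i)) (xi (nx (nx i)))) (hl Z) p
    = (2 * delta) *: ((- (2 * alpha)) *: (phi i p *m hl Z p)).
  rewrite /cov (brk_xi_xi hS _ Up) (conn_dirZ hc _ _ shZ).
  by rewrite (cov_xi_hl hS hn _ Up sZ).
have hZ j : ev (eta j p) (hl Z p) = 0 by exact: (eta_L hS).
have := phi_phi_next hS (nx i) p (hl Z p); have := phi_next_phi hS (nx i) p (hl Z p).
rewrite !nx3 !hZ !scale0r !addr0 => -> ->.
have := eta_xi_next hS (nx i) p; have := eta_xi_prev hS (nx i) p.
have := eta_xi_next hS (nx (nx i)) p; have := eta_xi_prev hS (nx (nx i)) p.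
have := eta_xi_next hS i p; have := eta_xi_prev hS i p.
have := eta_xi_same hS (nx i) p; have := eta_xi_same hS (nx (nx i)) p.
rewrite !nx3 => -> -> -> -> _ _ _ _.
by apply/matrixP => r c; rewrite !mxE /beta; ring.
Qed.

(** ** The structure on the base *)

(** The endomorphism of the tangent space of the base induced by [phi i]; it
    depends on the point [p] of the fibre. *)
Definition phiN i p : 'M[R]_d := J p *m phi i p *m L p.

Lemma phiNE i p x : phiN i p *m x = J p *m (phi i p *m (L p *m x)).
Proof. by rewrite /phiN -(mulmxA _ (L p) x) -(mulmxA (J p) (phi i p)). Qed.

Lemma phi_L p i x : U p -> L p *m (phiN i p *m x) = phi i p *m (L p *m x).
Proof.
move=> Up; rewrite phiNE [RHS](horizontalE hS Up) // => l.
by apply: (eta_phi_horizontal hS) => k; exact: (eta_L hS).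
Qed.

Lemma phiN_J p i v : U p -> phiN i p *m (J p *m v) = J p *m (phi i p *m v).
Proof.
move=> Up; rewrite phiNE [v in RHS](split_vec hS v Up) !mulmxDr.
rewrite -[LHS]addr0; congr (_ + _).
rewrite mulmx_sumr (sum3 _ i) -!scalemxAr.
rewrite (phi_xi_same hS) (phi_xi_next hS) (phi_xi_prev hS) scaler0 add0r.
by rewrite mulmxDr -!scalemxAr mulmxN !(J_xi _ Up) oppr0 !scaler0 addr0.
Qed.

Lemma phiN_ip p i x y : U p ->
  ip (gN (f p)) x (phiN i p *m y) = ip (g p) (L p *m x) (phi i p *m (L p *m y)).
Proof. by move=> Up; rewrite (gL hS) // -phiN_J // (JL hS). Qed.

Lemma phiN_sq p i : U p -> phiN i p *m phiN i p = - 1%:M.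
Proof.
move=> Up; apply: eq_mulmx_col => x; rewrite -mulmxA mulNmx mul1mx.
rewrite -(JL hS (phiN i p *m (phiN i p *m x)) Up) !phi_L // (phi_sq hS).
by rewrite (eta_L hS) // scale0r addr0 mulmxN (JL hS).
Qed.

Lemma phiN_next p i : U p -> phiN i p *m phiN (nx i) p = phiN (nx (nx i)) p.
Proof.
move=> Up; apply: eq_mulmx_col => x; rewrite -mulmxA.
rewrite -(JL hS (phiN i p *m (phiN (nx i) p *m x)) Up) !phi_L // (phi_phi_next hS).
by rewrite (eta_L hS) // scale0r addr0 -phi_L // (JL hS).
Qed.

Lemma phiN_prev p i : U p -> phiN (nx i) p *m phiN i p = - phiN (nx (nx i)) p.
Proof.
move=> Up; apply: eq_mulmx_col => x; rewrite -mulmxA mulNmx.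
rewrite -(JL hS (phiN (nx i) p *m (phiN i p *m x)) Up) !phi_L // (phi_next_phi hS).
by rewrite (eta_L hS) // scale0r addr0 mulmxN -phi_L // (JL hS).
Qed.

Let metN := cs_metricP sub.
Lemma gNS b : (gN b)^T = gN b. Proof. exact: (Defs.metric_sym metN). Qed.
Lemma gN_pos b x : x != 0 -> 0 < ip (gN b) x x. Proof. exact: (Defs.metric_pos metN). Qed.
Lemma gN_unit b : gN b \in unitmx. Proof. by apply: pos_unit => x; exact: gN_pos. Qed.

Lemma phiN_skew p i : U p -> (phiN i p)^T *m gN (f p) = - (gN (f p) *m phiN i p).
Proof.
move=> Up; apply: skew_endoP; first exact: gNS.
move=> x y; rewrite (ipC _ _ (gNS _)) !phiN_ip // (ipC _ _ (gS hS p)).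
exact: (g_phi hS).
Qed.

Lemma g_phi_split p i u v : U p ->
  ip (g p) u (phi i p *m v)
  = ip (gN (f p)) (J p *m u) (phiN i p *m (J p *m v))
    - wedge11 (eta (nx i) p) (eta (nx (nx i)) p) u v.
Proof.
move=> Up; rewrite [in LHS](split_vec hS u Up) ipDl (gL hS) // -phiN_J //.
congr (_ + _); rewrite (sum3 _ i) !ipDl !ipZl.
rewrite !(ipC (xi _ p) _ (gS hS p)) !(g_xi hS) (eta_phi_same hS).
have := eta_phi_next hS (nx (nx i)) p v; have := eta_phi_prev hS (nx i) p v.
by rewrite !nx3 => -> ->; rewrite /wedge11; ring.
Qed.

Lemma om_split p i u v : U p ->
  om phi eta g i p u v
  = ip (gN (f p)) (J p *m u) (phiN i p *m (J p *m v))
    - 2 * wedge11 (eta (nx i) p) (eta (nx (nx i)) p) u v.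
Proof. by move=> Up; rewrite /om g_phi_split //; ring. Qed.

Lemma Rm_same p u w : Rm nabla p u u w = 0.
Proof.
have := RmC hc p u u w => /eqP; rewrite -subr_eq0 opprK -mulr2n.
by rewrite -scaler_nat scaler_eq0 pnatr_eq0 => /eqP.
Qed.

(** The identity [alpha beta = 2 alpha delta - 4 alpha^2] lets a single multiple
    of [om] account for the horizontal correction of [Rm_horizontal] and for the
    vertical curvature of [Rm_vertical], up to a term coming from the base. *)
Lemma Rm_lift p u v z : U p ->
  Rm nabla p u v (L p *m z)
  = L p *m Rm lc (f p) (J p *m u) (J p *m v) z
    + (alpha * beta) *: \sum_i om phi eta g i p u v *: (phi i p *m (L p *m z))
    - (2 * alpha * delta) *: \sum_i
        ip (gN (f p)) (J p *m u) (phiN i p *m (J p *m v))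
        *: (phi i p *m (L p *m z)).
Proof.
move=> Up; have Rl := Rm_linearl hc p; have Rr := Rm_linear_mid hc p.
have RDl a b c e : Rm nabla p (a + b) c e = Rm nabla p a c e + Rm nabla p b c e.
  by rewrite -[a]scale1r Rl !scale1r.
have RDr a b c e : Rm nabla p a (b + c) e = Rm nabla p a b e + Rm nabla p a c e.
  by rewrite -[b]scale1r Rr !scale1r.
have R0l a b : Rm nabla p 0 a b = 0.
  by have := RDl 0 0 a b; rewrite addr0 => /eqP; rewrite -subr_eq0 opprD addNKr oppr_eq0 => /eqP.
have R0r a b : Rm nabla p a 0 b = 0 by rewrite (RmC hc) R0l oppr0.
have RZl s a b c : Rm nabla p (s *: a) b c = s *: Rm nabla p a b c.
  by rewrite -[s *: a]addr0 Rl R0l addr0.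
have RZr s a b c : Rm nabla p a (s *: b) c = s *: Rm nabla p a b c.
  by rewrite -[s *: b]addr0 Rr R0r addr0.
rewrite {1}(split_vec hS u Up) {1}(split_vec hS v Up) !(sum3 _ 0).
rewrite !(RDl, RDr, RZl, RZr) !Rm_same.
have mix i x : Rm nabla p (xi i p) (L p *m x) (L p *m z) = 0.
  by rewrite (RmC hc) Rm_mixed // oppr0.
rewrite !Rm_mixed // !mix !scaler0 !addr0 !add0r.
have v0 := Rm_vertical 0 z Up; have v1 := Rm_vertical (nx 0) z Up.
have v2 := Rm_vertical (nx (nx 0)) z Up; rewrite !nx3 in v1 v2.
rewrite v0 v1 v2.
rewrite (RmC hc p (xi (nx 0) p) (xi 0 p)) (RmC hc p (xi (nx (nx 0)) p) (xi (nx 0) p)).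
rewrite (RmC hc p (xi 0 p) (xi (nx (nx 0)) p)) v0 v1 v2.
rewrite Rm_horizontal // (sum3 _ 0) -!phiN_ip // !om_split // !nx3 /wedge11.
move: (L p *m Rm _ _ _ _ _) => a0.
move: (phi 0 p *m _) (phi (nx 0) p *m _) (phi (nx (nx 0)) p *m _) => a1 a2 a3.
by apply/matrixP => r c; rewrite !mxE /beta; ring.
Qed.

End Curvature.

(** * The curvature operator *)

Section Operator.
Variables (R : realType) (n d : nat) (M : manifold R (d + 3)).
Hypotheses (n_gt0 : (0 < n)%N) (dn : d = (4 * n)%N).
Variables (phi : 'I_3 -> M -> 'M[R]_(d + 3)) (xi : 'I_3 -> vfield M).
Variables (eta : 'I_3 -> M -> 'rV[R]_(d + 3)) (g : M -> 'M[R]_(d + 3)).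
Variables (alpha delta : R).
Hypothesis hS : sasaki3 phi xi eta g alpha delta.
Variable nabla : connection M.
Let beta := 2 * (delta - 2 * alpha).
Hypothesis hn : canonical_connection phi eta g beta nabla.
Let hc := cc_connection hn.
Variable sub : local_canonical_submersion d xi g nabla.
Let U := cs_dom sub.
Let f : M -> cs_base sub := cs_proj sub.
Let lc := cs_lc sub.
Let gN := cs_metric sub.
Let hlc := lc_connection (cs_lcP sub).
Variable p : M.
Hypothesis Up : U p.
Variable AN : {linear 'M[R]_d -> 'M[R]_d}.
Hypothesis coN : is_curvature_operator gN lc (f p) AN.
Implicit Types (i : 'I_3) (x y z : 'cV[R]_d) (u v : 'cV[R]_(d + 3)).
Implicit Types (w t : 'M[R]_(d + 3)).

Let J := jacmx f p.
Let L := lift_mx eta sub p.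
Let G := g p.
Let H := gN (f p).
Let ph i := phiN phi eta sub i p.
Let sG : G^T = G := gS hS p.
Let uG : G \in unitmx := g_unit hS p.
Let sH : H^T = H := gNS (f p).
Let uH : H \in unitmx := gN_unit (f p).

Lemma coN_endo x y z : AN (wedge_vec x y) *m H *m z = Rm lc (f p) x y z.
Proof.
apply: (ip_inj (G := H)) => [t t0|t]; first exact: gN_pos.
have sw := co_bivector coN (skew_wedge x y).
have := bip_wedge_endo z t sH sw.
have [X sX Xp] := smoothv_ext (f p) x; have [Y sY Yp] := smoothv_ext (f p) y.
have [Z sZ Zp] := smoothv_ext (f p) z; have [T sT Tp] := smoothv_ext (f p) t.
have := co_curv coN (X := X) (Y := Y) (Z := Z) (V := T).
rewrite !smoothvE => /(_ sX sY sZ sT).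
have -> : curv lc X Y Z (f p) = crv lc X Y Z (f p) by rewrite crv.unlock.
by rewrite (RmE hlc sX sY sZ) Xp Yp Zp Tp => -> /oppr_inj.
Qed.

Lemma kval_wedge i x y : kval H ph i (wedge_vec x y) = ip H x (ph i *m y).
Proof. by rewrite /kval /kform bip_dual //; exact: (phiN_skew hS). Qed.

Lemma Rm_base x y z : Rm lc (f p) x y z
  = J *m Rm nabla p (L *m x) (L *m y) (L *m z)
    + (4 * alpha ^+ 2) *: \sum_i ip H x (ph i *m y) *: (ph i *m z).
Proof.
rewrite (Rm_horizontal hS hn _ _ _ Up) mulmxBr /J (JL hS) //.
rewrite -scalemxAr mulmx_sumr; set s := \sum_i _; set t := \sum_i _.
suff -> : s = t by rewrite subrK.
apply: eq_bigr => i _; rewrite -scalemxAr -(phiN_ip hS) //.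
by rewrite -(phi_L hS) // (JL hS).
Qed.

(** The commutators of the curvature of the base with the local quaternionic
    structure, obtained by comparison with those of the canonical connection. *)
Lemma commN i B : skew B ->
  (AN B *m H) *m ph i - ph i *m (AN B *m H)
  = (4 * (alpha * delta)) *: (kval H ph (nx (nx i)) B *: ph (nx i)
                              - kval H ph (nx i) B *: ph (nx (nx i))).
Proof.
move: B; apply: skew_ind => [A B eA eB|c A eA|x y].
- rewrite /kval linearD /= !bipDr !(mulmxDl, mulmxDr) opprD addrACA.
  by rewrite eA eB -scalerDr !scalerDl opprD addrACA.
- rewrite /kval linearZ /= !bipZr -!scalemxAl -scalemxAr -scalerBr eA.
  rewrite /kval; move: (bip _ _ _) (bip _ _ _) (ph (nx i)) (ph (nx (nx i))).
  by move=> a b P Q; apply/matrixP => r s; rewrite !mxE; ring.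
rewrite !kval_wedge; apply: eq_mulmx_col => z.
rewrite mulmxBl -(mulmxA _ (ph i)) -(mulmxA (ph i)) !coN_endo !Rm_base.
set Pi := fun l => ip H x (ph l *m y).
rewrite /L -/L (_ : L *m (ph i *m z) = phi i p *m (L *m z)); last exact: (phi_L hS).
have := Rm_phi hS hn i p (L *m x) (L *m y) (L *m z).
move/eqP; rewrite subr_eq => /eqP ->.
rewrite !(om_split hS _ _ _ Up) /wedge11 !(eta_L hS) //.
rewrite !mulmxDr -/J !(JL hS) // -!scalemxAr mulmxBr -!scalemxAr -!(phiN_J hS) //.
rewrite -/J !(JL hS) //.
rewrite !(sum3 _ i) !mulmxDr -!scalemxAr !(mulmxA (ph _) (ph _)).
have p1 := phiN_sq hS i Up; have p2 := phiN_next hS i Up; have p3 := phiN_prev hS i Up.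
have p4 := phiN_next hS (nx (nx i)) Up; have p5 := phiN_prev hS (nx (nx i)) Up.
rewrite !nx3 in p4 p5.
rewrite /ph p1 p2 p3 p4 p5 -/(ph _).
rewrite -scalemxAl mulmxBl -!scalemxAl !mulNmx mul1mx.
move: (ph i *m (J *m _)) (ph i *m z) (ph (nx i) *m z) (ph (nx (nx i)) *m z) => a0 a1 a2 a3.
by apply/matrixP => r c; rewrite !mxE /beta; ring.
Qed.

(** The skew endomorphism [chi k] represents [om k]. It is [phi k] on horizontal
    vectors, and twice the infinitesimal rotation about [xi k] on vertical ones. *)
Let chi k : 'M[R]_(d + 3) := phi k p - xi (nx k) p *m eta (nx (nx k)) p
  + xi (nx (nx k)) p *m eta (nx k) p.
Let chif k : 'M[R]_(d + 3) := chi k *m invmx G.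

Lemma chiE k u : chi k *m u = phi k p *m u
  - ev (eta (nx (nx k)) p) u *: xi (nx k) p + ev (eta (nx k) p) u *: xi (nx (nx k)) p.
Proof. by rewrite /chi mulmxDl mulmxBl !outer_ev. Qed.

Lemma chi_skew k : (chi k)^T *m G = - (G *m chi k).
Proof.
apply: skew_endoP => // u v.
rewrite !chiE !(ipDl, ipDr, ipNl, ipNr, ipZl, ipZr) (g_phi hS).
by rewrite !(ipC (xi _ p) _ sG) !(g_xi hS); ring.
Qed.

Lemma chif_wedge k u v : bip G (chif k) (wedge_vec u v) = om phi eta g k p u v.
Proof.
rewrite /chif bip_dual //; last exact: chi_skew.
by rewrite chiE !(ipDr, ipNr, ipZr) !(g_xi hS) /om /wedge11; ring.
Qed.

Lemma skew_chif k : skew (chif k).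
Proof. by apply: skew_dual => //; exact: chi_skew. Qed.

Let push (w : 'M[R]_(d + 3)) : 'M[R]_d := J *m w *m J^T.
(** [AN] made to vanish on its eigenspace spanned by the [kform]: the eigenvalue
    [4 * n * (alpha * delta)] is cancelled as [kform] has squared length [2 * n]. *)
Let ANred (B : 'M[R]_d) : 'M[R]_d :=
  AN B - (2 * (alpha * delta)) *: \sum_i kval H ph i B *: kform H ph i.

Lemma skew_push w : skew w -> skew (push w).
Proof. exact: skew_conj. Qed.

Lemma push_wedge u v : push (wedge_vec u v) = wedge_vec (J *m u) (J *m v).
Proof. by rewrite /push /wedge_vec mulmxBr mulmxBl !trmx_mul !mulmxA. Qed.

Lemma skew_ANred B : skew B -> skew (ANred B).
Proof.
move=> sB; apply: skewD; first exact: (co_bivector coN).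
rewrite -scaleNr; apply: skewZ; apply: skew_sum => i; apply: skewZ.
by apply: skew_kform => // j; exact: (phiN_skew hS).
Qed.

(** [Rm_lift] and [Rm_xi] reassembled into an operator on bivectors. *)
Definition curv_op_fun (w : 'M[R]_(d + 3)) : 'M[R]_(d + 3) :=
  (alpha * beta) *: (\sum_i bip G (chif i) w *: chif i)
  + L *m ANred (push w) *m L^T.

Lemma bip_sum_linear m (B : 'M[R]_m) (F : 'I_3 -> 'M[R]_m) c (S T : 'M[R]_m) :
  \sum_i bip B (F i) (c *: S + T) *: F i
  = c *: (\sum_i bip B (F i) S *: F i) + \sum_i bip B (F i) T *: F i.
Proof.
rewrite scaler_sumr -big_split; apply: eq_bigr => i _ /=.
by rewrite bipDr bipZr scalerDl scalerA.
Qed.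

Lemma curv_op_linear : linear curv_op_fun.
Proof.
move=> c w t; rewrite /curv_op_fun.
have -> : push (c *: w + t) = c *: push w + push t.
  by rewrite /push mulmxDr mulmxDl -scalemxAr -scalemxAl.
have -> : ANred (c *: push w + push t) = c *: ANred (push w) + ANred (push t).
  rewrite /ANred linearP /kval bip_sum_linear.
  move: (AN _) (AN _) (\sum_i _) (\sum_i _) => a1 a2 s1 s2.
  by apply/matrixP => r s; rewrite !mxE; ring.
rewrite mulmxDr mulmxDl -scalemxAr -scalemxAl bip_sum_linear.
move: (L *m _ *m _) (L *m _ *m _) (\sum_i _) (\sum_i _) => a1 a2 s1 s2.
by apply/matrixP => r s; rewrite !mxE; ring.
Qed.

HB.instance Definition _ := GRing.isLinear.Build R _ _ _ curv_op_fun curv_op_linear.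

Lemma LG u : L^T *m G *m u = H *m (J *m u).
Proof.
apply/matrixP => i j; rewrite ord1 {j}.
have := gL hS (delta_mx i 0) u Up; rewrite /ip trmx_mul -/G -/L -/H -/J.
rewrite -!mulmxA trmx_delta -!rowE.
by rewrite [LHS]mxE [RHS]mxE.
Qed.

Lemma bip_lift B w : bip G (L *m B *m L^T) w = bip H B (push w).
Proof.
apply: bip_adjoint => //.
by apply: eq_mulmx_col => u; rewrite LG mulmxA.
Qed.

Lemma chif_endo k u : chif k *m G *m u = chi k *m u.
Proof. by rewrite /chif mulmxKV. Qed.

Lemma kform_endo k z : kform H ph k *m H *m z = ph k *m z.
Proof. by rewrite /kform mulmxKV. Qed.

Lemma ANred_endo x y z : ANred (wedge_vec x y) *m H *m z = Rm lc (f p) x y z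
  - (2 * (alpha * delta)) *: \sum_i ip H x (ph i *m y) *: (ph i *m z).
Proof.
rewrite /ANred !mulmxBl coN_endo; congr (_ - _).
rewrite -!scalemxAl !mulmx_suml; congr (_ *: _); apply: eq_bigr => i _.
by rewrite -!scalemxAl kform_endo kval_wedge.
Qed.

(** The vector [w] is split into its horizontal part, for which this is
    [Rm_lift], and its vertical part, for which it is [Rm_xi]. *)
Lemma curv_op_endo u v (w : 'cV[R]_(d + 3)) :
  curv_op_fun (wedge_vec u v) *m G *m w = Rm nabla p u v w.
Proof.
have E : curv_op_fun (wedge_vec u v) *m G *m w
    = (alpha * beta) *: \sum_i om phi eta g i p u v *: (chi i *m w)
      + L *m (Rm lc (f p) (J *m u) (J *m v) (J *m w)
        - (2 * (alpha * delta)) *: \sum_i ip H (J *m u) (ph i *m (J *m v))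
                                          *: (ph i *m (J *m w))).
  rewrite /curv_op_fun !mulmxDl -!scalemxAl !mulmx_suml; congr (_ *: _ + _).
    by apply: eq_bigr => i _; rewrite -!scalemxAl chif_endo chif_wedge.
  rewrite push_wedge; set A := ANred _.
  have -> : L *m A *m L^T *m G *m w = L *m (A *m (L^T *m G *m w)).
    by rewrite -(mulmxA _ G w) -(mulmxA _ L^T) -(mulmxA L A) (mulmxA L^T G w).
  by rewrite LG (mulmxA A H) ANred_endo.
rewrite E {E} [w in RHS](split_vec hS w Up) -/J -/L.
have Rl a := Rm_linearr hc p a u v.
have RD b c : Rm nabla p u v (b + c) = Rm nabla p u v b + Rm nabla p u v c.
  by rewrite -[b]scale1r Rl !scale1r.
have R0 : Rm nabla p u v 0 = 0.
  by have := RD 0 0; rewrite addr0 => /eqP; rewrite -subr_eq0 opprD addNKr oppr_eq0 => /eqP.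
have RZ s b : Rm nabla p u v (s *: b) = s *: Rm nabla p u v b.
  by rewrite -[s *: b]addr0 Rl R0 addr0.
rewrite RD (Rm_lift hS hn _ _ _ Up) !(sum3 _ 0) !RD !RZ !(Rm_xi hS hn) !nx3.
rewrite -/J -/f -/lc -/gN -/H.
set z := J *m w.
have phL i : L *m (ph i *m z) = phi i p *m (L *m z) by exact: (phi_L hS).
have chw i : chi i *m w = phi i p *m (L *m z)
    - (2 * ev (eta (nx (nx i)) p) w) *: xi (nx i) p
    + (2 * ev (eta (nx i) p) w) *: xi (nx (nx i)) p.
  rewrite chiE [w in phi i p *m w](split_vec hS w Up) -/J -/L -/z mulmxDr.
  rewrite (sum3 _ i) !mulmxDr -!scalemxAr.
  rewrite (phi_xi_same hS) (phi_xi_next hS) (phi_xi_prev hS).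
  by apply/matrixP => r c; rewrite !mxE; ring.
rewrite mulmxBr -!scalemxAr !mulmxDr -!scalemxAr !phL !chw !nx3.
move: (L *m Rm _ _ _ _ _) (phi 0 p *m _) (phi (nx 0) p *m _) (phi (nx (nx 0)) p *m _).
move=> a0 a1 a2 a3; move: (om _ _ _ _ _ _ _) (om _ _ _ _ _ _ _) (om _ _ _ _ _ _ _).
move=> o1 o2 o3.
by apply/matrixP => r c; rewrite !mxE /beta; ring.
Qed.

Definition curv_op : {linear 'M[R]_(d + 3) -> 'M[R]_(d + 3)} := curv_op_fun.

Lemma bip_curv_op w t : bip G (curv_op w) t
  = (alpha * beta) * \sum_i bip G (chif i) w * bip G (chif i) t
    + bip H (ANred (push w)) (push t).
Proof.
rewrite /curv_op /= /curv_op_fun bipDl bipZl bip_lift bip_suml; congr (_ * _ + _).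
by apply: eq_bigr => i _; rewrite bipZl.
Qed.

Lemma curv_opP : is_curvature_operator g nabla p curv_op.
Proof.
have sk w : skew w -> skew (curv_op w).
  move=> sw; apply: skewD.
    by apply: skewZ; apply: skew_sum => i; apply: skewZ; exact: skew_chif.
  by apply: skew_conj; apply: skew_ANred; exact: skew_push.
split=> // [w t sw st|X Y Z V].
  rewrite [RHS](bipC w (curv_op t) sG) [LHS](bip_curv_op w t) [RHS](bip_curv_op t w).
  congr (_ * _ + _).
    by apply: eq_bigr => i _; rewrite mulrC.
  have spw := skew_push sw; have spt := skew_push st.
  rewrite /ANred !bipDl !bipNl !bipZl !bip_suml (co_symmetric coN spw spt).
  rewrite (bipC _ (AN (push t)) sH); congr (_ - _ * _).
  by apply: eq_bigr => i _; rewrite !bipZl mulrC.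
rewrite !smoothvE => sX sY sZ sV.
rewrite (bip_wedge_endo _ _ sG (sk _ (skew_wedge _ _))) curv_op_endo.
by rewrite -(RmE hc sX sY sZ) crv.unlock.
Qed.

Lemma bip_curv_op_self w : skew w -> bip G (curv_op w) w
  = (alpha * beta) * \sum_i bip G (chif i) w ^+ 2
    + bip H (AN (kproj n H ph (push w))) (kproj n H ph (push w)).
Proof.
move=> sw; rewrite bip_curv_op.
have spw := skew_push sw.
rewrite (@bip_kproj _ _ _ _ ph AN (alpha * delta) n_gt0 dn sH uH _ _ _ _ _ _ _ _ spw).
- congr (_ * _ + _).
  rewrite /ANred bipDl bipNl bipZl bip_suml; congr (_ - _ * _).
  by apply: eq_bigr => i _; rewrite bipZl expr2.
- by move=> i; exact: (phiN_skew hS).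
- by move=> i; exact: (phiN_sq hS).
- by move=> i; exact: (phiN_next hS).
- by move=> i; exact: (phiN_prev hS).
- exact: (co_bivector coN).
- exact: (co_symmetric coN).
- by move=> i B; exact: commN.
Qed.

Lemma kproj_skew w : skew w -> skew (kproj n H ph (push w)).
Proof.
move=> sw; apply: skew_kproj; [exact: sH|exact: uH|by move=> i; exact: (phiN_skew hS)|].
exact: skew_push.
Qed.

(** The dual forms of the quaternionic structure are eigenvectors of the
    curvature operator of the base, which determines the sign of [alpha delta]. *)
Lemma AN_kform i : bip H (AN (kform H ph i)) (kform H ph i)
  = 8 * n%:R ^+ 2 * (alpha * delta).
Proof.
apply: (@bip_A_kform_same _ _ _ _ ph AN (alpha * delta) dn sH uH).
- by move=> j; exact: (phiN_skew hS).
- by move=> j; exact: (phiN_sq hS).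
- by move=> j; exact: (phiN_next hS).
- by move=> j; exact: (phiN_prev hS).
- exact: (co_bivector coN).
- by move=> j B; exact: commN.
Qed.

Lemma kform_skew i : skew (kform H ph i).
Proof. by apply: skew_kform; [exact: sH|exact: uH|by move=> j; exact: (phiN_skew hS)]. Qed.

(** Here [s] is the sum of the squares of the [om k], evaluated on [w], and [B] is
    the projection of [w] to the base, off the dual forms of the quaternionic
    structure. *)
Lemma curvature_operator_split : exists2 A, is_curvature_operator g nabla p A &
  forall w, skew w -> exists2 s : R, 0 <= s & exists2 B, skew B &
    bip (g p) (A w) w = alpha * beta * s + bip (gN (f p)) (AN B) B.
Proof.
exists curv_op; first exact: curv_opP.
move=> w sw; exists (\sum_i bip G (chif i) w ^+ 2).
  by apply: sumr_ge0 => i _; exact: sqr_ge0.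
exists (kproj n H ph (push w)); first exact: kproj_skew.
exact: bip_curv_op_self.
Qed.

Lemma base_operator_value : exists2 B, skew B &
  bip (gN (f p)) (AN B) B = 8 * n%:R ^+ 2 * (alpha * delta).
Proof. by exists (kform H ph 0); [exact: kform_skew|exact: AN_kform]. Qed.

End Operator.

(** The plane spanned by two of the [xi] detects the sign of [alpha beta]. *)
Lemma vertical_curvature (R : realType) m (M : manifold R m)
    (phi : 'I_3 -> M -> 'M[R]_m) (xi : 'I_3 -> vfield M)
    (eta : 'I_3 -> M -> 'rV[R]_m) (g : M -> 'M[R]_m) (alpha delta : R)
    (hS : sasaki3 phi xi eta g alpha delta) (nabla : connection M)
    (hn : canonical_connection phi eta g (2 * (delta - 2 * alpha)) nabla)
    (p : M) (A : {linear 'M[R]_m -> 'M[R]_m}) (i : 'I_3) :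
  is_curvature_operator g nabla p A ->
  bip (g p) (A (wedge_vec (xi i p) (xi (nx i) p)))
      (wedge_vec (xi i p) (xi (nx i) p))
  = 4 * (alpha * (2 * (delta - 2 * alpha))).
Proof.
move=> coA; have sx j := smooth_xi hS p j.
have := co_curv coA (X := xi i) (Y := xi (nx i)) (Z := xi i) (V := xi (nx i)).
rewrite !smoothvE => /(_ (sx _) (sx _) (sx _) (sx _)) ->.
have -> : curv nabla (xi i) (xi (nx i)) (xi i) p
    = crv nabla (xi i) (xi (nx i)) (xi i) p by rewrite crv.unlock.
rewrite (RmE (cc_connection hn) (sx _) (sx _) (sx _)) (Rm_xi hS hn).
rewrite !(ipZl, ipDl, ipNl) !(g_xi hS) (eta_xi_same hS) (eta_xi_next hS).
rewrite /om /wedge11 !nx3.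
have := phi_xi_prev hS (nx (nx i)) p; rewrite !nx3 => ->.
rewrite ipNr (g_xi hS) !(eta_xi_same hS) (eta_xi_next hS).
have := eta_xi_prev hS (nx i) p; rewrite !nx3 => ->.
by ring.
Qed.

Theorem theorem2p3 (R : realType) (n : nat) (hn : (1 <= n)%N)
    (M : manifold R (4 * n + 3)%N) (M_nonempty : [set: M] !=set0)
    (phi : 'I_3 -> M -> 'M[R]_(4 * n + 3)%N) (xi : 'I_3 -> vfield M)
    (eta : 'I_3 -> M -> 'rV[R]_(4 * n + 3)%N) (g : M -> 'M[R]_(4 * n + 3)%N)
    (alpha delta : R) (hS : sasaki3 phi xi eta g alpha delta)
    (nabla : connection M)
    (hnabla : canonical_connection phi eta g (2 * (delta - 2 * alpha)) nabla)
    (I : Type) (subm : I -> local_canonical_submersion (4 * n)%N xi g nabla)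
    (subm_cover : forall p, exists i, cs_dom (subm i) p) :
  let beta := 2 * (delta - 2 * alpha) in
  ((forall i, curvature_nonneg (cs_metric (subm i)) (cs_lc (subm i))) ->
     (curvature_nonneg g nabla <-> 0 <= alpha * beta)) /\
  ((forall i, curvature_nonpos (cs_metric (subm i)) (cs_lc (subm i))) ->
     curvature_nonpos g nabla).
Proof.
move=> beta; split=> [nnN|npN].
- split=> [nnM|ab].
    have [p _] := M_nonempty; have [A coA A0] := nnM p.
    have := A0 _ (skew_wedge (xi 0 p) (xi (nx 0) p)).
    by rewrite (vertical_curvature hS hnabla 0 coA) -/beta pmulr_rge0.
  move=> p; have [i Up] := subm_cover p.
  have [AN coN A0] := nnN i (cs_proj (subm i) p).
  have [A coA AE] := curvature_operator_split hn erefl hS hnabla Up coN.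
  exists A => // w sw; have [s s0 [B sB ->]] := AE w sw.
  by apply: addr_ge0; [exact: mulr_ge0|exact: A0].
- move=> p; have [i Up] := subm_cover p.
  have [AN coN A0] := npN i (cs_proj (subm i) p).
  have ad : alpha * delta <= 0.
    have [B sB BE] := base_operator_value erefl hS hnabla Up coN.
    have := A0 _ sB; rewrite BE pmulr_rle0 //.
    by rewrite mulr_gt0 // exprn_gt0 // ltr0n.
  (* [alpha * beta] is [2 * (alpha * delta) - 4 * alpha ^+ 2]. *)
  have ab : alpha * beta <= 0.
    by have := sqr_ge0 alpha; rewrite /beta expr2 => a2; lra.
  have [A coA AE] := curvature_operator_split hn erefl hS hnabla Up coN.
  exists A => // w sw; have [s s0 [B sB ->]] := AE w sw.
  by rewrite -[leRHS]addr0; apply: lerD; [exact: mulr_le0_ge0|exact: A0].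
Qed.
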